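(* Let $n\ge 3$, $m\ge 2$ and $n_1\ge 1$ be integers, let $\varphi_m\in\mathcal C(\overline{\mathbb B^n},\mathbb R^{n_1})$ and $\varphi_k\in\mathcal C(\mathbb S^{n-1},\mathbb R^{n_1})$ for $k\in\{1,\dots,m-1\}$. Suppose $f\in\mathcal C^{2m}(\mathbb B^n,\mathbb R^{n_1})\cap\mathcal C(\overline{\mathbb B^n},\mathbb R^{n_1})$ satisfies $\Delta^m f=\varphi_m$ in $\mathbb B^n$ with the boundary conditions $\Delta^1 f=\varphi_1,\dots,\Delta^{m-1}f=\varphi_{m-1}$ on $\mathbb S^{n-1}$, and put $\varphi_0=f|_{\mathbb S^{n-1}}$. Then for every $x\in\overline{\mathbb B^n}$, $$\left|f(x)-\frac{1-|x|^2}{(1+|x|^2)^{n/2}}P[\varphi_0](0)\right|\le \|\varphi_0\|_\infty\,U(|x|N)+\sum_{k=1}^m\frac{\|\varphi_k\|_\infty}{2n}\left[\frac{n+4}{4n(n+2)}\right]^{k-1}(1-|x|^2).$$ Moreover, the inequality is sharp on $\mathbb S^{n-1}$: for any constant $M>0$ and the mapping $f(x)=(M(1-|x|^{2(m-1)}),0,\dots,0)$, $x\in\overline{\mathbb B^n}$, equality holds at every $x\in\mathbb S^{n-1}$.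
   Context: $\mathbb B^n$ is the open unit ball of $\mathbb R^n$, $\mathbb S^{n-1}=\partial\mathbb B^n$, $|\cdot|$ is the Euclidean norm, $d\sigma$ is the normalized surface measure on $\mathbb S^{n-1}$, $dV$ is Lebesgue measure, $\omega_{n-1}=2\pi^{n/2}/\Gamma(n/2)$. $\Delta^0f=f$, $\Delta^jf=\Delta(\Delta^{j-1}f)$ (componentwise). Sup norms: $\|\varphi_m\|_\infty=\sup_{\mathbb B^n}|\varphi_m|$, and $\|\varphi_k\|_\infty=\sup_{\mathbb S^{n-1}}|\varphi_k|$ for $0\le k\le m-1$. Poisson kernel and integral: $P(x,\zeta)=\frac{1-|x|^2}{|x-\zeta|^n}$, $P[\varphi](x)=\int_{\mathbb S^{n-1}}P(x,\zeta)\varphi(\zeta)\,d\sigma(\zeta)$. $N=(0,\dots,0,1)'$ and $U=P[\mathcal X_{S^+}-\mathcal X_{S^-}]$, where $\mathcal X$ denotes indicator functions, $S^{+}=\{x\in\mathbb S^{n-1}:x_n\ge0\}$, $S^-=\{x\in\mathbb S^{n-1}:x_n\le0\}$; at $|x|=1$, $U(|x|N)=U(N)$ is understood as the boundary value $1$. Green function: $G(x,y)=\frac{1}{(n-2)\omega_{n-1}}\left(\frac1{|x-y|^{n-2}}-\frac1{[x,y]^{n-2}}\right)$, with $[x,y]=(1-2\langle x,y\rangle+|x|^2|y|^2)^{1/2}$. Boundary conditions and solutions: the condition $\Delta^jf=\varphi_j$ on $\mathbb S^{n-1}$ means that, with $f_r(x)=f(rx)$, $\lim_{r\to1^-}\Delta^jf_r(\zeta)=\varphi_j(\zeta)$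 for $\zeta\in\mathbb S^{n-1}$. Standing convention: the solutions of the boundary value problem are the mappings given by $$f(x)=P[\varphi_0](x)+\sum_{k=1}^m(-1)^kG_k[\varphi_k](x),\quad x\in\mathbb B^n,$$ where, writing $\mathcal G[h](x)=\int_{\mathbb B^n}G(x,y)h(y)\,dV(y)$, $G_k[\varphi_k]=\mathcal G^{k}\big[P[\varphi_k]\big]$ ($k$-fold iterate of $\mathcal G$) for $1\le k\le m-1$, and $G_m[\varphi_m]=\mathcal G^m[\varphi_m]$. *)

(* Defs.v *)
From HB Require Import structures.
From mathcomp Require Import all_boot all_order all_algebra.
From mathcomp Require Import all_classical all_reals all_analysis.
From mathcomp Require Import measurable_realfun.

Set Implicit Arguments.
Unset Strict Implicit.
Unset Printing Implicit Defensive.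
Import Order.TTheory GRing.Theory Num.Theory.
Import numFieldNormedType.Exports.

Local Open Scope classical_set_scope.
Local Open Scope ring_scope.

(* 'rV[R]_n is given the sigma-algebra generated by the coordinates, which is
   the Borel one. *)
Section rV_measurable.
Context {R : realType}.
Variable n : nat.

Definition rV_coord (i : 'I_n) (x : 'rV[R]_n) : R := x 0 i.

Let rV_set0 : g_sigma_preimage rV_coord set0.
Proof. exact: sigma_algebra0. Qed.

Let rV_setC A : g_sigma_preimage rV_coord A -> g_sigma_preimage rV_coord (~` A).
Proof. exact: sigma_algebraC. Qed.

Let rV_bigcup (F : (set 'rV[R]_n)^nat) :
  (forall i, g_sigma_preimage rV_coord (F i)) ->
  g_sigma_preimage rV_coord (\bigcup_i (F i)).
Proof. exact: sigma_algebra_bigcup. Qed.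

HB.instance Definition _ :=
  @isMeasurable.Build (measure_tuple_display default_measure_display)
    'rV[R]_n (g_sigma_preimage rV_coord) rV_set0 rV_setC rV_bigcup.

Lemma measurable_rV_coord (i : 'I_n) : measurable_fun setT (rV_coord i).
Proof.
move=> _ Y mY; rewrite setTI; apply: sub_sigma_algebra => /=.
rewrite -bigcup_seq/=; exists i => /=; first by rewrite mem_index_enum.
by exists Y => //; rewrite setTI.
Qed.

Lemma measurable_fun_rVP d (T : measurableType d) (f : T -> 'rV[R]_n) :
  (forall i, measurable_fun setT (rV_coord i \o f)) -> measurable_fun setT f.
Proof.
move=> mf.
have prefS : g_sigma_preimage (fun i => rV_coord i \o f) `<=` measurable.
  apply: smallest_sub; first exact: sigma_algebra_measurable.
  move=> A; rewrite -bigcup_seq/= => -[i _ [B mB <-]].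
  exact: mf.
move=> _ A mA; apply: prefS.
by rewrite g_sigma_preimage_comp; exists A.
Qed.

End rV_measurable.

Section rV_lebesgue.
Context {R : realType}.

Definition rV_cons n (p : R * 'rV[R]_n) : 'rV[R]_n.+1 :=
  row_mx (const_mx p.1 : 'rV_1) p.2.

Definition rV_uncons n (x : 'rV[R]_n.+1) : R * 'rV[R]_n :=
  (x 0 0, \row_i x 0 (lift ord0 i)).

Lemma rV_consK n : cancel (@rV_uncons n) (@rV_cons n).
Proof.
move=> x; apply/rowP => i; rewrite /rV_cons /rV_uncons mxE.
case: split_ordP => j -> /=; rewrite !mxE; congr (x _ _); apply/val_inj => //=.
by rewrite (ord1 j).
Qed.

Lemma rV_unconsK n : cancel (@rV_cons n) (@rV_uncons n).
Proof.
move=> [a x]; rewrite /rV_uncons; congr (_, _).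
  rewrite (_ : 0 = lshift n 0 :> 'I_(1 + n)); last exact/val_inj.
  by apply: etrans (row_mxEl _ _ _ _) _; rewrite mxE.
apply/rowP => i; rewrite mxE.
rewrite (_ : lift ord0 i = rshift 1 i :> 'I_(1 + n)); last exact/val_inj.
exact: row_mxEr.
Qed.

Lemma measurable_rV_cons n : measurable_fun setT (@rV_cons n).
Proof.
apply: measurable_fun_rVP => i.
case: (split_ordP (i : 'I_(1 + n))) => j ij.
  rewrite (_ : _ \o _ = fst) //; apply/funext => p /=.
  by rewrite /rV_coord ij; apply: etrans (row_mxEl _ _ _ _) _; rewrite mxE.
rewrite (_ : _ \o _ = rV_coord j \o snd).
  by apply: measurableT_comp => //; exact: measurable_rV_coord.
by apply/funext => p /=; rewrite /rV_coord ij; exact: row_mxEr.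
Qed.

Lemma measurable_rV_uncons n : measurable_fun setT (@rV_uncons n).
Proof.
apply/measurable_fun_pairP; split; first exact: (measurable_rV_coord ord0).
apply: measurable_fun_rVP => i.
rewrite (_ : _ \o _ = rV_coord (lift ord0 i)); first exact: measurable_rV_coord.
by apply/funext => x /=; rewrite /rV_coord /= mxE.
Qed.

Section cons_measure.
Variables (n : nat) (m : {sigma_finite_measure set 'rV[R]_n -> \bar R}).

Definition cons_measure : set 'rV[R]_n.+1 -> \bar R :=
  pushforward ((@lebesgue_measure R) \x m)%E (@rV_cons n).

Let cons_measure0 : cons_measure set0 = 0%E.
Proof. by rewrite /cons_measure /pushforward preimage_set0 measure0. Qed.

Let cons_measure_ge0 A : (0 <= cons_measure A)%E.
Proof. by rewrite /cons_measure /pushforward; exact: measure_ge0. Qed.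

Let cons_measure_sigma_additive : semi_sigma_additive cons_measure.
Proof.
by apply: measure_semi_sigma_additive; exact: measurable_rV_cons.
Qed.

HB.instance Definition _ := isMeasure.Build _ _ _ cons_measure
  cons_measure0 cons_measure_ge0 cons_measure_sigma_additive.

Let cons_measure_sigma_finite : sigma_finite setT cons_measure.
Proof.
have /sigma_finiteP[F [TF ndF Foo]] := sigma_finiteT (@lebesgue_measure R).
have /sigma_finiteP[G [TG ndG Goo]] := sigma_finiteT m.
exists (fun k => @rV_uncons n @^-1` (F k `*` G k)).
  rewrite -preimage_bigcup (_ : \bigcup_k _ = setT) ?preimage_setT//.
  rewrite -subTset => -[a x] _.
  have [k _ Fa] : (\bigcup_k F k) a by rewrite -TF.
  have [l _ Gx] : (\bigcup_k G k) x by rewrite -TG.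
  exists (maxn k l) => //; split => /=.
  - by move: a Fa; exact/subsetPset/ndF/leq_maxl.
  - by move: x Gx; exact/subsetPset/ndG/leq_maxr.
move=> k; have [mF mFoo] := Foo k; have [mG mGoo] := Goo k; split.
  rewrite -[X in measurable X]setTI; apply: measurable_rV_uncons => //.
  exact: measurableX.
rewrite /cons_measure /pushforward -comp_preimage.
rewrite (_ : @rV_uncons n \o _ = id); last first.
  by apply/funext => p; exact: rV_unconsK.
by rewrite preimage_id product_measure1E// lte_mul_pinfty// ge0_fin_numE.
Qed.

HB.instance Definition _ := Measure_isSigmaFinite.Build _ _ _ cons_measure
  cons_measure_sigma_finite.

End cons_measure.

Fixpoint rV_lebesgue n : {sigma_finite_measure set 'rV[R]_n -> \bar R} :=
  match n with
  | 0 => \d_(0 : 'rV[R]_0)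
  | n'.+1 => cons_measure (rV_lebesgue n')
  end.

End rV_lebesgue.

Section euclidean.
Context {R : realType}.
Variable n : nat.
Implicit Types x y : 'rV[R]_n.

(* The norm of the library on 'rV[R]_n is the sup norm; it induces the same
   topology, but the statement is about the Euclidean norm. *)
Definition dotp x y : R := \sum_(i < n) x 0 i * y 0 i.
Definition enorm x : R := Num.sqrt (dotp x x).

Definition oball : set 'rV[R]_n := [set x | enorm x < 1].
Definition cball : set 'rV[R]_n := [set x | enorm x <= 1].
Definition sphere : set 'rV[R]_n := [set x | enorm x = 1].

Lemma measurable_enorm : measurable_fun setT enorm.
Proof.
have msqrt : measurable_fun [set: R] (@Num.sqrt R).
  by apply: continuous_measurable_fun; exact: sqrt_continuous.
apply: (measurableT_comp msqrt).
by apply: measurable_sum => i; apply: measurable_funM; exact: measurable_rV_coord.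
Qed.

Lemma measurable_oball : measurable oball.
Proof.
rewrite (_ : oball = enorm @^-1` `]-oo, 1[); last first.
  by apply/seteqP; split => x /=; rewrite in_itv.
by rewrite -[X in measurable X]setTI; exact: measurable_enorm.
Qed.

Definition normalize x : 'rV[R]_n := (enorm x)^-1 *: x.

Lemma measurable_normalize : measurable_fun setT normalize.
Proof.
apply: measurable_fun_rVP => i.
rewrite (_ : _ \o _ = (fun x => enorm x `^ (-1) * rV_coord i x)); last first.
  by apply/funext => x; rewrite /= /rV_coord mxE powR_inv1// sqrtr_ge0.
apply: measurable_funM; last exact: measurable_rV_coord.
by apply: (measurableT_comp (measurable_powR (-1))); exact: measurable_enorm.
Qed.

(* Normalized surface measure, defined by cones: the measure of A is the
   proportion of the volume of the unit ball taken by the y with y / |y| in A.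
   The origin, where normalize is 0, is not sent to the sphere. *)
Definition surface_measure : set 'rV[R]_n -> \bar R := fun A =>
  ((fine (rV_lebesgue n oball))^-1%:E *
   rV_lebesgue n (oball `&` normalize @^-1` A))%E.

Let surface_measure0 : surface_measure set0 = 0%E.
Proof. by rewrite /surface_measure preimage_set0 setI0 measure0 mule0. Qed.

Let surface_measure_ge0 A : (0 <= surface_measure A)%E.
Proof. by rewrite mule_ge0// lee_fin invr_ge0 fine_ge0. Qed.

Let surface_measure_sigma_additive : semi_sigma_additive surface_measure.
Proof.
move=> F mF tF mUF; rewrite /surface_measure.
have mP (A : set 'rV[R]_n) : measurable A ->
    measurable (oball `&` normalize @^-1` A).
  move=> mA; apply: measurableI; first exact: measurable_oball.
  by rewrite -[X in measurable X]setTI; exact: measurable_normalize.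
rewrite [X in X @ \oo --> _](_ : _ = (fun k =>
    (fine (rV_lebesgue n oball))^-1%:E * \sum_(0 <= i < k)
      rV_lebesgue n (oball `&` normalize @^-1` F i))%E); last first.
  by apply/funext => k; rewrite ge0_sume_distrr.
apply: cvgeZl => //.
rewrite preimage_bigcup setI_bigcupr.
apply: measure_semi_sigma_additive => //.
- by move=> i; exact: mP.
- apply/trivIset_setIl/trivIsetP => i j _ _ ij; rewrite -preimage_setI.
  by move/trivIsetP : tF => /(_ _ _ _ _ ij) ->//; rewrite preimage_set0.
- by rewrite -setI_bigcupr -preimage_bigcup; exact: mP.
Qed.

HB.instance Definition _ := isMeasure.Build _ _ _ surface_measure
  surface_measure0 surface_measure_ge0 surface_measure_sigma_additive.

End euclidean.

Arguments oball {R n} _.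
Arguments cball {R n} _.
Arguments sphere {R n} _.
Arguments surface_measure {R} n _.

Section differential.
Context {R : realType}.
Variables n n1 : nat.
Implicit Types f : 'rV[R]_n -> 'rV[R]_n1.

Definition basis_vec (i : 'I_n) : 'rV[R]_n := delta_mx 0 i.

Definition partials (s : seq 'I_n) f : 'rV[R]_n -> 'rV[R]_n1 :=
  foldr (fun i g => 'D_(basis_vec i) g) f s.

(* f is of class C^k on the open set D: all iterated partial derivatives of
   order at most k exist and are continuous on D. *)
Definition smooth_on (k : nat) (D : set 'rV[R]_n) f : Prop :=
  forall s : seq 'I_n,
    ((size s <= k)%N -> forall x, D x -> {for x, continuous (partials s f)}) /\
    ((size s < k)%N -> forall x i, D x ->
       derivable (partials s f) x (basis_vec i)).

Definition laplacian f : 'rV[R]_n -> 'rV[R]_n1 := fun x =>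
  \sum_(i < n) 'D_(basis_vec i) ('D_(basis_vec i) f) x.

End differential.

Section potentials.
Context {R : realType}.
Variable n : nat.
Implicit Types x y z : 'rV[R]_n.

Definition poisson_kernel x z : R := (1 - enorm x ^+ 2) / enorm (x - z) ^+ n.

Definition poisson (u : 'rV[R]_n -> R) x : R :=
  \int[surface_measure n]_(z in sphere) (poisson_kernel x z * u z).

Definition north : 'rV[R]_n := \row_i (i.+1 == n)%:R.

Definition north_cap : set 'rV[R]_n :=
  [set z | sphere z /\ forall i : 'I_n, i.+1 = n -> 0 <= z 0 i].
Definition south_cap : set 'rV[R]_n :=
  [set z | sphere z /\ forall i : 'I_n, i.+1 = n -> z 0 i <= 0].

Definition cap_sign z : R := \1_north_cap z - \1_south_cap z.

(* U = P[cap_sign] in the ball, extended by its boundary values; in particular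
   capU (north n) = 1. *)
Definition capU x : R := if enorm x < 1 then poisson cap_sign x else cap_sign x.

Definition Gamma (a : R) : R :=
  \int[lebesgue_measure]_(t in `]0, +oo[) (t `^ (a - 1) * expR (- t)).

(* The area of the unit sphere of dimension n - 1. *)
Definition sphere_area : R := 2 * pi `^ (n%:R / 2) / Gamma (n%:R / 2).

Definition bracket x y : R :=
  Num.sqrt (1 - 2 * dotp x y + enorm x ^+ 2 * enorm y ^+ 2).

Definition green_kernel x y : R :=
  ((n%:R - 2) * sphere_area)^-1 *
  ((enorm (x - y) ^+ (n - 2))^-1 - (bracket x y ^+ (n - 2))^-1).

Section vector_valued.
Variable n1 : nat.
Implicit Types h phi : 'rV[R]_n -> 'rV[R]_n1.

Definition poissonV phi x : 'rV[R]_n1 := \row_j poisson (fun z => phi z 0 j) x.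

Definition green h x : 'rV[R]_n1 :=
  \row_j \int[rV_lebesgue n]_(y in oball) (green_kernel x y * h y 0 j).

Definition sup_norm (D : set 'rV[R]_n) h : R := sup [set enorm (h x) | x in D].

End vector_valued.
End potentials.

Arguments north {R} n.

Section boundary_value_problem.
Context {R : realType}.
Variables n m n1 : nat.

(* The data are indexed by 0, ..., m: phi m lives on the ball, and phi k lives
   on the sphere for k < m. *)
Implicit Types (phi : nat -> 'rV[R]_n -> 'rV[R]_n1).
Implicit Types (f : 'rV[R]_n -> 'rV[R]_n1).

Definition data_norm phi (k : nat) : R :=
  if k == m then sup_norm oball (phi m) else sup_norm sphere (phi k).

Definition green_term phi (k : nat) : 'rV[R]_n -> 'rV[R]_n1 :=
  if k == m then iter m (@green R n n1) (phi m)
  else iter k (@green R n n1) (poissonV (phi k)).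

(* The boundary values are only radial limits, which do not determine f in
   general; as a convention, the solutions are those given by the
   Poisson-Green representation bvp_representation. *)
Record bvp_solution phi f : Prop := BVPSolution {
  bvp_data_ball : {within cball, continuous (phi m)};
  bvp_data_sphere : forall k, (1 <= k < m)%N ->
    {within sphere, continuous (phi k)};
  bvp_smooth : smooth_on (2 * m) oball f;
  bvp_continuous : {within cball, continuous f};
  bvp_equation : forall x, oball x -> iter m (@laplacian R n n1) f x = phi m x;
  bvp_boundary : forall j, (1 <= j < m)%N -> forall z, sphere z ->
    iter j (@laplacian R n n1) (fun x => f (r *: x)) z @[r --> (1 : R)^'-]
      --> phi j z;
  bvp_trace : forall z, sphere z -> phi 0%N z = f z;
  bvp_representation : forall x, oball x ->
    f x = poissonV (phi 0%N) x +
      \sum_(1 <= k < m.+1) (-1) ^+ k *: green_term phi k x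
}.

End boundary_value_problem.

(* Main.v *)
(* By the Poisson-Green representation it suffices to bound each potential.
   For |x| < 1 put c = (1 - |x|^2) / (1 + |x|^2)^(n/2). The Poisson kernel
   P(x, .) exceeds c exactly on the half-sphere around x, so
   |P[phi_0](x) - c P[phi_0](0)| is at most |phi_0| times the integral of
   |P(x, .) - c|; a reflection moves x to |x| N, where this integral is
   U(|x| N), because the constant c integrates to 0 against the odd function
   X_{S+} - X_{S-}. The Green potential of |y|^(2j) is an explicit polynomial
   in |x|^2; in particular G[1] = (1 - |x|^2) / (2n), and G[1 - |y|^2] is at
   most (n + 4) / (4n(n + 2)) (1 - |x|^2), which is then iterated.

   The spherical means of the Poisson and Newtonian kernels that this requires
   are obtained without differentiation under the integral: both are values of
   one family of kernels, whose integral over a thin shell is computed in polar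
   coordinates centred at x rather than at 0.

   On the sphere both sides of the sharpness claim are 0, so its content is that
   a polynomial in |x|^2 vanishing on the sphere is given by the representation.
   On such polynomials the Green potential inverts the Laplacian up to sign and
   a constant, and the alternating sum telescopes. *)

Require Import Defs.
From HB Require Import structures.
From mathcomp Require Import all_boot all_order all_algebra.
From mathcomp Require Import all_classical all_reals all_analysis.
From mathcomp Require Import measurable_realfun gauss_integral.
From mathcomp Require Import ring lra.

Set Implicit Arguments.
Unset Strict Implicit.
Unset Printing Implicit Defensive.
Import Order.TTheory GRing.Theory Num.Theory.
Import numFieldNormedType.Exports.

Local Open Scope classical_set_scope.
Local Open Scope ring_scope.


(** * Lebesgue integrals over R^n *)

(** The kernels are K_c(x, y) = (|y - x|^2 + 2c <y - x, x>) / |y - x|^n with 0 <= c <= 1. Put y = x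
    + rz with |z| = 1: the weight r^(n-1) cancels the pole and leaves r + 2c <x, z> along the ray,
    whose integral across the shell R1 < |y| < R2 is (R2^2 - R1^2)/2 plus a term odd in z. The
    integral over the shell thus depends neither on x nor on c. In polar coordinates centred at 0 it
    is an integral of means over spheres, so by continuity the mean over |y| = r is r^(2-n) whenever
    |x| < r.

    Three facts about the measures have to precede this. Lebesgue measure is an iterated product
    along the axes, so its invariance under reflections is derived from translation invariance, with
    the unit ball as test set. The surface measure is given by cones, so polar coordinates come from
    Tonelli's theorem and scaling. The Green kernel is normalized through Gamma, so n times the
    volume of the ball must be identified with 2 pi^(n/2) / Gamma(n/2); the Gaussian integral gives
    both this and the finiteness of the volume. *)

Section curried_tonelli.
Local Open Scope ereal_scope.
Context d1 d2 (T1 : measurableType d1) (T2 : measurableType d2) (R : realType).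
Variables (m1 : {sigma_finite_measure set T1 -> \bar R})
  (m2 : {sigma_finite_measure set T2 -> \bar R}).
Variable f : T1 -> T2 -> \bar R.
Hypothesis mf : measurable_fun setT (fun p : T1 * T2 => f p.1 p.2).
Hypothesis f0 : forall x y, 0 <= f x y.

Lemma measurable_ge0_integral2 : measurable_fun setT (fun x => \int[m2]_y f x y).
Proof.
have H := @measurable_fun_fubini_tonelli_F _ _ _ _ _ m2 (fun p => f p.1 p.2) mf.
by apply: H => -[x y] /=.
Qed.

Lemma ge0_integral_swap :
  \int[m1]_x \int[m2]_y f x y = \int[m2]_y \int[m1]_x f x y.
Proof.
have H := @fubini_tonelli _ _ _ _ _ m1 m2 (fun p => f p.1 p.2) mf.
by apply: H => -[x y] /=.
Qed.

End curried_tonelli.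

(** * Affine substitutions on the line and in R^n *)

Section lebesgue_affine.
Local Open Scope ereal_scope.
Context {R : realType}.
Implicit Types (f : R -> \bar R).

(** The right-hand side is a measure in A that gives every []u, v]] its length, and Lebesgue measure
    is the only one. *)
Lemma lebesgue_measure_affine (s a : R) (A : set R) : (0 < s)%R ->
  measurable A ->
  lebesgue_measure A = s%:E * lebesgue_measure ((fun x => s * x + a)%R @^-1` A).
Proof.
move=> s0 mA.
pose phi : measurableTypeR R -> measurableTypeR R := (fun x => s * x + a)%R.
have mphi : measurable_fun setT phi.
  by apply: measurable_funD => //; apply: measurable_funM.
pose sn : {nonneg R} := NngNum (ltW s0).
pose mu : {measure set (measurableTypeR R) ->
    \bar R} := mscale sn (pushforward lebesgue_measure phi).
rewrite [LHS](lebesgue_measure_unique (mu := mu mphi))// => _ [[u v]] _ <-.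
rewrite /mu /= /mscale /= /pushforward.
have -> : phi @^-1` `]u, v] = `]((u - a) / s)%R, ((v - a) / s)%R]%classic.
  apply/seteqP; split => x /=; rewrite !in_itv /= /phi.
    by move=> /andP[h1 h2]; rewrite ltr_pdivrMr// ler_pdivlMr// (mulrC x);
        apply/andP; split; lra.
  by rewrite ltr_pdivrMr// ler_pdivlMr// (mulrC x) => /andP[h1 h2]; apply/andP;
      split; lra.
rewrite !lebesgue_measure_itv /= !lte_fin ltr_pM2r ?invr_gt0// ltrD2r.
case: ifPn => _; last by rewrite mule0.
by rewrite -!EFinB -EFinM; congr EFin; field; rewrite gt_eqF.
Qed.

Lemma ge0_integral_affine (s a : R) f : (0 < s)%R ->
  measurable_fun setT f -> (forall x, 0 <= f x) ->
  \int[lebesgue_measure]_x f (s * x + a)%R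
  = s^-1%:E * \int[lebesgue_measure]_x f x.
Proof.
move=> s0 mf f0.
pose phi : measurableTypeR R -> measurableTypeR R := (fun x => s * x + a)%R.
have mphi : measurable_fun setT phi.
  by apply: measurable_funD => //; apply: measurable_funM.
pose sn : {nonneg R} := NngNum (ltW s0).
pose nu : {measure set (measurableTypeR R) ->
    \bar R} := pushforward lebesgue_measure phi.
have -> : \int[lebesgue_measure]_x f x = \int[mscale sn (nu mphi)]_x f x.
  apply: eq_measure_integral => A mA _; exact: lebesgue_measure_affine.
rewrite ge0_integral_mscale// muleA -EFinM mulVf ?gt_eqF// mul1e.
by rewrite /nu ge0_integral_pushforward.
Qed.

End lebesgue_affine.

Section rV_lebesgue_affine.
Local Open Scope ereal_scope.
Context {R : realType}.

Lemma ge0_integral_rV_cons n (f : 'rV[R]_n.+1 -> \bar R) :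
  measurable_fun setT f -> (forall x, 0 <= f x) ->
  \int[rV_lebesgue n.+1]_x f x =
  \int[lebesgue_measure]_t \int[rV_lebesgue n]_x f (rV_cons (t, x)).
Proof.
move=> mf f0; rewrite /= /cons_measure.
rewrite ge0_integral_pushforward//; last exact: measurable_rV_cons.
rewrite preimage_setT fubini_tonelli1//=.
by apply: measurableT_comp => //; exact: measurable_rV_cons.
Qed.

Lemma measurable_fun_rV_affine n (s : R) (a : 'rV[R]_n) :
  measurable_fun setT (fun x : 'rV[R]_n => s *: x + a)%R.
Proof.
apply: measurable_fun_rVP => i.
rewrite (_ : _ \o _ = fun x => s * rV_coord i x + a ord0 i)%R; last first.
  by apply/funext => x; rewrite /= /rV_coord !mxE.
by apply: measurable_funD => //; apply: measurable_funM => //;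
    exact: measurable_rV_coord.
Qed.

Lemma measurable_rV_cons2 n (t : R) : measurable_fun setT (fun x : 'rV[R]_n =>
    rV_cons (t, x)).
Proof.
by apply: (measurableT_comp (@measurable_rV_cons _ _)); apply: measurable_fun_pair.
Qed.

(** Induction on the dimension: the first coordinate contributes one factor 1/s by the substitution
    on the line, the remaining ones s^-n by the induction hypothesis. *)
Lemma ge0_integral_rV_affine n (s : R) (a : 'rV[R]_n) (f : 'rV[R]_n -> \bar R) :
  (0 < s)%R -> measurable_fun setT f -> (forall x, 0 <= f x) ->
  \int[rV_lebesgue n]_x f (s *: x + a)%R
  = (s ^- n)%:E * \int[rV_lebesgue n]_x f x.
Proof.
move=> s0; elim: n a f => [|n IH] a f mf f0.
  rewrite expr0 invr1 mul1e; apply: eq_integral => x _.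
  by congr f; rewrite [LHS]thinmx0 [RHS]thinmx0.
have mf' : measurable_fun setT (fun x : 'rV[R]_n.+1 => f (s *: x + a)%R).
  by apply: measurableT_comp => //; exact: measurable_fun_rV_affine.
rewrite ge0_integral_rV_cons// [in RHS]ge0_integral_rV_cons//.
transitivity (\int[lebesgue_measure]_t ((s ^- n)%:E *
    \int[rV_lebesgue n]_x f (rV_cons (s * t + a ord0 ord0, x)%R))).
  apply: eq_integral => t _.
  rewrite -(IH (\row_i a ord0 (lift ord0 i)))//; last first.
    by apply: measurableT_comp => //; exact: measurable_rV_cons2.
  apply: eq_integral => x _; congr f.
  rewrite -[LHS]rV_consK; congr rV_cons; rewrite /rV_uncons; congr (_, _).
    by rewrite !mxE; case: split_ordP => j // _; rewrite !mxE.
  apply/rowP => i; rewrite !mxE; case: split_ordP => j ij.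
    by move/(congr1 val): ij => /=; have := ltn_ord j; case: (val j).
  by rewrite (_ : i = j)//; apply/val_inj; move/(congr1 val): ij => /= [].
have mF : measurable_fun setT
   (fun t => \int[rV_lebesgue n]_x f (rV_cons (t, x))).
  apply: (@measurable_ge0_integral2 _ _ _ _ _ (rV_lebesgue n)) => //.
  apply: measurableT_comp => //.
  rewrite (_ : (fun _ => _) = @rV_cons R n); first exact: measurable_rV_cons.
  by apply/funext => -[].
rewrite ge0_integralZl_EFin//; last 3 first.
- by move=> t _; apply: integral_ge0.
- apply: (measurableT_comp mF).
  by apply: measurable_funD => //; apply: measurable_funM.
- by rewrite invr_ge0 exprn_ge0// ltW.
rewrite (@ge0_integral_affine _ s (a ord0 ord0)
  (fun t => \int[rV_lebesgue n]_x f (rV_cons (t, x))))//; last first.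
  by move=> t; apply: integral_ge0.
by rewrite muleA -EFinM -invfM exprSr.
Qed.

Lemma ge0_integral_rV_shift n (a : 'rV[R]_n) (f : 'rV[R]_n -> \bar R) :
  measurable_fun setT f -> (forall x, 0 <= f x) ->
  \int[rV_lebesgue n]_x f (x + a)%R = \int[rV_lebesgue n]_x f x.
Proof.
move=> mf f0; have := ge0_integral_rV_affine a ltr01 mf f0.
by rewrite expr1n invr1 mul1e => <-; apply: eq_integral => x _; rewrite scale1r.
Qed.

Lemma ge0_integral_rV_scale n (s : R) (f : 'rV[R]_n -> \bar R) :
  (0 < s)%R -> measurable_fun setT f -> (forall x, 0 <= f x) ->
  \int[rV_lebesgue n]_x f (s *: x)%R = (s ^- n)%:E * \int[rV_lebesgue n]_x f x.
Proof.
move=> s0 mf f0; rewrite -(ge0_integral_rV_affine 0%R)//.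
by apply: eq_integral => x _; rewrite addr0.
Qed.

End rV_lebesgue_affine.

(** * Fundamental theorem of calculus and measurability on the line *)

Section integral_tools.
Context {R : realType}.

(** Puts the domain into the integrand as a factor, so that integrals over different sets can be
    compared pointwise or swapped. *)
Lemma integral_EFin_indic d (T : measurableType d)
    (mu : {measure set T -> \bar R}) (D : set T) (f : T -> R) :
  (\int[mu]_(x in D) (f x)%:E = \int[mu]_x (\1_D x * f x)%:E)%E.
Proof.
rewrite integral_mkcond; apply: eq_integral => x _.
by rewrite patchE indicE; case: ifPn => _; rewrite ?mul1r ?mul0r.
Qed.

Local Notation mu := (@lebesgue_measure R).

Lemma integral_itvcc_FTC (F f : R -> R) a b : (a <= b)%R ->
  (forall x, (a <= x <= b)%R -> {for x, continuous f}) ->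
  (forall x, (a <= x <= b)%R -> {for x, continuous F}) ->
  (forall x, (a < x < b)%R -> is_derive x (1:R) F (f x)) ->
  (\int[mu]_(x in `[a, b]) (f x)%:E)%E = (F b - F a)%:E.
Proof.
rewrite le_eqVlt => /predU1P[-> *|ab cf cF dF].
  by rewrite set_itv1 integral_set1 subrr.
rewrite (@continuous_FTC2 _ _ F)//.
- apply/continuous_within_itvP => //; split.
  + by move=> x /[!in_itv]/= /andP[? ?]; apply: cf; rewrite !ltW.
  + by apply: cvg_at_right_filter; apply: cf; rewrite lexx ltW.
  + by apply: cvg_at_left_filter; apply: cf; rewrite lexx ltW.
- split.
  + by move=> x /[!in_itv]/= /dF[].
  + by apply: cvg_at_right_filter; apply: cF; rewrite lexx ltW.
  + by apply: cvg_at_left_filter; apply: cF; rewrite lexx ltW.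
- by move=> x /[!in_itv]/= /dF[? <-]; rewrite derive1E.
Qed.

Lemma integral_itvcy_FTC (F f : R -> R) a l :
  (forall x, (a <= x)%R -> (0 <= f x)%R) ->
  (forall x, (a <= x)%R -> {for x, continuous f}) ->
  (forall x, (a <= x)%R -> is_derive x (1:R) F (f x)) ->
  F x @[x --> +oo%R] --> l ->
  (\int[mu]_(x in `[a, +oo[) (f x)%:E)%E = (l - F a)%:E.
Proof.
move=> f0 cf dF Fl.
rewrite (@ge0_continuous_FTC2y _ _ F _ l)//.
- apply/continuous_within_itvcyP; split.
  + by move=> x /[!in_itv]/= /andP[? ?]; apply: cf; rewrite !ltW.
  + by apply: cvg_at_right_filter; apply: cf; rewrite lexx.
- by move=> x /ltW/dF[].
- apply: cvg_at_right_filter; apply/differentiable_continuous/derivable1_diffP.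
  by have [] := dF _ (lexx a).
- by move=> x /[!in_itv]/= /andP[/ltW/dF[? <-] _]; rewrite derive1E.
Qed.

Lemma integral_expN_tail (s : R) :
  (\int[mu]_(t in `[s, +oo[) (expR (- t))%:E)%E = (expR (- s))%:E.
Proof.
transitivity ((0 - (- expR (- s)))%:E : \bar R);
    [apply: (@integral_itvcy_FTC (fun t => - expR (- t))%R _ _ 0)|].
- by move=> x _; exact: expR_ge0.
- by move=> x _; apply: continuous_comp; [exact: opp_continuous|exact: continuous_expR].
- move=> x _.
  have h1 : is_derive x (1:R) (expR \o -%R) (expR (- x) * (-1)).
    exact: is_derive1_comp.
  by have := is_deriveN h1; rewrite mulrN1 opprK.
- by rewrite -oppr0; apply: cvgN; exact: cvgr_expR.
- by rewrite sub0r opprK.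
Qed.

Lemma continuous_sqrtX n (x : R) : {for x, continuous (fun t : R => Num.sqrt t ^+ n)}.
Proof.
apply: (@continuous_comp _ _ _ Num.sqrt (fun t : R => t ^+ n)%R).
  exact: sqrt_continuous.
exact: exprn_continuous.
Qed.

(** The half-integer powers t^(n/2) are written as [Num.sqrt t ^+ n]; the shift by two keeps the
    exponent of the derivative natural. *)
Lemma is_derive_sqrtX n (x : R) : (0 < x)%R ->
  is_derive x (1:R) (fun t : R => Num.sqrt t ^+ n.+2)%R
    (n.+2%:R / 2 * Num.sqrt x ^+ n)%R.
Proof.
move=> x0; have H := is_derive1_sqrt x0.
have h2 := @is_deriveX _ _ _ n.+2 _ _ _ H.
have -> : (fun t : R => Num.sqrt t ^+ n.+2) = (@Num.sqrt R) ^+ n.+2.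
  by apply/funext => t; rewrite exprfctE.
apply: (is_derive_eq h2).
rewrite /= /GRing.scale /= invfM [_ ^+ n.+1]exprSr.
by field; rewrite gt_eqF// sqrtr_gt0.
Qed.

Lemma measurable_expN : measurable_fun setT (fun t : R => expR (- t)).
Proof.
by apply: measurableT_comp => //; exact: measurable_expR.
Qed.

Lemma measurable_sqrt d (T : measurableType d) (f : T -> R) :
  measurable_fun setT f -> measurable_fun setT (fun x => Num.sqrt (f x)).
Proof.
move=> mf; have h : measurable_fun [set: R] (@Num.sqrt R).
  by apply: continuous_measurable_fun; exact: sqrt_continuous.
exact: (measurableT_comp h).
Qed.

Lemma measurable_indic_lt d (T : measurableType d) (f g : T -> R) :
  measurable_fun setT f -> measurable_fun setT g ->
  measurable_fun setT (fun x => ((f x < g x)%R%:R : R)).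
Proof.
move=> mf mg.
have h := measurable_fun_ltr mf mg.
rewrite (_ : (fun x => _) = fun x => if f x < g x then 1 else 0); last first.
  by apply/funext => x; case: ifP.
exact: measurable_fun_ifT.
Qed.

End integral_tools.

(** * Measurability of Euclidean expressions *)

Section euclidean_measurability.
Context {R : realType} d (T : measurableType d) (n : nat).
Implicit Types f g : T -> 'rV[R]_n.

Lemma measurable_dotp f g : measurable_fun setT f -> measurable_fun setT g ->
  measurable_fun setT (fun t => dotp (f t) (g t)).
Proof.
move=> mf mg; apply: measurable_sum => i; apply: measurable_funM.
  exact: (measurableT_comp (measurable_rV_coord i) mf).
exact: (measurableT_comp (measurable_rV_coord i) mg).
Qed.

Lemma measurable_fun_rVD f g : measurable_fun setT f -> measurable_fun setT g ->
  measurable_fun setT (fun t => f t + g t).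
Proof.
move=> mf mg; apply: measurable_fun_rVP => i.
rewrite (_ : _ \o _ = fun t => rV_coord i (f t) + rV_coord i (g t)).
  apply: measurable_funD.
    exact: (measurableT_comp (measurable_rV_coord i) mf).
  exact: (measurableT_comp (measurable_rV_coord i) mg).
by apply/funext => t; rewrite /= /rV_coord mxE.
Qed.

Lemma measurable_fun_rVZ (c : T -> R) f : measurable_fun setT c ->
  measurable_fun setT f -> measurable_fun setT (fun t => c t *: f t).
Proof.
move=> mc mf; apply: measurable_fun_rVP => i.
rewrite (_ : _ \o _ = fun t => c t * rV_coord i (f t)).
  apply: measurable_funM => //.
  exact: (measurableT_comp (measurable_rV_coord i) mf).
by apply/funext => t; rewrite /= /rV_coord mxE.
Qed.

Lemma measurable_fun_rVB f g : measurable_fun setT f -> measurable_fun setT g ->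
  measurable_fun setT (fun t => f t - g t).
Proof.
move=> mf mg; apply: measurable_fun_rVD => //.
rewrite (_ : (fun _ => _) = fun t => (-1) *: g t); last first.
  by apply/funext => t; rewrite scaleN1r.
exact: measurable_fun_rVZ.
Qed.

Lemma measurable_fun_enorm f : measurable_fun setT f ->
  measurable_fun setT (fun t => enorm (f t)).
Proof. by move=> mf; exact: (measurableT_comp (@measurable_enorm R n)). Qed.

(** On nonnegative reals inversion is the power of exponent -1, also at 0, where both are 0. *)
Lemma measurable_fun_invr (f : T -> R) : measurable_fun setT f ->
  (forall t, 0 <= f t) -> measurable_fun setT (fun t => (f t)^-1).
Proof.
move=> mf f0; rewrite (_ : (fun _ => _) = fun t => f t `^ (-1)).
  by apply: (measurableT_comp (measurable_powR (-1))).
by apply/funext => t; rewrite powR_inv1.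
Qed.

End euclidean_measurability.

(** * The Gaussian integral in R^n *)

Section ball_volume.
Context {R : realType}.
Local Notation mu := (@lebesgue_measure R).

Lemma rV_cons_head n (p : R * 'rV[R]_n) : rV_cons p 0 0 = p.1.
Proof. by have /(congr1 fst) := rV_unconsK p. Qed.

Lemma rV_cons_tail n (p : R * 'rV[R]_n) i : rV_cons p 0 (lift ord0 i) = p.2 0 i.
Proof.
by have /(congr1 snd)/rowP/(_ i) := rV_unconsK p; rewrite mxE.
Qed.

Lemma dotp_ge0 n (x : 'rV[R]_n) : 0 <= dotp x x.
Proof. by apply: sumr_ge0 => i _; rewrite -expr2 sqr_ge0. Qed.

(** The Gaussian is a product over the coordinates, hence computable for an iterated product
    measure, and also a function of |x| alone, hence able to measure the ball. *)
Lemma integral_gauss_rV n :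
  (\int[rV_lebesgue n]_x (expR (- dotp x x))%:E)%E = (Num.sqrt pi ^+ n : R)%:E.
Proof.
have mg k : measurable_fun setT (fun x : 'rV[R]_k => (expR (- dotp x x))%:E).
  apply/measurable_EFinP; apply: (measurableT_comp (@measurable_expN R)).
  by apply: measurable_dotp.
elim: n => [|n IH].
  rewrite [LHS](@integral_dirac _ _ _ _ _ measurableT)//; last exact: mg.
  by rewrite diracT mul1e /dotp big_ord0 oppr0 expR0 expr0.
rewrite ge0_integral_rV_cons//.
transitivity (\int[mu]_t ((gauss_fun t)%:E * (Num.sqrt pi ^+ n : R)%:E))%E.
  apply: eq_integral => t _; rewrite -IH -ge0_integralZl_EFin//; last 2 first.
  - exact: (mg n).
  - exact: gauss_fun_ge0.
  apply: eq_integral => x _; rewrite -EFinM /gauss_fun -expRD -opprD.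
  congr (expR (- _))%:E; rewrite /dotp big_ord_recl rV_cons_head -expr2.
  by congr (_ + _); apply: eq_bigr => i _; rewrite rV_cons_tail.
rewrite ge0_integralZr//; last 2 first.
- by apply/measurable_EFinP; exact: measurable_gauss_fun.
- by move=> x _; rewrite lee_fin gauss_fun_ge0.
by rewrite integralT_gauss -EFinM exprS.
Qed.

End ball_volume.

(** * The volume of the unit ball *)

Section ball_volume_formula.
Context {R : realType}.
Local Notation mu := (@lebesgue_measure R).

Lemma oballE n (x : 'rV[R]_n) : oball x <-> dotp x x < 1.
Proof.
rewrite /oball /= /enorm -[X in _ < X]sqrtr1 ltr_sqrt//.
Qed.

(** The layer-cake form of exp(-s): at s = |x|^2 it writes the Gaussian as a superposition of
    indicators of balls. *)
Lemma integral_exp_layer (s : R) :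
  (\int[mu]_t ((s < t)%R%:R * expR (- t))%:E)%E = (expR (- s))%:E.
Proof.
rewrite -integral_expN_tail -integral_itv_obnd_cbnd; last first.
  by apply/measurable_funTS/measurable_EFinP; exact: measurable_expN.
rewrite [RHS]integral_EFin_indic; apply: eq_integral => t _.
by rewrite indicE mem_setE in_itv/= andbT.
Qed.

Lemma integral_ball_dilation n (t : R) : 0 < t ->
  (\int[rV_lebesgue n]_x ((dotp x x < t)%R%:R)%:E =
   (Num.sqrt t ^+ n)%:E * rV_lebesgue n oball)%E.
Proof.
move=> t0; have st0 : 0 < Num.sqrt t by rewrite sqrtr_gt0.
have mf : measurable_fun setT (fun x : 'rV[R]_n => ((dotp x x < t)%R%:R : R)%:E).
  by apply/measurable_EFinP; apply: measurable_indic_lt => //; apply: measurable_dotp.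
have := ge0_integral_rV_scale st0 mf.
have -> : (\int[rV_lebesgue n]_x (((dotp (Num.sqrt t *: x) (Num.sqrt t *: x))%R
    < t)%R%:R)%:E)%E
   = rV_lebesgue n oball.
  rewrite -[oball]setIT -integral_indic//; last exact: measurable_oball.
  apply: eq_integral => x _; rewrite indicE; congr ((nat_of_bool _)%:R)%:E.
  have -> : dotp (Num.sqrt t *: x) (Num.sqrt t *: x) = t * dotp x x.
    rewrite /dotp mulr_sumr; apply: eq_bigr => i _;
        rewrite !mxE mulrACA -expr2 sqr_sqrtr//.
    exact: ltW.
  rewrite -[X in _ < X]mulr1 ltr_pM2l//.
  by apply/esym; apply/idP/idP; rewrite inE => /oballE.
move=> -> //.
by rewrite muleA -EFinM divff ?mul1e// expf_neq0// gt_eqF.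
Qed.

(** After the layers and the integral over x are swapped, the layer t contributes the ball of radius
    sqrt t. The identity is pi^(n/2) = vol(B) Gamma(n/2 + 1), read in the extended reals. *)
Lemma integral_gauss_layers n :
  ((Num.sqrt pi ^+ n : R)%:E = rV_lebesgue n oball *
    \int[mu]_t ((0 < t)%R%:R * (Num.sqrt t ^+ n * expR (- t)))%:E)%E.
Proof.
rewrite -integral_gauss_rV.
under eq_integral do rewrite -integral_exp_layer.
have mlt : measurable_fun setT
    (fun p : 'rV[R]_n * R => (dotp p.1 p.1 < p.2)%R%:R * expR (- p.2)).
  apply: measurable_funM; last by apply: (measurableT_comp (@measurable_expN R)).
  by apply: measurable_indic_lt => //; apply: measurable_dotp.
rewrite (ge0_integral_swap (rV_lebesgue n) mu)//; last exact/measurable_EFinP.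
rewrite -ge0_integralZl//; last first.
- apply/measurable_EFinP; apply: measurable_funM.
    by apply: measurable_indic_lt.
  apply: measurable_funM; last exact: measurable_expN.
  by apply: measurable_funX; apply: measurable_sqrt.
apply: eq_integral => t _.
have [t0|t0] := ltP 0 t.
  rewrite mul1r EFinM muleA (muleC (rV_lebesgue _ _)) -integral_ball_dilation//.
  rewrite -ge0_integralZr//.
  apply/measurable_EFinP; apply: measurable_indic_lt => //; exact: measurable_dotp.
rewrite mul0r mule0; apply: integral0_eq => x _.
by rewrite ltNge (le_trans t0)//= ?mul0r// dotp_ge0.
Qed.

(** Gamma(n/2 + 2) = (n/2 + 1) Gamma(n/2 + 1). The power t^(n/2 + 1) is written as the integral of
    its derivative and the order of integration is exchanged, which replaces integration by parts
    and holds without finiteness. *)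
Lemma integral_Gamma_shift n :
  (\int[mu]_t ((0 < t)%R%:R * (Num.sqrt t ^+ n.+2 * expR (- t)))%:E =
  (n.+2%:R / 2)%:E * \int[mu]_t ((0 < t)%R%:R * (Num.sqrt t ^+ n * expR (- t)))%:E)%E.
Proof.
pose F (t s : R) : R := (s < t)%R%:R * (expR (- t)) * ((0 < s)%R%:R *
    (n.+2%:R / 2 * Num.sqrt s ^+ n)).
have F0 t s : 0 <= F t s.
  by rewrite /F !mulr_ge0// ?exprn_ge0 ?sqrtr_ge0 ?expR_ge0.
have ms k : measurable_fun setT (fun s : R => Num.sqrt s ^+ k).
  by apply: measurable_funX; apply: measurable_sqrt.
have mpos : measurable_fun setT (fun s : R => (0 < s)%R%:R : R).
  exact: measurable_indic_lt.
have mF : measurable_fun setT (fun p : R * R => F p.1 p.2).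
  apply: measurable_funM; first apply: measurable_funM.
  - exact: measurable_indic_lt.
  - exact: (measurableT_comp (@measurable_expN R)).
  - apply: (@measurableT_comp _ _ _ _ _ _
      (fun s : R => (0 < s)%R%:R * (n.+2%:R / 2 * Num.sqrt s ^+ n)) setT snd) => //.
    by apply: measurable_funM => //; apply: measurable_funM.
transitivity (\int[mu]_t \int[mu]_s (F t s)%:E)%E.
  apply: eq_integral => t _; have [t0|t0] := ltP 0 t; last first.
    rewrite mul0r; apply/esym/integral0_eq => s _; rewrite /F.
    have [s0|] := ltP 0 s; last by rewrite mul0r mulr0.
    by rewrite (ltNge s) (le_trans t0 (ltW s0)) !mul0r.
  transitivity ((expR (- t))%:E * \int[mu]_(s in `[0%R, t]) (n.+2%:R / 2 *
      Num.sqrt s ^+ n)%:E)%E.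
    transitivity ((expR (- t))%:E * (Num.sqrt t ^+ n.+2 - Num.sqrt 0 ^+ n.+2)%:E)%E.
      by rewrite sqrtr0 expr0n subr0 mul1r mulrC EFinM.
    congr (_ * _)%E; apply/esym;
        apply: (@integral_itvcc_FTC _ (fun s => Num.sqrt s ^+ n.+2)).
    - exact: ltW.
    - move=> x _; apply: (@continuousM _ _ (cst (n.+2%:R / 2)));
        first exact: cst_continuous.
      exact: continuous_sqrtX.
    - move=> x _; exact: continuous_sqrtX.
    - by move=> x /andP[x0 _]; exact: is_derive_sqrtX.
  rewrite integral_itv_bndoo; last first.
    apply/measurable_funTS/measurable_EFinP; exact: measurable_funM.
  rewrite integral_EFin_indic -ge0_integralZl_EFin//.
  - apply: eq_integral => s _; rewrite indicE mem_setE in_itv/= -EFinM /F.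
    by rewrite -mulnb natrM; congr EFin; ring.
  - apply/measurable_EFinP; apply: measurable_funM; first exact: measurable_indic.
    by apply: measurable_funM; [exact: measurable_cst|exact: ms].
rewrite (ge0_integral_swap mu mu)//; last exact/measurable_EFinP.
rewrite -ge0_integralZl_EFin//; last first.
  apply/measurable_EFinP; apply: measurable_funM; first exact: mpos.
  by apply: measurable_funM; [exact: ms|exact: measurable_expN].
apply: eq_integral => s _; rewrite /F.
under eq_integral do rewrite EFinM.
rewrite ge0_integralZr//; last first.
  apply/measurable_EFinP; apply: measurable_funM; last exact: measurable_expN.
  exact: measurable_indic_lt.
by rewrite integral_exp_layer -!EFinM; congr EFin; ring.
Qed.

(** From pi^(n/2) = vol(B) (n/2) Gamma(n/2), the two lemmas above combined. *)
Lemma ball_volume_area n : (2 <= n)%N ->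
  exists2 b : R, 0 < b & rV_lebesgue n oball = b%:E /\ n%:R * b = sphere_area n.
Proof.
case: n => [|[|n]]// _.
have := integral_gauss_layers n.+2; rewrite integral_Gamma_shift.
set L := rV_lebesgue _ _; set K := (\int[mu]_t _)%E.
have K0 : (0 <= K)%E.
  by apply: integral_ge0 => t _;
      rewrite lee_fin !mulr_ge0// ?exprn_ge0 ?sqrtr_ge0 ?expR_ge0.
have L0 : (0 <= L)%E by exact: measure_ge0.
have KE : (Gamma (n.+2%:R / 2) : R) = fine K.
  rewrite /Gamma /Rintegral integral_EFin_indic; congr fine.
  apply: eq_integral => t _; rewrite indicE mem_setE in_itv/= andbT.
  have [t0|_] := ltP 0 t; last by rewrite !mul0r.
  rewrite !mul1r; congr ((_ * _)%:E).
  rewrite -powR_mulrn ?sqrtr_ge0// -powR12_sqrt ?(ltW t0)// -powRrM; congr powR.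
  by rewrite -[in LHS]natr1 -[in LHS]natr1; field.
have sp : (0 : R) < Num.sqrt pi ^+ n.+2 by rewrite exprn_gt0// sqrtr_gt0 pi_gt0.
have c0 : (0 : R) < n.+2%:R / 2 by rewrite divr_gt0.
rewrite /sphere_area KE.
(* Neither the volume nor the Gamma integral is known to be finite here; an infinite or zero factor
   contradicts the finite positive product pi^(n/2). *)
move: L K L0 K0 {KE} => [b| |]// [k| |]//; rewrite ?lee_fin => b0 k0.
- rewrite -!EFinM => -[E].
  have bk : b != 0 /\ k != 0.
    by split; apply/eqP => h; move: sp; rewrite E h ?(mul0r, mulr0) ltxx.
  exists b; first by rewrite lt_neqAle eq_sym bk.1.
  split => //=; apply: (mulIf bk.2); rewrite divfK; last by case: bk.
  have -> : pi `^ (n.+2%:R / 2) = Num.sqrt (pi : R) ^+ n.+2.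
    by rewrite -powR_mulrn ?sqrtr_ge0// -powR12_sqrt ?pi_ge0// -powRrM mulrC.
  by rewrite E; field.
- move: b0; rewrite le_eqVlt => /predU1P[<-|b0].
    by rewrite mul0e => -[E]; move: sp; rewrite E ltxx.
  by rewrite gt0_muley ?lte_fin// gt0_muley ?lte_fin.
- move: k0; rewrite le_eqVlt => /predU1P[<-|k0].
    by rewrite mule0 mule0 => -[E]; move: sp; rewrite E ltxx.
  by rewrite -EFinM gt0_mulye// lte_fin mulr_gt0.
- by rewrite gt0_muley ?lte_fin// mulyy.
Qed.

End ball_volume_formula.

(** * The Euclidean inner product and norm *)

Section ball_volume_real.
Context {R : realType}.

Definition ball_vol n : R := fine (rV_lebesgue n (@oball R n)).

Lemma rV_lebesgue_oball n : (2 <= n)%N ->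
  rV_lebesgue n (@oball R n) = (ball_vol n)%:E.
Proof. by case/(@ball_volume_area R) => b _ [E _]; rewrite /ball_vol E. Qed.

Lemma ball_vol_gt0 n : (2 <= n)%N -> 0 < ball_vol n.
Proof. by case/(@ball_volume_area R) => b b0 [E _]; rewrite /ball_vol E. Qed.

Lemma ball_vol_area n : (2 <= n)%N -> n%:R * ball_vol n = sphere_area n.
Proof. by case/(@ball_volume_area R) => b _ [E <-]; rewrite /ball_vol E. Qed.

Lemma dotpC n (x y : 'rV[R]_n) : dotp x y = dotp y x.
Proof. by rewrite /dotp; apply: eq_bigr => i _; rewrite mulrC. Qed.

Lemma dotpDl n (x y z : 'rV[R]_n) : dotp (x + y) z = dotp x z + dotp y z.
Proof.
by rewrite /dotp -big_split; apply: eq_bigr => i _; rewrite mxE mulrDl.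
Qed.

Lemma dotpZl n (a : R) (x z : 'rV[R]_n) : dotp (a *: x) z = a * dotp x z.
Proof.
by rewrite /dotp mulr_sumr; apply: eq_bigr => i _; rewrite mxE mulrA.
Qed.

Lemma dotpDr n (x y z : 'rV[R]_n) : dotp z (x + y) = dotp z x + dotp z y.
Proof. by rewrite dotpC dotpDl !(dotpC _ z). Qed.

Lemma dotpZr n (a : R) (x z : 'rV[R]_n) : dotp z (a *: x) = a * dotp z x.
Proof. by rewrite dotpC dotpZl dotpC. Qed.

Lemma dotpNl n (x z : 'rV[R]_n) : dotp (- x) z = - dotp x z.
Proof. by rewrite -scaleN1r dotpZl mulN1r. Qed.

Lemma dotpNr n (x z : 'rV[R]_n) : dotp z (- x) = - dotp z x.
Proof. by rewrite dotpC dotpNl dotpC. Qed.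

Definition dotpE := (dotpDl, dotpDr, dotpZl, dotpZr, dotpNl, dotpNr).

Lemma enorm_ge0 n (x : 'rV[R]_n) : 0 <= enorm x.
Proof. exact: sqrtr_ge0. Qed.

Lemma sqr_enorm n (x : 'rV[R]_n) : enorm x ^+ 2 = dotp x x.
Proof. by rewrite sqr_sqrtr// dotp_ge0. Qed.

Lemma enormZ n (a : R) (x : 'rV[R]_n) : enorm (a *: x) = `|a| * enorm x.
Proof.
by rewrite /enorm !dotpE mulrA -expr2 sqrtrM ?sqr_ge0// sqrtr_sqr.
Qed.

Lemma enorm0 n : enorm (0 : 'rV[R]_n) = 0.
Proof. by rewrite -(scale0r (0 : 'rV[R]_n)) enormZ normr0 mul0r. Qed.

Lemma enorm_eq0 n (x : 'rV[R]_n) : (enorm x == 0) = (x == 0).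
Proof.
apply/idP/idP => [|/eqP->]; last by rewrite enorm0.
rewrite sqrtr_eq0 => h; have /eqP : dotp x x = 0.
  by apply/eqP; rewrite eq_le h dotp_ge0.
rewrite psumr_eq0; last by move=> i _; rewrite -expr2 sqr_ge0.
move=> /allP H; apply/eqP/rowP => i; rewrite mxE.
by have := H i; rewrite mem_index_enum => /(_ isT); rewrite mulf_eq0 orbb => /eqP.
Qed.

Lemma enormN n (x : 'rV[R]_n) : enorm (- x) = enorm x.
Proof. by rewrite -scaleN1r enormZ normrN1 mul1r. Qed.

Lemma enorm_normalize n (x : 'rV[R]_n) : x != 0 -> enorm (normalize x) = 1.
Proof.
move=> x0; rewrite enormZ normfV ger0_norm ?enorm_ge0// mulVf//.
by rewrite enorm_eq0.
Qed.

Lemma normalizeK n (x : 'rV[R]_n) : enorm x *: normalize x = x.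
Proof.
have [->|x0] := eqVneq x 0; first by rewrite enorm0 scale0r.
by rewrite scalerA divff ?scale1r// enorm_eq0.
Qed.

End ball_volume_real.

(** * Invariance of Lebesgue measure under involutive isometries *)

Section isometry.
Local Open Scope ereal_scope.
Context {R : realType} (n : nat).
Hypothesis hn : (2 <= n)%N.
Local Notation L := (@rV_lebesgue R n).

Section involutive_isometry.
Variable T : 'rV[R]_n -> 'rV[R]_n.
Hypotheses (mT : measurable_fun setT T) (TD : {morph T : x y / (x + y)%R})
  (TK : involutive T) (Td : forall x, dotp (T x) (T x) = dotp x x).

(* For a translation-invariant measure mu, Tonelli's theorem applied to
   f(z) g(y + z) gives mu(f) L(g) = mu(g) L(f o -%R); here mu is the image of
   L by T, and g is the indicator of the unit ball, which T preserves. *)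
Lemma ge0_integral_isometry_opp (f : 'rV[R]_n -> \bar R) :
  measurable_fun setT f -> (forall x, 0 <= f x) ->
  \int[L]_x f (T x) = \int[L]_x f (- x)%R.
Proof.
move=> mf f0.
pose g (x : 'rV[R]_n) : \bar R := (((dotp x x < 1)%R)%:R)%:E.
have g0 x : 0 <= g x by rewrite lee_fin.
have mg : measurable_fun setT g.
  by apply/measurable_EFinP; apply: measurable_indic_lt => //; apply: measurable_dotp.
have gB : \int[L]_x g x = (ball_vol n)%:E.
  rewrite -rV_lebesgue_oball// (integral_ball_dilation n (@ltr01 R)).
  by rewrite sqrtr1 expr1n mul1e.
have gT x : g (T x) = g x by rewrite /g Td.
have TB x y : (T (x - T y) = T x - y)%R.
  have T0 : T 0%R = 0%R by apply: (addIr (T 0%R)); rewrite -TD !add0r.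
  have TN z : (T (- z) = - T z)%R by apply: (addrI (T z)); rewrite -TD !subrr.
  by rewrite TD TN TK.
have m1 (h : 'rV[R]_n -> \bar R) (k : 'rV[R]_n * 'rV[R]_n -> 'rV[R]_n) :
    measurable_fun setT h -> measurable_fun setT k ->
    measurable_fun setT (fun p => h (k p)).
  by move=> mh mk; exact: (measurableT_comp mh).
have mT1 : measurable_fun setT (fun p : 'rV[R]_n * 'rV[R]_n => T p.1).
  exact: (measurableT_comp mT).
have fT0 : 0 <= \int[L]_x f (T x) by apply: integral_ge0.
have mN : measurable_fun setT (fun x : 'rV[R]_n => - x)%R.
  have := @measurable_fun_rVB R _ _ n (cst 0%R) id (measurable_cst _)
      (@measurable_id _ _ _).
  by under eq_fun do rewrite sub0r.
have key : \int[L]_x f (T x) * (ball_vol n)%:E = (ball_vol n)%:E * \int[L]_x f (- x)%R.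
  rewrite -[in LHS]gB -ge0_integralZr//; last 2 first.
  - exact: (measurableT_comp mf).
  - by apply: integral_ge0.
  transitivity (\int[L]_x \int[L]_y (f (T x) * g (y + T x)%R)).
    apply: eq_integral => x _; rewrite -(ge0_integral_rV_shift (T x) mg)//.
    rewrite ge0_integralZl//.
    by apply: (measurableT_comp mg); apply: measurable_fun_rVD.
  rewrite (ge0_integral_swap L L); last 2 first.
  - apply: emeasurable_funM; first exact: (m1 f).
    by apply: (m1 g) => //; apply: measurable_fun_rVD.
  - by move=> x y; rewrite mule_ge0.
  transitivity (\int[L]_y \int[L]_x (f (T x - y)%R * g (T x))).
    apply: eq_integral => y _.
    rewrite -(ge0_integral_rV_shift (- T y)%R
      (f := fun x => f (T x) * g (y + T x)%R)); last 2 first.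
    - apply: emeasurable_funM; first exact: (measurableT_comp mf).
      by apply: (measurableT_comp mg); apply: measurable_fun_rVD.
    - by move=> x; rewrite mule_ge0.
    by apply: eq_integral => x _; rewrite TB [(y + _)%R]addrC subrK.
  rewrite -(ge0_integral_swap L L (f := fun x y => f (T x - y)%R * g (T x)));
      last 2 first.
  - apply: emeasurable_funM; last exact: (m1 g).
    by apply: (m1 f) => //; apply: measurable_fun_rVB.
  - by move=> x y; rewrite mule_ge0.
  rewrite -gB -ge0_integralZr//; last by apply: integral_ge0.
  apply: eq_integral => x _; rewrite gT muleC -ge0_integralZr//; last first.
    exact: (measurableT_comp mf).
  rewrite -(ge0_integral_rV_shift (- T x)%R (f := fun y => f (- y)%R * g x));
      last 2 first.
  - by apply: emeasurable_funM => //; exact: (measurableT_comp mf).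
  - by move=> y; rewrite mule_ge0.
  by apply: eq_integral => y _; rewrite opprB.
have b0 := @ball_vol_gt0 R _ hn.
move: key; rewrite muleC => /(congr1 (fun z => ((ball_vol n)^-1)%:E * z)).
by rewrite !muleA -EFinM mulVf ?gt_eqF// !mul1e.
Qed.

End involutive_isometry.

(** The identity is itself an involutive isometry, so the preceding lemma also gives invariance
    under x -> -x, which removes the sign. *)
Lemma ge0_integral_isometry (T : 'rV[R]_n -> 'rV[R]_n) (f : 'rV[R]_n -> \bar R) :
  measurable_fun setT T -> {morph T : x y / (x + y)%R} -> involutive T ->
  (forall x, dotp (T x) (T x) = dotp x x) ->
  measurable_fun setT f -> (forall x, 0 <= f x) ->
  \int[L]_x f (T x) = \int[L]_x f x.
Proof.
move=> mT TD TK Td mf f0; rewrite ge0_integral_isometry_opp//.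
by rewrite -(ge0_integral_isometry_opp (T := id)).
Qed.

End isometry.

(** * The sphere and polar coordinates *)

Section polar.
Local Open Scope ereal_scope.
Context {R : realType} (n : nat).
Hypothesis hn : (2 <= n)%N.
Local Notation L := (@rV_lebesgue R n).
Local Notation mu := (@lebesgue_measure R).
Local Notation sigma := (@surface_measure R n).

Let n0 : (0 < n)%N. Proof. exact: leq_trans hn. Qed.

Lemma measurable_rV_set1 (x : 'rV[R]_n) : measurable [set x].
Proof.
rewrite (_ : [set _] = (fun y => enorm (y - x)) @^-1` [set 0%R]).
  rewrite -[X in measurable X]setTI; apply: measurable_fun_enorm => //.
  exact: measurable_fun_rVB.
apply/seteqP; split => y /=; first by move=> ->; rewrite subrr enorm0.
by move/eqP; rewrite enorm_eq0 subr_eq0 => /eqP.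
Qed.

Lemma measurable_sphere : measurable (@sphere R n).
Proof.
rewrite (_ : sphere = @enorm R n @^-1` [set 1%R])//.
by rewrite -[X in measurable X]setTI; apply: measurable_enorm.
Qed.

(* The integrand over the ball is cut at the origin, where [normalize] is 0
   and does not lie on the sphere. *)
Lemma ge0_integral_sphere (g : 'rV[R]_n -> \bar R) :
  measurable_fun setT g -> (forall x, 0 <= g x) ->
  \int[sigma]_(z in sphere) g z = ((ball_vol n)^-1)%:E *
   \int[L]_x (((0 < enorm x < 1)%R%:R)%:E * g (normalize x)).
Proof.
move=> mg g0.
(* [phi] sends the outside of the ball to 0, which is not on the sphere; on subsets of the sphere
   the surface measure is thus a multiple of the image of [L] under [phi]. *)
pose phi (x : 'rV[R]_n) := ((enorm x < 1)%R%:R *: normalize x)%R.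
have mphi : measurable_fun setT phi.
  apply: measurable_fun_rVZ; last exact: measurable_normalize.
  by apply: measurable_indic_lt => //; exact: measurable_enorm.
have c0 : (0 <= (ball_vol n : R)^-1)%R by rewrite invr_ge0 ltW// ball_vol_gt0.
pose nu : {measure set 'rV[R]_n -> \bar R} := pushforward L phi.
have zS : ~ sphere (0%R : 'rV[R]_n).
  by rewrite /sphere/= enorm0 => /esym/eqP; rewrite oner_eq0.
transitivity (\int[mscale (NngNum c0) (nu mphi)]_(z in sphere) g z).
  apply: eq_measure_integral => A mA AS.
  rewrite /= /surface_measure /mscale /= /pushforward; congr (_ * L _).
  apply/seteqP; split => x /=.
    by move=> [xB nA]; rewrite /phi (_ : (enorm x < 1)%R) ?scale1r.
  rewrite /phi; have [x1|x1] := ltP (enorm x) 1%R; first by rewrite scale1r.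
  by rewrite scale0r => /AS.
rewrite ge0_integral_mscale//; last 2 first.
- exact: measurable_sphere.
- exact: measurable_funTS.
rewrite /nu ge0_integral_pushforward//; last 2 first.
- exact: measurable_sphere.
- exact: measurable_funTS.
congr (_ * _); rewrite integral_mkcond; apply: eq_integral => x _.
rewrite patchE /= /phi.
have E : (x \in phi @^-1` sphere) = (0 < enorm x < 1)%R.
  apply/idP/idP; rewrite inE /= /sphere /= /phi.
    have [x1|x1] := ltP (enorm x) 1%R; last by rewrite scale0r.
    rewrite scale1r andbT => nx; rewrite lt_neqAle enorm_ge0 andbT eq_sym enorm_eq0.
    apply/eqP => x0; apply: zS; move: nx; rewrite x0.
    by rewrite /normalize scaler0.
  move=> /andP[x0 x1]; rewrite x1 scale1r enorm_normalize//.
  by rewrite -enorm_eq0 gt_eqF.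
rewrite E; case: ifPn => [/andP[x0 x1]|_]; last by rewrite mul0e.
by rewrite mul1e x1 scale1r.
Qed.

(** Scaling by 2 fixes the origin but multiplies its measure by 2^-n; that measure is finite because
    the ball contains the origin, so it is 0. *)
Lemma rV_lebesgue_set0 : L [set 0%R] = 0.
Proof.
have m0 := measurable_rV_set1 0%R.
have m1 : measurable_fun setT (fun x : 'rV[R]_n => (\1_[set (0%R : 'rV[R]_n)] x
    : R)%:E).
  exact/measurable_EFinP.
have m2 x : 0 <= (\1_[set (0%R : 'rV[R]_n)] x : R)%:E by rewrite lee_fin.
have := ge0_integral_rV_scale (@ltr0n R 2) m1 m2.
have -> : \int[L]_x (\1_[set 0%R] (2 *: x)%R : R)%:E =
    \int[L]_x (\1_[set 0%R] x : R)%:E.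
  apply: eq_integral => x _; rewrite !indicE; congr ((nat_of_bool _)%:R)%:E.
  apply/idP/idP; rewrite !inE /=; last by move=> ->; rewrite scaler0.
  by move/eqP; rewrite scaler_eq0 pnatr_eq0 /= => /eqP.
rewrite integral_indic// setIT => H.
have {H} : L [set 0%R] = ((2 ^- n)%R)%:E * L [set 0%R] by exact: H.
have : L [set 0%R] <= (ball_vol n)%:E.
  rewrite -rV_lebesgue_oball//; apply: le_measure; rewrite ?inE//;
      first exact: measurable_oball.
  by move=> x /= ->; rewrite /oball/= enorm0.
have : 0 <= L [set 0%R] by exact: measure_ge0.
case: (L [set 0%R]) => [r| |]// _ _ [E].
have : (r * (1 - 2 ^- n) = 0)%R by rewrite mulrBr mulr1 {1}E mulrC subrr.
move/eqP; rewrite mulf_eq0 => /orP[/eqP->//|].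
rewrite subr_eq0 => /eqP E2; exfalso; move: n0.
have : (1 < (2 : R) ^+ n)%R by rewrite exprn_egt1// ?ltr1n// -lt0n.
by rewrite -[X in (_ < X)%R]invrK -E2 invr1 ltxx.
Qed.

(** The integral that eliminates the radial parameter in [integral_polar], and the source of the
    factor n there. *)
Lemma integral_inv_power_tail (a : R) : (0 < a)%R ->
  \int[mu]_s ((a < s)%R%:R * (s ^- n.+1)%R)%:E = (a ^- n / n%:R)%:E.
Proof.
move=> a0.
have ms k : measurable_fun `]a, +oo[ (fun s : R => s ^- k)%R.
  apply: open_continuous_measurable_fun => //.
  move=> x; rewrite inE /= in_itv/= andbT => ax.
  apply: (@continuous_comp _ _ _ (fun s : R => s ^+ k)%R (@GRing.inv R)).
    exact: exprn_continuous.
  by apply: inv_continuous; rewrite expf_neq0// gt_eqF// (lt_trans a0).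
transitivity (\int[mu]_(s in `[a, +oo[) (s ^- n.+1)%:E).
  rewrite -integral_itv_obnd_cbnd; last exact/measurable_EFinP.
  rewrite [RHS]integral_EFin_indic; apply: eq_integral => s _.
  by rewrite indicE mem_setE in_itv/= andbT.
transitivity ((0 - (- (a ^- n / n%:R)))%:E : \bar R); last by rewrite sub0r opprK.
have n00 : (n%:R != 0 :> R)%R by rewrite pnatr_eq0 -lt0n.
apply: (@integral_itvcy_FTC _ (fun s : R => - (s ^- n / n%:R))%R).
- by move=> x ax; rewrite invr_ge0 exprn_ge0// (le_trans (ltW a0)).
- move=> x ax; apply: (@continuous_comp _ _ _ (fun s : R => s ^+ n.+1)%R
    (@GRing.inv R)).
    exact: exprn_continuous.
  by apply: inv_continuous; rewrite expf_neq0// gt_eqF// (lt_le_trans a0).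
- move=> x ax; have x0 : (0 < x)%R := lt_le_trans a0 ax.
  have h1 : is_derive x 1%R (@GRing.exp R ^~ n) (n%:R * x ^+ n.-1)%R.
    have := @is_deriveX _ _ id n x 1%R 1%R (is_derive_id _ _).
    rewrite (_ : id ^+ n = @GRing.exp R ^~ n)%R; last by apply/funext => t;
        rewrite exprfctE.
    by rewrite /GRing.scale/= mulr1.
  have h2 := is_deriveV (_ : (fun s : R => s ^+ n)%R x != 0%R) h1.
  have /h2{}h2 : (fun s : R => s ^+ n)%R x != 0%R by rewrite /= expf_neq0// gt_eqF.
  have h3 := is_deriveZ (- (n%:R)^-1)%R h2.
  rewrite (_ : (fun s : R => _) =
      (- n%:R^-1 \*: (fun y : R => (y ^+ n)^-1))%R); last first.
    apply/funext => s; change (- (s ^- n / n%:R) = - n%:R^-1 * s ^- n)%R.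
    by rewrite mulNr mulrC.
  apply: (is_derive_eq h3); rewrite /GRing.scale /=.
  case: (n) n0 n00 => // k _ k0 /=; rewrite !exprS; field.
  by rewrite -natr1 addrC in k0; rewrite k0 expf_neq0 ?gt_eqF.
- rewrite -oppr0; apply: cvgN; rewrite -(mul0r (n%:R^-1)%R).
  apply: cvgMl.
  have : (fun s : R => s^-1 ^+ n)%R x @[x --> +oo%R] --> (0 ^+ n : R)%R.
    apply: (@cvg_comp _ _ _ (@GRing.inv R) (fun s : R => s ^+ n)%R _ (nbhs (0%R : R))).
      apply/gtr0_cvgV0; last exact: cvg_id.
      by apply: nbhs_pinfty_gt.
    exact: exprn_continuous.
  rewrite expr0n eqn0Ngt n0 /=; apply: cvg_trans.
  by apply: near_eq_cvg; apply: nearW => s; rewrite exprVn.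
Qed.

End polar.

(** * Integration in polar coordinates *)

Section polar_coordinates.
Local Open Scope ereal_scope.
Context {R : realType} (n : nat).
Hypothesis hn : (2 <= n)%N.
Local Notation L := (@rV_lebesgue R n).
Local Notation mu := (@lebesgue_measure R).
Local Notation sigma := (@surface_measure R n).

Let n0 : (0 < n)%N. Proof. exact: leq_trans hn. Qed.

(** By the definition through cones, the inner integral is an average of f(r x/|x|) over the
    punctured ball. The substitutions r = |x| s and then y = s x remove the normalization and leave
    the weight |y|^n s^(-n-1) on s > |y|, whose integral in s is 1/n. *)
Lemma integral_polar (f : 'rV[R]_n -> \bar R) :
  measurable_fun setT f -> (forall x, 0 <= f x) ->
  \int[L]_x f x = (n%:R * ball_vol n)%:E *
    \int[mu]_r (((0 < r)%R%:R * r ^+ n.-1)%:E * \int[sigma]_(z in sphere) f (r *: z)%R).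
Proof.
move=> mf f0.
have b0 := @ball_vol_gt0 R _ hn.
have nR0 : (0 < n%:R :> R)%R by rewrite ltr0n.
have mrz (T : 'rV[R]_n -> 'rV[R]_n) : measurable_fun setT T ->
    measurable_fun setT (fun p : R * 'rV[R]_n => f (p.1 *: T p.2)%R).
  move=> mT; apply: (measurableT_comp mf); apply: measurable_fun_rVZ => //.
  exact: (measurableT_comp mT).
pose pun (a : R) (x : 'rV[R]_n) : R := ((0 < enorm x < a)%R)%:R.
have mpun : measurable_fun setT (fun p : R * 'rV[R]_n => pun p.1 p.2).
  rewrite (_ : (fun _ => _) = fun p : R * 'rV[R]_n =>
     ((0 < enorm p.2)%R%:R * (enorm p.2 < p.1)%R%:R)%R); last first.
    by apply/funext => p; rewrite /pun -mulnb natrM.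
  have me : measurable_fun setT (fun p : R * 'rV[R]_n => enorm p.2).
    exact: measurable_fun_enorm.
  by apply: measurable_funM; apply: measurable_indic_lt.
have mpun1 a : measurable_fun setT (pun a).
  have : measurable_fun setT (fun x : 'rV[R]_n => (a, x)) by apply: measurable_fun_pair.
  by move=> /(measurableT_comp mpun).
have mpos k : measurable_fun setT (fun r : R => (0 < r)%R%:R * r ^+ k : R)%R.
  apply: measurable_funM; first exact: measurable_indic_lt.
  exact: measurable_funX.
have pos0 k (r : R) : (0 <= (0 < r)%R%:R * r ^+ k)%R.
  by have [r0|_] := ltP 0%R r; rewrite ?mul0r// mul1r exprn_ge0// ltW.
have men k : measurable_fun setT (fun x : 'rV[R]_n => enorm x ^+ k)%R.
  by apply: measurable_funX; exact: measurable_enorm.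
have en0 k (x : 'rV[R]_n) : (0 <= enorm x ^+ k)%R by rewrite exprn_ge0// enorm_ge0.
have pun0 a x : (0 <= pun a x)%R by rewrite /pun.
apply/esym.
transitivity (n%:R%:E * \int[mu]_r \int[L]_x
    (((0 < r)%R%:R * r ^+ n.-1)%:E * ((pun 1%R x)%:E * f (r *: normalize x)%R))).
  rewrite EFinM -muleA; apply: (congr1 (fun z => n%:R%:E * z));
      rewrite -ge0_integralZl//; last 3 first.
  - apply: emeasurable_funM; first by apply/measurable_EFinP; exact: (mpos n.-1).
    rewrite (_ : (fun r => _) = fun r => ((ball_vol n)^-1)%:E *
      \int[L]_x ((pun 1%R x)%:E * f (r *: normalize x)%R)); last first.
      apply/funext => r; rewrite (@ge0_integral_sphere R n hn (fun z => f (r *: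
          z)%R))//.
      by apply: (measurableT_comp mf); apply: measurable_fun_rVZ.
    apply: measurable_funeM; apply: (measurable_ge0_integral2 L).
      apply: emeasurable_funM; last by apply: mrz; exact: measurable_normalize.
      by apply/measurable_EFinP; exact: (measurableT_comp (mpun1 1%R)).
    by move=> r x; rewrite mule_ge0// lee_fin.
  - by move=> r _; rewrite mule_ge0 ?lee_fin ?integral_ge0.
  - by rewrite lee_fin ltW.
  apply: eq_integral => r _.
  rewrite (@ge0_integral_sphere R n hn (fun z => f (r *: z)%R))//; last first.
    by apply: (measurableT_comp mf); apply: measurable_fun_rVZ.
  rewrite muleCA (muleA (ball_vol n)%:E) -EFinM divff ?gt_eqF// mul1e.
  rewrite -ge0_integralZl//.
  - apply: emeasurable_funM; first by apply/measurable_EFinP; exact: mpun1.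
    apply: (measurableT_comp mf); apply: measurable_fun_rVZ => //.
    exact: measurable_normalize.
  - by move=> x _; rewrite mule_ge0// lee_fin.
  - by rewrite lee_fin.
rewrite (ge0_integral_swap mu L); last 2 first.
- apply: emeasurable_funM.
    by apply/measurable_EFinP; exact: (measurableT_comp (mpos n.-1)).
  apply: emeasurable_funM; last by apply: mrz; exact: measurable_normalize.
  by apply/measurable_EFinP; exact: (measurableT_comp (mpun1 1%R)).
- by move=> r x; rewrite mule_ge0 ?mule_ge0 ?lee_fin.
(* Substitution r = |x| s, for fixed x. *)
transitivity (n%:R%:E * \int[L]_x \int[mu]_s
    (((0 < s)%R%:R * s ^+ n.-1)%:E * (((pun 1%R x * enorm x ^+ n)%R)%:E *
        f (s *: x)%R))).
  apply: (congr1 (fun z => n%:R%:E * z)); apply: eq_integral => x _.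
  have [/andP[x0 x1]|x01] := boolP (0 < enorm x < 1)%R; last first.
    by rewrite !integral0_eq// => t _; rewrite /pun (negbTE x01) ?mul0r !mul0e mule0.
  have xn0 : enorm x != 0%R by rewrite gt_eqF.
  pose F r := ((0 < r)%R%:R * r ^+ n.-1)%:E * ((pun 1%R x)%:E * f (r *: normalize x)%R).
  have mF : measurable_fun setT F.
    apply: emeasurable_funM; first by apply/measurable_EFinP; exact: (mpos n.-1).
    apply: emeasurable_funM => //.
    by apply: (measurableT_comp mf); apply: measurable_fun_rVZ.
  have F0 r : 0 <= F r by rewrite /F mule_ge0 ?mule_ge0 ?lee_fin.
  transitivity ((enorm x)%:E * \int[mu]_s F (enorm x * s + 0)%R).
    by rewrite (ge0_integral_affine 0%R x0 mF)// muleA -EFinM divff// mul1e.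
  rewrite /F.
  rewrite -ge0_integralZl//; last 3 first.
  - apply: emeasurable_funM.
      apply/measurable_EFinP; apply: (measurableT_comp (mpos n.-1)).
      by apply: measurable_funD => //; apply: measurable_funM.
    apply: emeasurable_funM => //.
    apply: (measurableT_comp mf); apply: measurable_fun_rVZ => //.
    by apply: measurable_funD => //; apply: measurable_funM.
  - by move=> r _; rewrite mule_ge0 ?mule_ge0 ?lee_fin.
  - by rewrite lee_fin ltW.
  apply: eq_integral => s _;
      rewrite addr0 pmulr_rgt0// (mulrC (enorm x) s) -scalerA normalizeK.
  rewrite !muleA -!EFinM; congr ((_)%:E * _).
  have -> : (enorm x ^+ n = enorm x * enorm x ^+ n.-1)%R by rewrite -exprS prednK.
  by rewrite exprMn; ring.
rewrite -(ge0_integral_swap mu L (f := fun s x => ((0 < s)%R%:R * s ^+ n.-1)%:E *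
    (((pun 1%R x * enorm x ^+ n)%R)%:E * f (s *: x)%R))); last 2 first.
- apply: emeasurable_funM.
    by apply/measurable_EFinP; exact: (measurableT_comp (mpos n.-1)).
  apply: emeasurable_funM; last by apply: (mrz id).
  apply/measurable_EFinP; apply: measurable_funM.
    exact: (measurableT_comp (mpun1 1%R)).
  exact: (measurableT_comp (men n)).
- move=> r x; apply: mule_ge0; first by rewrite lee_fin.
  by apply: mule_ge0 => //; rewrite lee_fin mulr_ge0.
(* Substitution y = s x, for fixed s; the condition |x| < 1 becomes |y| < s. *)
transitivity (n%:R%:E * \int[mu]_s \int[L]_y
    (((enorm y < s)%R%:R * s ^- n.+1)%:E * (((0 < enorm y)%R%:R *
        enorm y ^+ n)%:E * f y))).
  apply: (congr1 (fun z => n%:R%:E * z)); apply: eq_integral => s _.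
  have [s0|s0] := ltP 0%R s; last first.
    rewrite !integral0_eq// => y _; last by rewrite mul0r mul0e.
    by rewrite ltNge (le_trans s0) ?enorm_ge0//= mul0r mul0e.
  have mh : measurable_fun setT (fun y : 'rV[R]_n =>
      (((pun s y * enorm y ^+ n))%:E * f y)).
    by apply: emeasurable_funM => //; apply/measurable_EFinP; apply: measurable_funM.
  have h0 y : 0 <= (pun s y * enorm y ^+ n)%:E * f y.
    by apply: mule_ge0 => //; rewrite lee_fin mulr_ge0.
  have H := ge0_integral_rV_scale s0 mh h0.
  transitivity ((s^-1)%:E * ((s ^- n)%:E * \int[L]_y ((pun s y *
      enorm y ^+ n)%:E * f y))).
    rewrite -H -ge0_integralZl//.
    - apply: eq_integral => x _; rewrite mul1r !muleA -!EFinM.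
      congr ((_)%:E * _); rewrite enormZ (gtr0_norm s0) exprMn.
      have -> : pun s (s *: x)%R = pun 1%R x.
        by rewrite /pun enormZ (gtr0_norm s0) pmulr_rgt0// gtr_pMr.
      have -> : (s ^+ n = s * s ^+ n.-1)%R by rewrite -exprS prednK.
      by field; rewrite gt_eqF.
    - apply: (measurableT_comp mh); apply: measurable_fun_rVZ => //.
    - by rewrite lee_fin invr_ge0 ltW.
  rewrite muleA -EFinM -invfM -exprS -ge0_integralZl//.
  - apply: eq_integral => y _; rewrite !muleA -!EFinM /pun.
    by congr ((_)%:E * _); rewrite -mulnb natrM; ring.
  - by rewrite lee_fin invr_ge0 exprn_ge0// ltW.
have mS : measurable_fun setT (fun s : R => s ^- n.+1)%R.
  (* The sign is split off because [measurable_fun_invr] applies to nonnegative functions. *)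
  rewrite (_ : (fun _ => _) = fun s : R => (Num.sg s ^+ n.+1 * (`|s| ^+ n.+1)^-1)%R).
    apply: measurable_funM.
      apply: measurable_funX.
      rewrite (_ : Num.sg = fun s : R => ((0 < s)%R%:R - (s < 0)%R%:R)%R).
        by apply: measurable_funB; apply: measurable_indic_lt.
      by apply/funext => s; case: (sgrP s) => s0; rewrite ?subrr ?subr0 ?sub0r.
    apply: measurable_fun_invr => //; apply: measurable_funX.
    exact: normr_measurable.
  apply/funext => s; rewrite -!exprVn -exprMn; congr (_ ^+ _)%R.
  by rewrite [in LHS](numEsg s) invfM invr_sg.
have mS2 : measurable_fun setT (fun p : R * 'rV[R]_n =>
    ((enorm p.2 < p.1)%R%:R * p.1 ^- n.+1)%R).
  apply: measurable_funM; last exact: (measurableT_comp mS).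
  by apply: measurable_indic_lt => //; exact: measurable_fun_enorm.
have mS3 : measurable_fun setT (fun x : 'rV[R]_n => ((0 < enorm x)%R%:R *
    enorm x ^+ n)%R).
  apply: measurable_funM; last exact: men.
  by apply: measurable_indic_lt => //; exact: measurable_enorm.
have S0 (y : 'rV[R]_n) s : (0 <= (enorm y < s)%R%:R * s ^- n.+1)%R.
  have [ys|_] := ltP (enorm y) s; last by rewrite mul0r.
  by rewrite mul1r invr_ge0 exprn_ge0// (le_trans (enorm_ge0 y))// ltW.
rewrite (ge0_integral_swap mu L (f := fun s y => ((enorm y < s)%R%:R * s ^- n.+1)%:E *
    (((0 < enorm y)%R%:R * enorm y ^+ n)%:E * f y))); last 2 first.
- apply: emeasurable_funM; first exact/measurable_EFinP.
  apply: emeasurable_funM; last exact: (measurableT_comp mf).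
  by apply/measurable_EFinP; exact: (measurableT_comp mS3).
- move=> s y; apply: mule_ge0; first by rewrite lee_fin.
  by apply: mule_ge0 => //; rewrite lee_fin mulr_ge0.
(* Polar coordinates miss the origin, where the weight on the left vanishes; it is a null set. *)
have mz := measurable_rV_set1 (0%R : 'rV[R]_n); have z0 := @rV_lebesgue_set0 R n hn.
rewrite [RHS](ge0_negligible_integral mz)// [RHS]integral_mkcond.
rewrite -ge0_integralZl//.
- apply: eq_integral => y _; rewrite patchE.
  have [->|y0] := eqVneq y 0%R.
    rewrite ifF; last by apply/negbTE/negP; rewrite inE/= => -[_]; apply.
    by rewrite integral0_eq ?mule0// => s _; rewrite enorm0 ltxx mul0r mul0e mule0.
  have ey : (0 < enorm y)%R by rewrite lt_neqAle enorm_ge0 eq_sym enorm_eq0 y0.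
  rewrite ifT; last by rewrite inE/=; split => //; exact/eqP.
  rewrite ge0_integralZr//; last 3 first.
  - apply/measurable_EFinP; apply: measurable_funM => //.
    exact: measurable_indic_lt.
  - by move=> s _; rewrite lee_fin.
  - by apply: mule_ge0 => //; rewrite lee_fin mulr_ge0.
  rewrite integral_inv_power_tail// ey !muleA -!EFinM -[RHS]mul1e.
  rewrite [(true%:R * _)%R]mul1r; congr ((_)%:E * _); field.
  by rewrite pnatr_eq0 -lt0n n0 expf_neq0// gt_eqF.
- apply: (measurable_ge0_integral2 mu (f := fun y s => ((enorm y < s)%R%:R *
    s ^- n.+1)%:E *
    (((0 < enorm y)%R%:R * enorm y ^+ n)%:E * f y))).
    apply: emeasurable_funM.
      have := measurableT_comp mS2 (@measurable_swap _ _ 'rV[R]_n R).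
      by move=> ?; exact/measurable_EFinP.
    apply: emeasurable_funM; last exact: (measurableT_comp mf).
    by apply/measurable_EFinP; exact: (measurableT_comp mS3).
  move=> y s; apply: mule_ge0; first by rewrite lee_fin.
  by apply: mule_ge0 => //; rewrite lee_fin mulr_ge0.
- move=> y _; apply: integral_ge0 => s _; apply: mule_ge0; first by rewrite lee_fin.
  by apply: mule_ge0 => //; rewrite lee_fin mulr_ge0.
Qed.

End polar_coordinates.

(** * Integration over the sphere: swapping, reflections, total mass *)

Section sphere_tools.
Local Open Scope ereal_scope.
Context {R : realType} (n : nat).
Hypothesis hn : (2 <= n)%N.
Local Notation L := (@rV_lebesgue R n).
Local Notation mu := (@lebesgue_measure R).
Local Notation sigma := (@surface_measure R n).

Lemma measurable_puncture : measurable_fun setT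
  (fun x : 'rV[R]_n => ((0 < enorm x < 1)%R%:R : R)).
Proof.
rewrite (_ : (fun _ => _) = fun x : 'rV[R]_n =>
     ((0 < enorm x)%R%:R * (enorm x < 1)%R%:R)%R); last first.
  by apply/funext => p; rewrite -mulnb natrM.
by apply: measurable_funM; apply: measurable_indic_lt => //; exact: measurable_enorm.
Qed.

(** Reduced to Tonelli's theorem for Lebesgue measure through [ge0_integral_sphere], since the
    surface measure is equipped with a measure structure only. *)
Lemma ge0_integral_sphere_swap (F : R -> 'rV[R]_n -> \bar R) :
  measurable_fun setT (fun p => F p.1 p.2) -> (forall r z, 0 <= F r z) ->
  \int[mu]_r \int[sigma]_(z in sphere) F r z =
  \int[sigma]_(z in sphere) \int[mu]_r F r z.
Proof.
move=> mF F0.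
have c0 : (0 <= (ball_vol n : R)^-1)%R by rewrite invr_ge0 ltW// ball_vol_gt0.
have mFr r : measurable_fun setT (F r).
  have : measurable_fun setT (fun x : 'rV[R]_n => (r, x)) by apply: measurable_fun_pair.
  by move=> /(measurableT_comp mF).
have mFs : measurable_fun setT (fun p : 'rV[R]_n * R => F p.2 p.1).
  by have := measurableT_comp mF (@measurable_swap _ _ 'rV[R]_n R).
have mN : measurable_fun setT (fun p : R * 'rV[R]_n => (p.1, normalize p.2)).
  apply: measurable_fun_pair => //.
  exact: (measurableT_comp (@measurable_normalize R n)).
have mG : measurable_fun setT (fun p : R * 'rV[R]_n =>
    ((0 < enorm p.2 < 1)%R%:R)%:E * F p.1 (normalize p.2)).
  apply: emeasurable_funM; last exact: (measurableT_comp mF mN).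
  by apply/measurable_EFinP; exact: (measurableT_comp measurable_puncture).
rewrite (ge0_integral_sphere hn); last 2 first.
- exact: (measurable_ge0_integral2 mu).
- by move=> z; apply: integral_ge0.
under eq_integral do rewrite (ge0_integral_sphere hn)//.
rewrite ge0_integralZl//; last 2 first.
- apply: (measurable_ge0_integral2 L mG) => r x.
  by apply: mule_ge0 => //; rewrite lee_fin.
- move=> r _; apply: integral_ge0 => x _.
  by apply: mule_ge0 => //; rewrite lee_fin.
apply: (congr1 (fun z => ((ball_vol n)^-1)%:E * z)).
rewrite (ge0_integral_swap mu L mG); last first.
  by move=> r x; apply: mule_ge0 => //; rewrite lee_fin.
apply: eq_integral => x _; rewrite ge0_integralZl//.
exact: (measurable_funS _ (@subsetT _ _) (measurableT_comp mFs
    (measurable_fun_pair (measurable_cst _) (@measurable_id _ _ _)))).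
Qed.

Lemma ge0_integral_sphere_isometry (T : 'rV[R]_n -> 'rV[R]_n) (g : 'rV[R]_n -> \bar R) :
  measurable_fun setT T -> {morph T : x y / (x + y)%R} ->
  (forall a x, T (a *: x)%R = (a *: T x)%R) -> involutive T ->
  (forall x, dotp (T x) (T x) = dotp x x) ->
  measurable_fun setT g -> (forall x, 0 <= g x) ->
  \int[sigma]_(z in sphere) g (T z) = \int[sigma]_(z in sphere) g z.
Proof.
move=> mT TD TZ TK Td mg g0.
rewrite (ge0_integral_sphere hn mg g0) (ge0_integral_sphere hn (g := fun z => g
    (T z)))//; last first.
  exact: (measurableT_comp mg).
apply: (congr1 (fun z => ((ball_vol n)^-1)%:E * z)).
rewrite -(ge0_integral_isometry hn mT TD TK Td (f := fun x => ((0 < enorm x <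
    1)%R%:R)%:E * g (normalize x))).
- by apply: eq_integral => x _; rewrite /normalize /enorm Td TZ.
- apply: emeasurable_funM;
    last exact: (measurableT_comp mg (@measurable_normalize R n)).
  by apply/measurable_EFinP; exact: measurable_puncture.
- by move=> x; apply: mule_ge0 => //; rewrite lee_fin.
Qed.

Lemma measurable_oppV : measurable_fun setT (fun x : 'rV[R]_n => - x)%R.
Proof.
have := @measurable_fun_rVB R _ _ n (cst 0%R) id (measurable_cst _)
    (@measurable_id _ _ _).
by under eq_fun do rewrite sub0r.
Qed.

Lemma ge0_integral_sphere_opp (g : 'rV[R]_n -> \bar R) :
  measurable_fun setT g -> (forall x, 0 <= g x) ->
  \int[sigma]_(z in sphere) g (- z)%R = \int[sigma]_(z in sphere) g z.
Proof.
move=> mg g0; apply: (ge0_integral_sphere_isometry (T := -%R)) => //.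
- exact: measurable_oppV.
- by move=> x y; rewrite opprD.
- by move=> a x; rewrite scalerN.
- exact: opprK.
- by move=> x; rewrite !dotpE opprK.
Qed.

Lemma surface_measure_sphere : sigma sphere = 1.
Proof.
have b0 := @ball_vol_gt0 R _ hn.
transitivity (\int[sigma]_(z in sphere) cst 1 z).
  by rewrite integral_cst ?mul1e//; exact: measurable_sphere.
rewrite (ge0_integral_sphere hn (g := cst 1))//.
rewrite (_ : \int[L]_x _ = (ball_vol n)%:E); first by rewrite -EFinM mulVf ?gt_eqF.
have mB := @measurable_oball R n.
have mz := measurable_rV_set1 (0%R : 'rV[R]_n); have z0 := @rV_lebesgue_set0 R n hn.
transitivity (\int[L]_(z in oball) cst 1 z); last first.
  by rewrite integral_cst// mul1e; exact: rV_lebesgue_oball.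
rewrite [RHS](ge0_negligible_integral mz)// [RHS]integral_mkcond.
apply: eq_integral => x _; rewrite mule1 patchE.
have -> : (x \in oball `\` [set 0%R]) = (0 < enorm x < 1)%R.
  apply/idP/idP; rewrite inE /= /oball /=.
    by move=> [-> x0]; rewrite andbT lt_neqAle enorm_ge0 eq_sym enorm_eq0
        !andbT; exact/eqP.
  by move=> /andP[x0 ->]; split => //; apply/eqP; rewrite -enorm_eq0 gt_eqF.
by case: ifP.
Qed.

(** Cauchy-Schwarz, from the nonnegative square of |y| x - |x| y. *)
Lemma dotp_le_enorm (x y : 'rV[R]_n) : (dotp x y <= enorm x * enorm y)%R.
Proof.
have [->|x0] := eqVneq x 0%R.
  by rewrite -(scale0r (0%R : 'rV[R]_n)) dotpZl mul0r mulr_ge0// enorm_ge0.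
have [->|y0] := eqVneq y 0%R.
  by rewrite -(scale0r (0%R : 'rV[R]_n)) dotpZr mul0r mulr_ge0// enorm_ge0.
have ex : (0 < enorm x)%R by rewrite lt_neqAle enorm_ge0 eq_sym enorm_eq0 x0.
have ey : (0 < enorm y)%R by rewrite lt_neqAle enorm_ge0 eq_sym enorm_eq0 y0.
have := dotp_ge0 (enorm y *: x - enorm x *: y)%R.
rewrite !dotpE -!sqr_enorm (dotpC y x).
set a := enorm x; set b := enorm y; set d := dotp x y => h.
have {h} : (0 <= (a * b) * (a * b - d))%R by nra.
by rewrite pmulr_rge0 ?mulr_gt0// subr_ge0.
Qed.

Lemma normr_dotp_le (x y : 'rV[R]_n) : (`|dotp x y| <= enorm x * enorm y)%R.
Proof.
rewrite ler_norml dotp_le_enorm andbT -[(- _ <= _)%R]lerN2 opprK -dotpNl.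
by rewrite -[enorm x]enormN dotp_le_enorm.
Qed.

End sphere_tools.

(** * Spherical means of the Poisson and Newtonian kernels *)

Section shell_kernel.
Context {R : realType}.
Local Notation mu := (@lebesgue_measure R).

(** The ray is y = x + rz with |z| = 1, a = <x, z> and rho = |x|; the factor r + 2ca is r^(n-1)
    times the shell kernel. The shell cuts out q1 - a < r < q2 - a with qi = sqrt(a^2 + Ri^2 -
    rho^2). The second summand of the result is odd in a, hence in z. *)
Lemma integral_ray (a rho R1 R2 c : R) : 0 <= rho -> rho < R1 -> R1 < R2 ->
  a ^+ 2 <= rho ^+ 2 ->
  (\int[mu]_r ((0 < r)%R%:R *
     ((R1 ^+ 2 < r ^+ 2 + 2 * a * r + rho ^+ 2 < R2 ^+ 2)%R%:R * (r + 2 * c * a)))%:E =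
  ((R2 ^+ 2 - R1 ^+ 2) / 2 + (2 * c - 1) * a *
   (Num.sqrt (a ^+ 2 + R2 ^+ 2 - rho ^+ 2) - Num.sqrt (a ^+ 2 +
       R1 ^+ 2 - rho ^+ 2)))%:E)%E.
Proof.
move=> rho0 rR1 R12 ar.
have r1 : rho ^+ 2 < R1 ^+ 2 by rewrite ltr_pXn2r ?nnegrE// (ltW (le_lt_trans
    rho0 rR1)).
have r2 : R1 ^+ 2 < R2 ^+ 2.
  by rewrite ltr_pXn2r ?nnegrE// ?(ltW (le_lt_trans rho0 rR1))// (ltW (lt_trans
      (le_lt_trans rho0 rR1) R12)).
set q1 := Num.sqrt (_ + R1 ^+ 2 - _); set q2 := Num.sqrt (_ + R2 ^+ 2 - _).
have q1E : q1 ^+ 2 = a ^+ 2 + R1 ^+ 2 - rho ^+ 2.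
  by rewrite sqr_sqrtr//; have := sqr_ge0 a; lra.
have q2E : q2 ^+ 2 = a ^+ 2 + R2 ^+ 2 - rho ^+ 2.
  by rewrite sqr_sqrtr//; have := sqr_ge0 a; lra.
have q10 : 0 <= q1 by exact: sqrtr_ge0.
have q20 : 0 <= q2 by exact: sqrtr_ge0.
have q12 : q1 < q2 by nra.
(* Since rho < R1, the point x lies in the hollow of the shell: each ray enters it once, at q1 - a >
   0. *)
have qa : `|a| < q1.
  have := sqr_ge0 a => a2.
  by rewrite -(ltr_pXn2r (n := 2))// ?nnegrE// real_normK ?num_real//; lra.
have [qa1 qa2] : - q1 < a /\ a < q1 by move: qa; rewrite ltr_norml => /andP.
pose p : {poly R} := 'X + (2 * c * a)%:P.
pose P : {poly R} := 2^-1 *: 'X^2 + (2 * c * a) *: 'X.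
have PE r : P.[r] = 2^-1 * r ^+ 2 + 2 * c * a * r by rewrite /P !hornerE.
have pE r : p.[r] = r + 2 * c * a by rewrite /p !hornerE.
have Pp : deriv P = p.
  rewrite /P /p derivD !derivZ derivX derivXn /= expr1 -[('X *+ 2)]scaler_nat scalerA.
  by rewrite mulVf ?pnatr_eq0// scale1r alg_polyC.
transitivity (\int[mu]_(r in `](q1 - a)%R, (q2 - a)%R[) (p.[r])%:E)%E.
  rewrite [RHS]integral_EFin_indic; apply: eq_integral => r _.
  rewrite pE mulrA -natrM mulnb indicE mem_setE in_itv/=.
  congr ((nat_of_bool _)%:R * _)%:E.
  by apply/idP/idP => [/and3P[? ? ?]|/andP[? ?]]; [apply/andP|apply/and3P]; split; nra.
rewrite -(@integral_itv_bndoo R (q1 - a) (q2 - a) (fun r => (p.[r])%:E) true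
    false); last first.
  apply: measurable_funTS; apply/measurable_EFinP.
  by apply: continuous_measurable_fun; exact: continuous_horner.
transitivity ((P.[q2 - a] - P.[q1 - a])%:E : \bar R).
  apply: (@integral_itvcc_FTC _ (horner P) (horner p)).
  - by rewrite lerD2r ltW.
  - by move=> x _; exact: continuous_horner.
  - by move=> x _; exact: continuous_horner.
  - by move=> x _; rewrite -Pp; exact: is_derive_poly.
congr EFin; rewrite !PE.
transitivity (((q2 ^+ 2 - q1 ^+ 2) / 2 + (2 * c - 1) * a * (q2 - q1))); first by field.
by rewrite q1E q2E; field.
Qed.

Variable n : nat.
Hypothesis hn : (2 <= n)%N.
Local Notation L := (@rV_lebesgue R n).
Local Notation sigma := (@surface_measure R n).

Let n0 : (0 < n)%N. Proof. exact: leq_trans hn. Qed.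

(* At [c = 0] this is the Newtonian kernel, and at [c = 1] the Poisson kernel
   of the sphere through y: its numerator is then |y|^2 - |x|^2. *)
Definition shell_kernel (c : R) (x y : 'rV[R]_n) : R :=
  (dotp (y - x) (y - x) + 2 * c * dotp (y - x) x) / enorm (y - x) ^+ n.

(** The numerator is the convex combination (1 - c) |y - x|^2 + c (|y|^2 - |x|^2). *)
Lemma shell_kernel_ge0 c x y : 0 <= c <= 1 -> dotp x x <= dotp y y ->
  0 <= shell_kernel c x y.
Proof.
move=> /andP[c0 c1] xy; rewrite divr_ge0 ?exprn_ge0 ?enorm_ge0//.
have h1 := dotp_ge0 (y - x).
rewrite (_ : _ + _ = (1 - c) * dotp (y - x) (y - x) + c * (dotp y y - dotp x x)).
  by rewrite addr_ge0// mulr_ge0//; lra.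
by rewrite !dotpE (dotpC x y); ring.
Qed.

Lemma measurable_shell_kernel c x : measurable_fun setT (shell_kernel c x).
Proof.
have mB : measurable_fun setT (fun y : 'rV[R]_n => y - x) by apply: measurable_fun_rVB.
apply: measurable_funM.
  apply: measurable_funD; first exact: measurable_dotp.
  by apply: measurable_funM => //; exact: measurable_dotp.
apply: measurable_fun_invr; last by move=> y; rewrite exprn_ge0 ?enorm_ge0.
by apply: measurable_funX; exact: measurable_fun_enorm.
Qed.

Definition in_shell (R1 R2 : R) (y : 'rV[R]_n) : R :=
  (R1 ^+ 2 < dotp y y < R2 ^+ 2)%R%:R.

Lemma measurable_in_shell R1 R2 : measurable_fun setT (in_shell R1 R2).
Proof.
rewrite (_ : in_shell R1 R2 = fun y =>
     ((R1 ^+ 2 < dotp y y)%R%:R * (dotp y y < R2 ^+ 2)%R%:R)%R); last first.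
  by apply/funext => p; rewrite -natrM mulnb.
by apply: measurable_funM; apply: measurable_indic_lt => //; exact: measurable_dotp.
Qed.

Lemma sphere_dotp (z : 'rV[R]_n) : sphere z -> dotp z z = 1.
Proof. by rewrite -sqr_enorm => ->; rewrite expr1n. Qed.

Section shell_integral.
Variables (c : R) (x : 'rV[R]_n) (R1 R2 : R).
Hypotheses (c01 : 0 <= c <= 1) (xR1 : enorm x < R1) (R12 : R1 < R2).

Let F y : \bar R := (in_shell R1 R2 y * shell_kernel c x y)%:E.

Let R10 : 0 < R1. Proof. exact: le_lt_trans (enorm_ge0 x) xR1. Qed.

Lemma shell_kernel_indic_ge0 y : 0 <= in_shell R1 R2 y * shell_kernel c x y.
Proof.
rewrite /in_shell; have [/andP[h1 h2]|_] := boolP (_ < _ < _); last by rewrite mul0r.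
rewrite mul1r shell_kernel_ge0// (le_trans _ (ltW h1))// -sqr_enorm.
by rewrite ler_pXn2r ?nnegrE ?enorm_ge0// ltW.
Qed.

Let F0 y : (0 <= F y)%E. Proof. by rewrite lee_fin shell_kernel_indic_ge0. Qed.

Let mF : measurable_fun setT F.
Proof.
apply/measurable_EFinP; apply: measurable_funM; first exact: measurable_in_shell.
exact: measurable_shell_kernel.
Qed.

Let w (r : R) : R := (0 < r)%R%:R * r ^+ n.-1.

Let w0 r : 0 <= w r.
Proof.
rewrite /w; have [r0|_] := ltP 0 r; last by rewrite mul0r.
by rewrite mul1r exprn_ge0// ltW.
Qed.

Let mw : measurable_fun setT w.
Proof.
apply: measurable_funM; first exact: measurable_indic_lt.
exact: measurable_funX.
Qed.

(* In polar coordinates centred at x, the ray in direction z meets the shell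
   in an interval, and the odd part of the integral in z cancels. *)
Lemma integral_shell_kernel :
  (\int[L]_y F y = (n%:R * ball_vol n * ((R2 ^+ 2 - R1 ^+ 2) / 2))%:E)%E.
Proof.
rewrite -(ge0_integral_rV_shift x mF F0).
have mFx : measurable_fun setT (fun z : 'rV[R]_n => F (z + x)).
  by apply: (measurableT_comp mF); apply: measurable_fun_rVD.
rewrite (integral_polar hn mFx)// [RHS]EFinM.
apply: (congr1 (fun z => (n%:R * ball_vol n)%:E * z)%E).
pose H (r : R) (z : 'rV[R]_n) : \bar R := ((w r)%:E * F (r *: z + x))%E.
have mH : measurable_fun setT (fun p : R * 'rV[R]_n => H p.1 p.2).
  apply: emeasurable_funM.
    by apply/measurable_EFinP; exact: (measurableT_comp mw).
  by apply: (measurableT_comp mFx); apply: measurable_fun_rVZ.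
have H0 r z : (0 <= H r z)%E.
  by apply: mule_ge0; [rewrite lee_fin; exact: w0|exact: F0].
transitivity (\int[mu]_r \int[sigma]_(z in sphere) H r z)%E.
  apply: eq_integral => r _; rewrite -ge0_integralZl//.
  - exact: measurable_sphere.
  - apply: measurable_funTS; apply: (measurableT_comp mFx).
    by apply: measurable_fun_rVZ.
  - exact: w0.
rewrite (ge0_integral_sphere_swap hn mH H0).
pose J z := (\int[mu]_r H r z)%E.
have J0 z : (0 <= J z)%E by exact: integral_ge0.
have mJ : measurable_fun setT J.
  apply: (measurable_ge0_integral2 mu (f := fun z r => H r z)) => //.
  by have := measurableT_comp mH (@measurable_swap _ _ 'rV[R]_n R).
have JE z : sphere z -> J z = ((R2 ^+ 2 - R1 ^+ 2) / 2 + (2 * c - 1) * dotp x z *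
   (Num.sqrt (dotp x z ^+ 2 + R2 ^+ 2 - enorm x ^+ 2) - Num.sqrt (dotp x z ^+ 2
       + R1 ^+ 2 - enorm x ^+ 2)))%:E.
  move=> Sz; have z1 := sphere_dotp Sz.
  rewrite -(integral_ray c (enorm_ge0 x) xR1 R12); last first.
    rewrite -[leLHS]real_normK ?num_real// ler_pXn2r ?nnegrE ?enorm_ge0//.
    by rewrite (le_trans (normr_dotp_le _ _))// Sz mulr1.
  apply: eq_integral => r _; rewrite /H /F -EFinM; congr EFin.
  rewrite /w /in_shell /shell_kernel addrK; have [r0|_] := ltP 0 r;
      last by rewrite !mul0r.
  rewrite !mul1r.
  have -> : dotp (r *: z + x) (r *: z + x) = r ^+ 2 + 2 * dotp x z * r + enorm x ^+ 2.
    by rewrite !dotpE sqr_enorm z1 (dotpC z x); ring.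
  rewrite mulrCA; congr (_ * _).
  rewrite !dotpE z1 enormZ Sz (gtr0_norm r0) !mulr1 (dotpC z x).
  have -> : r ^+ n = r * r ^+ n.-1 by rewrite -exprS prednK.
  by field; rewrite expf_neq0 ?gt_eqF.
suff : (\int[sigma]_(z in sphere) J z = ((R2 ^+ 2 - R1 ^+ 2) / 2)%:E)%E by [].
clearbody J.
(* J(z) + J(-z) is constant, because the odd part found in [integral_ray] cancels. *)
have JJ : (\int[sigma]_(z in sphere) J z + \int[sigma]_(z in sphere) J z =
    (R2 ^+ 2 - R1 ^+ 2)%:E)%E.
  have mJN : measurable_fun setT (fun z : 'rV[R]_n => J (- z)).
    by apply: (measurableT_comp mJ); exact: measurable_oppV.
  transitivity (\int[sigma]_(z in sphere) (J z + J (- z)%R))%E.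
    have -> := ge0_integralD sigma (@measurable_sphere R n) (fun z _ => J0 z)
      (measurable_funTS mJ) (fun z _ => J0 (- z)) (measurable_funTS mJN).
    by rewrite (ge0_integral_sphere_opp hn mJ J0).
  transitivity (\int[sigma]_(z in sphere) cst (R2 ^+ 2 - R1 ^+ 2)%:E z)%E.
    apply: eq_integral => z; rewrite inE => Sz.
    rewrite !JE//; last by rewrite /sphere /= enormN.
    rewrite dotpNr sqrrN -EFinD; congr EFin.
    set q1 := Num.sqrt _; set q2 := Num.sqrt _; clearbody q1 q2.
    by field.
  rewrite [LHS](integral_cst sigma (@measurable_sphere R n)).
  exact: etrans (congr1 (fun z => _ * z)%E (@surface_measure_sphere R n hn)) (mule1 _).
have IJ0 : (0 <= \int[sigma]_(z in sphere) J z)%E by apply: integral_ge0.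
move: JJ IJ0; case: (\int[sigma]_(z in sphere) J z)%E => [j| |]//.
by rewrite -EFinD => -[jj] _; congr EFin; rewrite -jj; field.
Qed.

(** The same shell integral in polar coordinates centred at 0, which turns it into a weighted
    integral of spherical means over the radii. *)
Lemma integral_shell_kernel_polar :
  (\int[mu]_(r in `]R1, R2[)
    ((r ^+ n.-1)%:E * \int[sigma]_(z in sphere) (shell_kernel c x (r *: z))%:E) =
   ((R2 ^+ 2 - R1 ^+ 2) / 2)%:E)%E.
Proof.
have := integral_shell_kernel; rewrite (integral_polar hn mF)// [RHS]EFinM.
have nb : n%:R * ball_vol n != 0 :> R.
  by rewrite mulf_neq0 ?pnatr_eq0 -?lt0n ?gt_eqF// ball_vol_gt0.
move=> /(congr1 (fun z => ((n%:R * ball_vol n)^-1)%:E * z)%E).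
rewrite !muleA -!EFinM mulVf// mul1e mul1r => <-.
rewrite [LHS]integral_mkcond; apply: eq_integral => r _; rewrite patchE.
have shE z : sphere z -> in_shell R1 R2 (r *: z) = (R1 ^+ 2 < r ^+ 2 < R2 ^+ 2)%R%:R.
  by move=> Sz; rewrite /in_shell !dotpE (sphere_dotp Sz) mulr1 -expr2.
rewrite mem_setE in_itv/=; have [r0|r0] := ltP 0 r; last first.
  by rewrite ifF ?mul0r ?mul0e// ltNge (le_trans r0)// ltW.
rewrite mul1r.
have rR : (R1 < r < R2) = (R1 ^+ 2 < r ^+ 2 < R2 ^+ 2).
  by rewrite !ltr_pXn2r// ?nnegrE ltW// (lt_trans R10).
rewrite rR; case: ifPn => h; last first.
  rewrite integral0_eq ?mule0// => z Sz.
  by rewrite /F shE// (negbTE h) mul0r.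
congr (_ * _)%E; apply: eq_integral => z; rewrite inE => Sz.
by rewrite /F shE// h mul1r.
Qed.

End shell_integral.
End shell_kernel.

(** * From integrals over shells to means over spheres *)

Section sphere_means.
Context {R : realType}.
Local Notation mu := (@lebesgue_measure R).

(** The integrals agree with those of the identity, so differentiating in the upper endpoint gives g
    r = r. The lower endpoint is taken midway between rho and r, because g is controlled only beyond
    rho. *)
Lemma continuous_eq_id_of_integrals (g : R -> R) (rho : R) :
  (forall r, rho < r -> {for r, continuous g}) ->
  (forall R1 R2, rho < R1 -> R1 < R2 ->
    (\int[mu]_(r in `]R1, R2[) (g r)%:E = ((R2 ^+ 2 - R1 ^+ 2) / 2)%:E)%E) ->
  forall r, rho < r -> g r = r.
Proof.
move=> cg ig r rr.
pose a := (rho + r) / 2; pose u := r + 1.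
have ra : rho < a by rewrite /a; lra.
have ar : a < r by rewrite /a; lra.
have ru : r < u by rewrite /u; lra.
have iau : mu.-integrable `[a, u] (EFin \o g).
  apply: continuous_compact_integrable => //; first exact: segment_compact.
  apply/continuous_in_subspaceT => t; rewrite inE /= in_itv/= => /andP[at_ _].
  by apply: cg; rewrite (lt_le_trans ra).
have [dF F'] := continuous_FTC1_closed ru iau ar (cg _ rr).
pose P : {poly R} := 2^-1 *: 'X^2 - (a ^+ 2 / 2)%:P.
have FP : {near r, (fun t => \int[mu]_(s in `[a, t]) g s) =1 horner P}.
  near=> t.
  have at_ : a < t by near: t; exact: lt_nbhsr.
  have mgt : measurable_fun `]a, t[ (EFin \o g).
    apply/measurable_EFinP; apply: open_continuous_measurable_fun => //.
    move=> s; rewrite inE /= in_itv/= => /andP[as_ _].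
    by apply: cg; rewrite (lt_trans ra).
  rewrite /Rintegral (integral_itv_bndoo true false mgt) ig//=.
  by rewrite /P hornerD hornerN hornerZ hornerXn hornerC; field.
have : derive1 (fun t => \int[mu]_(s in `[a, t]) g s) r = r.
  rewrite derive1E (near_eq_derive _ FP).
  have [_ ->] := is_derive_poly P r.
  rewrite /P derivB derivZ derivXn derivC subr0 hornerZ hornerMn hornerXn.
  by rewrite -mulr_natl; field.
by move=> E; rewrite -[RHS]E; exact/esym.
Unshelve. all: by end_near. Qed.

Variable n : nat.
Hypothesis hn : (2 <= n)%N.
Local Notation sigma := (@surface_measure R n).

Let n0 : (0 < n)%N. Proof. exact: leq_trans hn. Qed.

Lemma integrable_sphere_bounded (h : 'rV[R]_n -> R) (C : R) :
  measurable_fun sphere h -> (forall z, sphere z -> `|h z| <= C) ->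
  sigma.-integrable sphere (EFin \o h).
Proof.
move=> mh hC; apply: (@le_integrable _ _ _ _ _ (@measurable_sphere R n) _ (EFin
    \o cst `|C|)).
- exact/measurable_EFinP.
- move=> z Sz /=; rewrite lee_fin normr_id (le_trans (hC _ Sz))//.
  exact: ler_norm.
- apply/integrableP; split; first by apply/measurable_EFinP; exact: measurable_cst.
  under eq_integral do rewrite /= normr_id.
  have := integral_cst sigma (@measurable_sphere R n) `|C|%:E.
  rewrite /cst => ->.
  by rewrite (_ : (_ * _)%E = `|C|%:E) ?ltry//;
      exact: etrans (congr1 (fun z => _ *
      z)%E (@surface_measure_sphere R n hn)) (mule1 _).
Qed.

Lemma dotp_sub_sphere (x z : 'rV[R]_n) (r : R) : sphere z ->
  dotp (r *: z - x) (r *: z - x) = r ^+ 2 - 2 * r * dotp x z + enorm x ^+ 2.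
Proof.
by move=> Sz; rewrite !dotpE (sphere_dotp Sz) sqr_enorm (dotpC z x); ring.
Qed.

Lemma le_enorm_sub_sphere (x z : 'rV[R]_n) (r : R) : sphere z ->
  r - enorm x <= enorm (r *: z - x) <= `|r| + enorm x.
Proof.
move=> Sz; have := normr_dotp_le x z; rewrite Sz mulr1 ler_norml => /andP[a1 a2].
have e0 := enorm_ge0 x.
have H := dotp_sub_sphere x r Sz.
have E := enorm_ge0 (r *: z - x).
have E2 := sqr_enorm (r *: z - x); rewrite H in E2.
apply/andP; split.
  have [r0|r0] := leP r 0; first by rewrite (le_trans _ E)//; lra.
  have [rx|rx] := leP r (enorm x); first by rewrite (le_trans _ E)//; lra.
  rewrite -(ler_pXn2r (n := 2))// ?nnegrE ?subr_ge0 ?(ltW rx)// E2; nra.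
rewrite -(ler_pXn2r (n := 2))// ?nnegrE ?addr_ge0// E2 sqrrD real_normK ?num_real//.
have : - (r * dotp x z) <= `|r| * enorm x.
  rewrite -mulNr (le_trans (ler_norm _))// normrM normrN ler_wpM2l//.
  by rewrite ler_norml a1 a2.
lra.
Qed.

Lemma shell_kernel_sphereE (c r : R) (x z : 'rV[R]_n) : sphere z ->
  shell_kernel c x (r *: z) =
  (r ^+ 2 - 2 * r * dotp x z + enorm x ^+ 2 + 2 * c * (r * dotp x z - enorm x ^+ 2)) /
  Num.sqrt (r ^+ 2 - 2 * r * dotp x z + enorm x ^+ 2) ^+ n.
Proof.
move=> Sz; rewrite /shell_kernel /enorm dotp_sub_sphere//; congr (_ / _).
by rewrite -/(enorm x) sqr_enorm !dotpE (dotpC z x).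
Qed.

Lemma continuous_shell_kernel (c r : R) (x z : 'rV[R]_n) : sphere z ->
  enorm x < r -> {for r, continuous (fun t : R => shell_kernel c x (t *: z))}.
Proof.
move=> Sz xr.
pose q : {poly R} := 'X^2 - (2 * dotp x z) *: 'X + (enorm x ^+ 2)%:P.
pose p : {poly R} := q + (2 * c) *: (dotp x z *: 'X - (enorm x ^+ 2)%:P).
have qE t : q.[t] = t ^+ 2 - 2 * t * dotp x z + enorm x ^+ 2.
  by rewrite /q !hornerE; ring.
rewrite (_ : (fun t => _) = fun t => p.[t] * (Num.sqrt q.[t] ^+ n)^-1); last first.
  apply/funext => t; rewrite shell_kernel_sphereE// qE; congr (_ / _).
  by rewrite /p hornerD qE hornerZ hornerD hornerN hornerZ hornerX hornerC; ring.
have q0 : 0 < Num.sqrt q.[r].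
  rewrite qE -dotp_sub_sphere// -/(enorm _).
  have /andP[h _] := le_enorm_sub_sphere x r Sz.
  by rewrite (lt_le_trans _ h)// subr_gt0.
apply: (@continuousM _ _ (horner p)); first exact: continuous_horner.
apply: (@continuous_comp _ _ _ (fun t => Num.sqrt q.[t] ^+ n) (@GRing.inv R)).
  apply: (@continuous_comp _ _ _ (horner q) (fun t : R => Num.sqrt t ^+ n)).
    exact: continuous_horner.
  exact: continuous_sqrtX.
by apply: inv_continuous; rewrite expf_neq0// gt_eqF.
Qed.

(** A bound uniform in z and in r between u and v, used as the dominating function for continuity in
    r. The condition |x| < u keeps these spheres away from the pole x. *)
Lemma shell_kernel_bound (c r u v : R) (x z : 'rV[R]_n) : 0 <= c <= 1 ->
  sphere z -> enorm x < u -> u < r -> r < v ->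
  `|shell_kernel c x (r *: z)| <= ((v + enorm x) ^+ 2 + v ^+ 2) / (u - enorm x) ^+ n.
Proof.
move=> c01 Sz xu ur rv; have e0 := enorm_ge0 x.
have /andP[h1 h2] := le_enorm_sub_sphere x r Sz.
have r0 : 0 < r by lra.
rewrite ger0_norm; last first.
  apply: shell_kernel_ge0 => //; rewrite -!sqr_enorm ler_pXn2r ?nnegrE ?enorm_ge0//.
  by rewrite enormZ Sz mulr1 gtr0_norm//; lra.
rewrite gtr0_norm// in h2.
have un : 0 < (u - enorm x) ^+ n by rewrite exprn_gt0// subr_gt0.
apply: ler_pM => //.
- rewrite (_ : dotp (r *: z - x) x = r * dotp x z - enorm x ^+ 2); last first.
    by rewrite !dotpE -sqr_enorm (dotpC z x).
  rewrite dotp_sub_sphere//; case/andP: c01 => c0 c1.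
  have k1 : 0 <= (1 - c) * (r ^+ 2 - 2 * r * dotp x z + enorm x ^+ 2).
    by rewrite mulr_ge0 ?subr_ge0// -dotp_sub_sphere// dotp_ge0.
  have k2 : 0 <= c * (r ^+ 2 - enorm x ^+ 2) by rewrite mulr_ge0//; nra.
  lra.
- by rewrite invr_ge0 exprn_ge0// enorm_ge0.
- have q2 : dotp (r *: z - x) (r *: z - x) <= (v + enorm x) ^+ 2.
    rewrite -sqr_enorm ler_pXn2r ?nnegrE ?enorm_ge0//; lra.
  have := dotp_ge0 (r *: z - x); move: q2.
  rewrite [dotp (r *: z - x) x](_ : _ = r * dotp x z - enorm x ^+ 2); last first.
    by rewrite !dotpE -sqr_enorm (dotpC z x).
  have D := dotp_sub_sphere x r Sz; move=> q2 q1.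
  have -> : dotp (r *: z - x) (r *: z - x) + 2 * c * (r * dotp x z - enorm x ^+ 2) =
     (1 - c) * dotp (r *: z - x) (r *: z - x) + c *
         (r ^+ 2 - enorm x ^+ 2) by rewrite D; ring.
  case/andP: c01 => c0 c1.
  have k1 : (1 - c) * dotp (r *: z - x) (r *: z - x) <= (v + enorm x) ^+ 2.
    by rewrite (le_trans _ q2)// ler_piMl//; lra.
  have k2 : c * (r ^+ 2 - enorm x ^+ 2) <= v ^+ 2.
    have : c * (r ^+ 2 - enorm x ^+ 2) <= r ^+ 2 - enorm x ^+ 2 by rewrite
        ler_piMl//; nra.
    nra.
  lra.
- rewrite lef_pV2 ?posrE//.
    by rewrite ler_pXn2r ?nnegrE ?enorm_ge0//; lra.
  by rewrite exprn_gt0//; lra.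
Qed.

(** With [phi t] the mean over the sphere of radius t, t^(n-1) [phi t] is continuous by domination
    and has the integral (R2^2 - R1^2)/2 between R1 and R2, so it equals t. The value depends
    neither on x nor on c. *)
Lemma sphere_mean_shell_kernel (c r : R) (x : 'rV[R]_n) : 0 <= c <= 1 ->
  enorm x < r ->
  (\int[sigma]_(z in sphere) (shell_kernel c x (r *: z))%:E = (r / r ^+ n.-1)%:E)%E.
Proof.
move=> c01 xr; have e0 := enorm_ge0 x.
have mK t : measurable_fun sphere (fun z : 'rV[R]_n => shell_kernel c x (t *: z)).
  apply: measurable_funTS; apply: (measurableT_comp (measurable_shell_kernel c x)).
  exact: measurable_fun_rVZ.
have iK t : enorm x < t -> sigma.-integrable sphere (EFin \o (fun z =>
    shell_kernel c x (t *: z))).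
  move=> xt; apply: (integrable_sphere_bounded (mK t)) => z Sz.
  by apply: (@shell_kernel_bound c t ((enorm x + t) / 2) (t + 1)) => //; lra.
pose phi t := \int[sigma]_(z in sphere) shell_kernel c x (t *: z).
have phiE t : enorm x < t ->
    ((phi t)%:E = \int[sigma]_(z in sphere) (shell_kernel c x (t *: z))%:E)%E.
  move=> xt; rewrite /phi /Rintegral fineK//.
  exact: (integrable_fin_num (@measurable_sphere R n) (iK _ xt)).
have cphi t : enorm x < t -> {for t, continuous phi}.
  move=> xt; pose u := (enorm x + t) / 2; pose v := t + 1.
  have xu : enorm x < u by rewrite /u; lra.
  have tI : t \in `]u, v[%classic by rewrite inE /= in_itv/= /u /v; apply/andP;
      split; lra.
  apply: (@continuity_under_integral _ _ _ sigma (fun t z => shell_kernel c x (t *: z))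
     sphere (@measurable_sphere R n) u v _ _
     (cst (((v + enorm x) ^+ 2 + v ^+ 2) / (u - enorm x) ^+ n)) _ _ t tI).
  - by move=> s; rewrite /= in_itv/= => /andP[us _]; apply: iK; exact: lt_trans us.
  - apply: aeW => z Sz s; rewrite inE /= in_itv/= => /andP[us _].
    by apply: continuous_shell_kernel => //; exact: lt_trans us.
  - by apply: (@integrable_sphere_bounded _ `|_| (measurable_cst _)) => z _;
      exact: lexx.
  - move=> s; rewrite /= in_itv/= => /andP[us sv]; apply: aeW => z Sz.
    exact: shell_kernel_bound.
rewrite -phiE//; congr EFin.
have r0 : 0 < r by lra.
apply: (mulIf (_ : r ^+ n.-1 != 0)); first by rewrite expf_neq0// gt_eqF.
rewrite divfK ?expf_neq0 ?gt_eqF// mulrC.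
apply: (@continuous_eq_id_of_integrals (fun t => t ^+ n.-1 * phi t) (enorm x)) => //.
- move=> t xt; apply: (@continuousM R R (fun t : R => t ^+ n.-1) phi t);
    last exact: cphi.
  exact: exprn_continuous.
- move=> R1 R2 xR1 R12; rewrite -(integral_shell_kernel_polar hn c01 xR1 R12).
  apply: eq_integral => t; rewrite inE /= in_itv/= => /andP[R1t _].
  by rewrite EFinM phiE//; exact: lt_trans R1t.
Qed.

End sphere_means.

(** * Means of the Poisson, Newtonian and Green kernels *)

Section potentials_of_powers.
Context {R : realType}.
Local Notation mu := (@lebesgue_measure R).

Lemma integral_itvoo_monomials (a b alpha beta : R) (p q : nat) : a <= b ->
  (\int[mu]_(r in `]a, b[) (alpha * r ^+ p + beta * r ^+ q)%:E =
   (alpha * (b ^+ p.+1 - a ^+ p.+1) / p.+1%:R +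
    beta * (b ^+ q.+1 - a ^+ q.+1) / q.+1%:R)%:E)%E.
Proof.
move=> ab.
pose f : {poly R} := alpha *: 'X^p + beta *: 'X^q.
pose P : {poly R} := (alpha / p.+1%:R) *: 'X^(p.+1) + (beta / q.+1%:R) *: 'X^(q.+1).
have Pf : deriv P = f.
  rewrite /P /f derivD !derivZ !derivXn /=.
  have mn (e : R) k (v : {poly R}) : (e / k.+1%:R) *: (v *+ k.+1) = e *: v.
    by rewrite -[v *+ _]scaler_nat scalerA divfK ?pnatr_eq0.
  by rewrite !mn.
have fE r : alpha * r ^+ p + beta * r ^+ q = f.[r].
  by rewrite /f hornerD !hornerZ !hornerXn.
have PE r : P.[r] = alpha / p.+1%:R * r ^+ p.+1 + beta / q.+1%:R * r ^+ q.+1.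
  by rewrite /P hornerD !hornerZ !hornerXn.
under eq_integral do rewrite fE.
rewrite -(@integral_itv_bndoo R a b (fun r => (f.[r])%:E) true false); last first.
  apply: measurable_funTS; apply/measurable_EFinP.
  by apply: continuous_measurable_fun; exact: continuous_horner.
transitivity ((P.[b] - P.[a])%:E : \bar R).
  apply: (@integral_itvcc_FTC _ (horner P) (horner f)) => //.
  - by move=> x _; exact: continuous_horner.
  - by move=> x _; exact: continuous_horner.
  - by move=> x _; rewrite -Pf; exact: is_derive_poly.
congr EFin; rewrite !PE.
set A := _ ^+ p.+1; set B := _ ^+ p.+1; set A' := _ ^+ q.+1; set B' := _ ^+ q.+1.
by field; rewrite !(addrC 1) !natr1 !pnatr_eq0.
Qed.

Variable n : nat.
Hypothesis hn : (3 <= n)%N.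
Local Notation sigma := (@surface_measure R n).

Let hn2 : (2 <= n)%N. Proof. exact: leq_trans hn. Qed.

Lemma enorm_subC (x y : 'rV[R]_n) : enorm (x - y) = enorm (y - x).
Proof. by rewrite -enormN opprB. Qed.

(** The shell kernel at c = 1 on the unit sphere. *)
Lemma integral_poisson_kernel (x : 'rV[R]_n) : oball x ->
  (\int[sigma]_(z in sphere) (poisson_kernel x z)%:E = 1)%E.
Proof.
move=> x1; have h1 : 0 <= (1 : R) <= 1 by rewrite ler01 /=.
have := sphere_mean_shell_kernel hn2 h1 x1; rewrite expr1n divr1 => <-.
apply: eq_integral => z; rewrite inE => Sz; congr EFin.
rewrite scale1r /shell_kernel /poisson_kernel (enorm_subC z x); congr (_ / _).
by rewrite !dotpE (sphere_dotp Sz) sqr_enorm (dotpC z x); ring.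
Qed.

(** The shell kernel at c = 0: Newton's theorem for a point inside the sphere of radius s. *)
Lemma integral_newton (x : 'rV[R]_n) (s : R) : enorm x < s ->
  (\int[sigma]_(z in sphere) ((enorm (x - s *: z) ^+ (n - 2))^-1)%:E =
   ((s ^+ (n - 2))^-1)%:E)%E.
Proof.
move=> xs; have e0 := enorm_ge0 x.
have s0 : 0 < s by lra.
have h1 : 0 <= (0 : R) <= 1 by rewrite ler01 andbT.
have := sphere_mean_shell_kernel hn2 h1 xs.
have -> : s / s ^+ n.-1 = (s ^+ (n - 2))^-1.
  rewrite (_ : n.-1 = (n - 2).+1); last by rewrite subnSK// subn1.
  by rewrite exprS invfM mulrA divff ?mul1r// gt_eqF.
move=> <-; apply: eq_integral => z; rewrite inE => Sz; congr EFin.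
rewrite /shell_kernel mulr0 mul0r addr0 -sqr_enorm enorm_subC.
have /andP[h _] := le_enorm_sub_sphere x s Sz.
have : 0 < enorm (x - s *: z) by rewrite enorm_subC; lra.
move: (enorm (x - s *: z)) => e e1.
rewrite -[in RHS](subnK hn2) exprD invfM mulrCA mulfV ?mulr1//.
by rewrite expf_neq0// gt_eqF.
Qed.

Lemma measurable_enorm_sub_inv d (T : measurableType d) (f g : T -> 'rV[R]_n) k :
  measurable_fun setT f -> measurable_fun setT g ->
  measurable_fun setT (fun t => (enorm (f t - g t) ^+ k)^-1).
Proof.
move=> mf mg; apply: measurable_fun_invr; last first.
  by move=> t; rewrite exprn_ge0// enorm_ge0.
by apply: measurable_funX; apply: measurable_fun_enorm; exact: measurable_fun_rVB.
Qed.

Lemma measurable_green_kernel d (T : measurableType d) (f g : T -> 'rV[R]_n) :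
  measurable_fun setT f -> measurable_fun setT g ->
  measurable_fun setT (fun t => green_kernel (f t) (g t)).
Proof.
move=> mf mg; apply: measurable_funM => //; apply: measurable_funB.
  exact: measurable_enorm_sub_inv.
apply: measurable_fun_invr; last by move=> t; rewrite exprn_ge0// sqrtr_ge0.
apply: measurable_funX; apply: measurable_sqrt; apply: measurable_funD.
  by apply: measurable_funB => //; apply: measurable_funM => //; exact: measurable_dotp.
by apply: measurable_funM; apply: measurable_funX; exact: measurable_fun_enorm.
Qed.

Lemma sphere_area_gt0 : 0 < (sphere_area n : R).
Proof.
rewrite -ball_vol_area// mulr_gt0 ?ball_vol_gt0// ltr0n.
exact: leq_trans hn2.
Qed.

(** From [x, y]^2 - |x - y|^2 = (1 - |x|^2)(1 - |y|^2). *)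
Lemma green_kernel_ge0 (x y : 'rV[R]_n) : oball x -> oball y -> y != x ->
  0 <= green_kernel x y.
Proof.
move=> x1 y1 yx.
have n2 : (0 : R) < n%:R - 2.
  by rewrite subr_gt0 ltr_nat.
rewrite mulr_ge0//.
  by rewrite invr_ge0 mulr_ge0// ltW// sphere_area_gt0.
have e : 0 < enorm (x - y).
  by rewrite lt_neqAle enorm_ge0 eq_sym enorm_eq0 subr_eq0 eq_sym yx.
have E : enorm (x - y) <= bracket x y.
  rewrite /enorm /bracket ler_wsqrtr//.
  rewrite !sqr_enorm !dotpE (dotpC y x) opprK.
  move: x1 y1 => /oballE x1 /oballE y1.
  have := dotp_ge0 x; have := dotp_ge0 y; nra.
have b0 : 0 < bracket x y := lt_le_trans e E.
rewrite subr_ge0 lef_pV2 ?posrE ?exprn_gt0//.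
by rewrite lerXn2r ?nnegrE ?sqrtr_ge0.
Qed.

(* [green_kernel x x] is a negative junk value (the pole is inverted to 0). *)
Definition green_pos (x y : 'rV[R]_n) : R :=
  (y != x)%:R * (\1_oball y * green_kernel x y).

Lemma green_pos_ge0 x y : oball x -> 0 <= green_pos x y.
Proof.
move=> x1; rewrite /green_pos indicE.
have [->|yx] := eqVneq y x; first by rewrite mul0r.
have [/set_mem y1|_] := boolP (y \in oball); last by rewrite mul0r mulr0.
by rewrite !mul1r green_kernel_ge0.
Qed.

Lemma measurable_green_pos x : measurable_fun setT (green_pos x).
Proof.
apply: measurable_funM; last first.
  apply: measurable_funM.
    by apply: measurable_indic; exact: measurable_oball.
  by apply: measurable_green_kernel.
rewrite (_ : (fun _ => _) = fun y : 'rV[R]_n => (0 < enorm (y - x))%R%:R).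
  apply: measurable_indic_lt => //; apply: measurable_fun_enorm.
  exact: measurable_fun_rVB.
apply/funext => y; congr (nat_of_bool _)%:R.
by rewrite -subr_eq0 -enorm_eq0 lt_neqAle enorm_ge0 andbT eq_sym.
Qed.

Lemma ge0_integral_EFinB (k : R) (f g : 'rV[R]_n -> R) (a b : R) :
  measurable_fun setT f -> measurable_fun setT g ->
  (forall z, 0 <= f z) -> (forall z, 0 <= g z) ->
  (\int[sigma]_(z in sphere) (f z)%:E = a%:E)%E ->
  (\int[sigma]_(z in sphere) (g z)%:E = b%:E)%E ->
  (\int[sigma]_(z in sphere) (k * (f z - g z))%:E = (k * (a - b))%:E)%E.
Proof.
move=> mf mg f0 g0 fa gb.
have i (h : 'rV[R]_n -> R) (c : R) : measurable_fun setT h -> (forall z, 0 <= h z) ->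
  (\int[sigma]_(z in sphere) (h z)%:E = c%:E)%E -> sigma.-integrable sphere (EFin \o h).
  move=> mh h0 hc; apply/integrableP; split;
      first exact/measurable_EFinP/measurable_funTS.
  under eq_integral do rewrite /= ger0_norm//.
  by rewrite hc ltry.
have mS := @measurable_sphere R n.
have {}fi := i _ _ mf f0 fa; have {}gi := i _ _ mg g0 gb.
under eq_integral do rewrite EFinM.
rewrite integralZl//; last exact: (integrableB mS fi gi).
by rewrite integralB_EFin// fa gb.
Qed.

(** The image term is Newtonian as well, since [x, sz] = |sx - z|, and its mean is 1. For s < |x|
    the two radii exchange roles through |x - sz| = |(s/|x|) x - |x| z|, which produces the maximum.
    At s = |x| the sphere passes through the pole. *)
Lemma sphere_mean_green (x : 'rV[R]_n) (s : R) : oball x -> 0 < s -> s < 1 ->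
  s != enorm x ->
  (\int[sigma]_(z in sphere) (green_kernel x (s *: z))%:E =
   (((n%:R - 2) * sphere_area n)^-1 *
    ((Num.max (enorm x) s ^+ (n - 2))^-1 - 1))%:E)%E.
Proof.
move=> x1 s0 s1 sx; have e0 := enorm_ge0 x.
have n2 : (0 : R) < n%:R - 2 by rewrite subr_gt0 ltr_nat.
have mz (t : R) (y : 'rV[R]_n) : measurable_fun setT
    (fun z : 'rV[R]_n => (enorm (y - t *: z) ^+ (n - 2))^-1).
  by apply: measurable_enorm_sub_inv => //; exact: measurable_fun_rVZ.
have z0 (t : R) (y z : 'rV[R]_n) : 0 <= (enorm (y - t *: z) ^+ (n - 2))^-1.
  by rewrite invr_ge0 exprn_ge0// enorm_ge0.
have I1 : (\int[sigma]_(z in sphere) ((enorm (x - s *: z) ^+ (n - 2))^-1)%:E =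
    ((Num.max (enorm x) s ^+ (n - 2))^-1)%:E)%E.
  have [xs|sx'] := ltP (enorm x) s; first exact: integral_newton.
  have {sx sx'} sx : s < enorm x by rewrite lt_neqAle sx.
  have x0 : 0 < enorm x by lra.
  have hx : enorm ((s / enorm x) *: x) < enorm x.
    by rewrite enormZ gtr0_norm ?divr_gt0// divfK// gt_eqF.
  rewrite -(integral_newton hx); apply: eq_integral => z; rewrite inE => Sz.
  congr (_ ^+ _)^-1%:E; apply: (congr1 Num.sqrt).
  rewrite !dotpE (sphere_dotp Sz) (dotpC z x) -(sqr_enorm x); field.
  by rewrite gt_eqF.
have I2 : (\int[sigma]_(z in sphere) ((enorm (s *: x - 1 *: z) ^+ (n -
    2))^-1)%:E = 1)%E.
  have hx : enorm (s *: x) < 1.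
    by rewrite enormZ gtr0_norm// mulr_ilt1// ltW.
  by rewrite integral_newton// expr1n invr1.
rewrite -(ge0_integral_EFinB _ (mz s x) (mz 1 (s *: x)) (z0 _ _) (z0 _ _) I1 I2).
have E z : sphere z -> green_kernel x (s *: z) =
   ((n%:R - 2) * sphere_area n)^-1 *
       ((enorm (x - s *: z) ^+ (n - 2))^-1 - (enorm (s *: x - 1 *: z) ^+ (n - 2))^-1).
  move=> Sz; rewrite /green_kernel; congr (_ * (_ - _)).
  rewrite /bracket /enorm; congr (Num.sqrt _ ^+ _)^-1.
  rewrite -/(enorm x) -/(enorm (s *: z)) !sqr_enorm !dotpE (sphere_dotp Sz) (dotpC z x).
  ring.
by apply: eq_integral => z; rewrite inE => Sz; rewrite E.
Qed.

End potentials_of_powers.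

(** * Green potentials *)

Section green_potential_of_powers.
Context {R : realType} (n : nat).
Hypothesis hn : (3 <= n)%N.
Local Notation mu := (@lebesgue_measure R).
Local Notation L := (@rV_lebesgue R n).
Local Notation sigma := (@surface_measure R n).

Let hn2 : (2 <= n)%N. Proof. exact: leq_trans hn. Qed.

(** The value solves -Delta u = |y|^(2j) with u = 0 on the sphere, as Delta |x|^(2j+2) =
    2(j+1)(2j+n) |x|^(2j). It is computed in polar coordinates, where the mean of the Green kernel
    leaves monomials in r on each side of r = |x|. *)
Lemma integral_green_pos (x : 'rV[R]_n) (j : nat) : oball x ->
  (\int[L]_y (green_pos x y * dotp y y ^+ j)%:E =
   ((1 - dotp x x ^+ j.+1) / ((2 * j.+1%:R) * ((2 * j)%:R + n%:R)))%:E)%E.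
Proof.
move=> x1; set rho := enorm x.
have rho0 : 0 <= rho := enorm_ge0 x.
have rho1 : rho < 1 by [].
have n2 : (0 : R) < n%:R - 2 by rewrite subr_gt0 ltr_nat.
have sa := @sphere_area_gt0 R n hn.
pose f y : \bar R := (green_pos x y * dotp y y ^+ j)%:E.
have mf : measurable_fun setT f.
  apply/measurable_EFinP; apply: measurable_funM; first exact: measurable_green_pos.
  by apply: measurable_funX; exact: measurable_dotp.
have f0 y : (0 <= f y)%E.
  by rewrite lee_fin mulr_ge0 ?green_pos_ge0// exprn_ge0// dotp_ge0.
rewrite -/(f _) (integral_polar hn2 mf f0) ball_vol_area//.
pose U (r : R) := (((0 < r)%R%:R * r ^+ n.-1)%:E *
    \int[sigma]_(z in sphere) f (r *: z))%E.
have mfz r : measurable_fun setT (fun z : 'rV[R]_n => f (r *: z)).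
  by apply: (measurableT_comp mf); exact: measurable_fun_rVZ.
have mU : measurable_fun setT U.
  apply: emeasurable_funM.
    apply/measurable_EFinP; apply: measurable_funM; last exact: measurable_funX.
    exact: measurable_indic_lt.
  rewrite (_ : (fun r => _) = fun r => (((ball_vol n)^-1)%:E *
      \int[L]_y (((0 < enorm y < 1)%R%:R)%:E * f (r *: normalize y)))%E); last first.
    by apply/funext => r; rewrite (ge0_integral_sphere hn2 (mfz r)).
  apply: measurable_funeM; apply: (measurable_ge0_integral2 L).
    apply: emeasurable_funM.
      by apply/measurable_EFinP; exact: (measurableT_comp (@measurable_puncture R n)).
    apply: (measurableT_comp mf); apply: measurable_fun_rVZ => //.
    exact: (measurableT_comp (@measurable_normalize R n)).
  by move=> r y; apply: mule_ge0 => //; rewrite lee_fin.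
pose C := ((n%:R - 2) * (sphere_area n : R))^-1.
have Ur r : 0 < r -> r < 1 -> r != rho ->
    U r = (C * (r ^+ n.-1 * r ^+ (2 * j) * ((Num.max rho r ^+ (n - 2))^-1 - 1)))%:E.
  move=> r0 r1 rr; rewrite /U r0 mul1r.
  transitivity ((r ^+ n.-1)%:E * \int[sigma]_(z in sphere) ((r ^+ (2 * j))%:E *
      (green_kernel x (r *: z))%:E))%E.
    congr (_ * _)%E; apply: eq_integral => z; rewrite inE => Sz.
    have erz : enorm (r *: z) = r by rewrite enormZ Sz mulr1 gtr0_norm.
    rewrite -EFinM /f /green_pos -sqr_enorm erz -exprM indicE mem_set;
        last by rewrite /oball/= erz.
    rewrite (_ : r *: z != x) ?mul1r ?(mulrC (r ^+ _))//.
    by apply: contra_neq rr => rz; rewrite /rho -rz erz.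
  rewrite ge0_integralZl//; last 4 first.
  - exact: measurable_sphere.
  - apply: measurable_funTS; apply/measurable_EFinP.
    by apply: measurable_green_kernel => //; exact: measurable_fun_rVZ.
  - move=> z Sz; rewrite lee_fin green_kernel_ge0//.
      by rewrite /oball/= enormZ Sz mulr1 gtr0_norm.
    by apply: contra_neq rr => rz; rewrite /rho -rz enormZ Sz mulr1 gtr0_norm.
  - by rewrite lee_fin exprn_ge0// ltW.
  rewrite sphere_mean_green// -!EFinM; congr EFin.
  by rewrite -/C -/rho; ring.
have Uout r : ~ (0 < r < 1) -> U r = 0%E.
  move=> r01; rewrite /U; have [r0|r0] := ltP 0 r; last by rewrite mul0r mul0e.
  have r1 : 1 <= r by rewrite leNgt; apply/negP => r1; apply: r01; rewrite r0.
  rewrite integral0_eq ?mule0// => z Sz;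
      rewrite /f /green_pos indicE memNset ?mul0r ?mulr0 ?mul0r//.
  by rewrite /oball /= enormZ Sz mulr1 gtr0_norm// => /(le_lt_trans r1); rewrite ltxx.
have U0 r : (0 <= U r)%E.
  rewrite /U mule_ge0 ?integral_ge0// lee_fin.
  by have [r0|_] := ltP 0 r; rewrite ?mul0r// mul1r exprn_ge0// ltW.
rewrite -/(U _).
have -> : (\int[mu]_r U r =
    \int[mu]_(r in `]0%R, rho[) U r + \int[mu]_(r in `]rho, 1%R[) U r)%E.
  transitivity (\int[mu]_(r in `]0%R, 1%R[) U r)%E.
    rewrite [RHS]integral_mkcond; apply: eq_integral => r _; rewrite patchE.
    by case: ifPn => //; rewrite notin_setE /= in_itv/= => /Uout.
  rewrite [X in (_ + X)%E](integral_itv_obnd_cbnd (measurable_funTS mU)).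
  have [rho_gt0|] := ltP 0 rho; last first.
    move=> rho_le0; have -> : rho = 0 by apply/eqP; rewrite eq_le rho_le0.
    rewrite (_ : `]0%R, 0%R[%classic = set0 :> set R); last by rewrite set_itvoo0.
    by rewrite integral_set0 add0e (integral_itv_obnd_cbnd (measurable_funTS mU)).
  rewrite -ge0_integral_setU//; last 2 first.
  - exact: measurable_funTS.
  - apply/disj_setPS => r /= []; rewrite !in_itv/= => /andP[_ a] /andP[b _].
    by move: (lt_le_trans a b); rewrite ltxx.
  by congr (integral _ _ _); rewrite -itv_bndbnd_setU// bnd_simp// ltW.
have K : n.-1 = (n - 2).+1 by rewrite subnSK// subn1.
have K2 : n = (n - 2).+2 by rewrite -K prednK// (leq_trans _ hn).
have -> : (\int[mu]_(r in `]0%R, rho[) U r =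
    (C * ((rho ^+ (n - 2))^-1 - 1) * (rho ^+ (n.-1 + 2 *
        j).+1 - 0 ^+ (n.-1 + 2 * j).+1) / (n.-1 + 2 * j).+1%:R +
     0 * (rho ^+ 1 - 0 ^+ 1) / 1)%:E)%E.
  rewrite -(integral_itvoo_monomials _ 0 _ 0)//; apply: eq_integral => r.
  rewrite inE /= in_itv/= => /andP[r0 rr]; rewrite Ur//; last 2 first.
  - exact: lt_trans rho1.
  - by rewrite lt_eqF.
  by congr EFin; rewrite mul0r addr0 exprD max_l ?(ltW rr)//; ring.
have -> : (\int[mu]_(r in `]rho, 1%R[) U r =
    (C * (1 ^+ (2 * j).+2 - rho ^+ (2 * j).+2) / (2 * j).+2%:R +
     (- C) * (1 ^+ (n.-1 + 2 * j).+1 - rho ^+ (n.-1 + 2 * j).+1) / (n.-1 + 2 *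
         j).+1%:R)%:E)%E.
  rewrite -integral_itvoo_monomials ?(ltW rho1)//; apply: eq_integral => r.
  rewrite inE /= in_itv/= => /andP[rr r1].
  have r0 : 0 < r := le_lt_trans rho0 rr.
  rewrite Ur//; last by rewrite gt_eqF.
  congr EFin; rewrite max_r ?(ltW rr)// K exprD !exprS; field.
  by rewrite expf_neq0// gt_eqF.
rewrite -EFinD -EFinM; congr EFin.
rewrite expr0n /= !expr1n subr0 !mul0r addr0.
have -> : dotp x x ^+ j.+1 = rho ^+ (2 * j).+2.
  by rewrite -sqr_enorm -exprM mulnS.
have -> : (n.-1 + 2 * j).+1 = (n - 2 + (2 * j).+2)%N by rewrite K !addSn !addnS.
rewrite exprD; set P := rho ^+ (2 * j).+2; set Q := rho ^+ (n - 2).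
have -> : C * (Q^-1 - 1) * (Q * P) = C * ((1 - Q) * P).
  (* At the centre the inverse of Q is the default value 0, but the factor P vanishes there too. *)
  have [r0|r0] := eqVneq rho 0.
    by rewrite /P r0 expr0n /= !mulr0.
  have Q0 : Q != 0 by rewrite expf_neq0.
  by field.
have -> : (n - 2 + (2 * j).+2)%:R = (2 * j)%:R + n%:R :> R.
  by rewrite -natrD; congr (_%:R); rewrite addnS addnS -addSn -addSn -K2; exact: addnC.
have -> : (2 * j).+2%:R = 2 * j.+1%:R :> R by rewrite -natrM mulnS.
have N1 : (2 * j)%:R + n%:R != 0 :> R.
  by rewrite -natrD pnatr_eq0 addn_eq0 negb_and -!lt0n (leq_trans _ hn) ?orbT.
have N2 : 2 * j.+1%:R != 0 :> R by rewrite mulf_neq0 ?pnatr_eq0.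
(* With u = n - 2 and v = 2(j + 1), the rest is algebra in u and v, since 2j + n = u + v. *)
have D : (2 * j)%:R + n%:R = (n%:R - 2) + 2 * j.+1%:R :> R.
  by rewrite natrM -[j.+1%:R]natr1; ring.
rewrite /C; move: N1 N2 n2; rewrite D.
move: (n%:R - 2) (2 * j.+1%:R) => u v uv v0 u0; field.
by rewrite uv v0 !gt_eqF.
Qed.

End green_potential_of_powers.

(** * Norms of vector-valued integrals *)

Section vector_integral.
Context {R : realType} d (T : measurableType d) (mu : {measure set T ->
    \bar R}) (n1 : nat).

Lemma normr_coord_le_enorm (x : 'rV[R]_n1) j : `|x 0 j| <= enorm x.
Proof.
rewrite -sqrtr_sqr ler_wsqrtr// /dotp (bigD1 j)//= expr2 lerDl.
by apply: sumr_ge0 => i _; rewrite -expr2 sqr_ge0.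
Qed.

(** Bounding each component would cost a factor depending on [n1]. Instead the integral w is paired
    with itself: |w|^2 is the integral of K <w, v>, at most |w| times the integral of |K| B by
    Cauchy-Schwarz. *)
Lemma enorm_Rintegral_le (D : set T) (K B : T -> R) (v : T -> 'rV[R]_n1) :
  measurable D -> measurable_fun D K ->
  (forall j, measurable_fun D (fun t => v t 0 j)) ->
  (forall t, D t -> enorm (v t) <= B t) ->
  mu.-integrable D (EFin \o (fun t => `|K t| * B t)) ->
  enorm (\row_j \int[mu]_(t in D) (K t * v t 0 j)) <=
  \int[mu]_(t in D) (`|K t| * B t).
Proof.
move=> mD mK mv vB iKB; set w := \row__ _.
have B0 t : D t -> 0 <= B t by move=> /vB; exact: le_trans (enorm_ge0 _).
have iKv j : mu.-integrable D (EFin \o (fun t => K t * v t 0 j)).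
  apply: (le_integrable mD _ _ iKB); first by apply/measurable_EFinP;
      exact: measurable_funM.
  move=> t Dt /=; rewrite lee_fin !normrM normr_id ler_wpM2l//.
  by rewrite (le_trans (normr_coord_le_enorm _ _))// (le_trans (vB _ Dt))// ler_norm.
have R0 : 0 <= \int[mu]_(t in D) (`|K t| * B t).
  by apply: Rintegral_ge0 => t Dt; rewrite mulr_ge0// B0.
have [w0|w0] := eqVneq (enorm w) 0; first by rewrite w0.
have wp : 0 < enorm w by rewrite lt_neqAle enorm_ge0 eq_sym w0.
rewrite -(ler_pM2l wp) -expr2 sqr_enorm.
have E : (dotp w w)%:E = (\int[mu]_(t in D) (\sum_(j < n1) (w 0 j)%:E * (K t *
    v t 0 j)%:E))%E.
  rewrite integral_sum//; last first.
    by move=> j; apply: integrableZl => //; exact: iKv.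
  rewrite /dotp -sumEFin; apply: eq_bigr => j _.
  rewrite (integralZl _ (iKv j))// EFinM; congr (_ * _)%E.
  by rewrite mxE /Rintegral fineK//; exact: (integrable_fin_num mD (iKv j)).
rewrite -lee_fin E EFinM.
have -> : ((\int[mu]_(t in D) (`|K t| * B t))%:E =
    \int[mu]_(t in D) (`|K t| * B t)%:E)%E.
  by rewrite /Rintegral fineK//; exact: (integrable_fin_num mD iKB).
rewrite -(integralZl mD iKB); apply: le_integral => //.
- apply: integrable_sum => // j _; apply: integrableZl => //; exact: iKv.
- exact: integrableZl.
move=> t; rewrite inE => Dt; under eq_bigr do rewrite -EFinM.
rewrite sumEFin -EFinM lee_fin.
rewrite (_ : \sum_(_ < _) _ = K t * dotp w (v t)); last first.
  by rewrite /dotp mulr_sumr; apply: eq_bigr => j _; ring.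
rewrite (le_trans (ler_norm _))// normrM mulrCA ler_wpM2l//.
by rewrite (le_trans (normr_dotp_le _ _))// ler_wpM2l// ?enorm_ge0// vB.
Qed.

End vector_integral.

(** * Measurability of integrals in a parameter *)

Section parametric_measurability.
Context {R : realType} d1 (T1 : measurableType d1).

(** Tonelli's theorem handles the positive and the negative part, and [fine] of their difference is
    measurable even where the integral diverges. This makes a Green potential an admissible density
    for the next one. *)
Lemma measurable_Rintegral_param d2 (T2 : measurableType d2)
    (m2 : {sigma_finite_measure set T2 -> \bar R}) (f : T1 -> T2 -> R) :
  measurable_fun setT (fun p : T1 * T2 => f p.1 p.2) ->
  measurable_fun setT (fun x => \int[m2]_y f x y).
Proof.
move=> mf; have mEf : measurable_fun setT (EFin \o (fun p => f p.1 p.2)).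
  exact/measurable_EFinP.
rewrite /Rintegral; apply: (measurableT_comp (@fine_measurable R setT measurableT)).
under eq_fun do rewrite integralE.
apply: emeasurable_funB.
  apply: (measurable_ge0_integral2 m2 (f := fun x y => (EFin \o f x)^\+%E y)) => //.
  have mp : measurable_fun setT (fun p => (EFin \o (fun p : T1 *
      _ => f p.1 p.2))^\+%E p).
    exact: measurable_funepos.
  rewrite [X in measurable_fun _ X](_ : _ =
      (fun p => (EFin \o (fun p : T1 * _ => f p.1 p.2))^\+%E p))//.
  by apply/funext => p; rewrite !funepos.unlock.
apply: (measurable_ge0_integral2 m2 (f := fun x y => (EFin \o f x)^\-%E y)) => //.
have mp : measurable_fun setT (fun p => (EFin \o (fun p : T1 * _ => f p.1 p.2))^\-%E p).
  exact: measurable_funeneg.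
rewrite [X in measurable_fun _ X](_ : _ =
    (fun p => (EFin \o (fun p : T1 * _ => f p.1 p.2))^\-%E p))//.
by apply/funext => p; rewrite !funeneg.unlock.
Qed.

Lemma measurable_Rintegral_sphere_param n (hn : (2 <= n)%N) (f : T1 -> 'rV[R]_n -> R) :
  measurable_fun setT (fun p : T1 * 'rV[R]_n => f p.1 p.2) ->
  measurable_fun setT (fun x => \int[surface_measure n]_(z in sphere) f x z).
Proof.
move=> mf; have mEf : measurable_fun setT (EFin \o (fun p => f p.1 p.2)).
  exact/measurable_EFinP.
rewrite /Rintegral; apply: (measurableT_comp (@fine_measurable R setT measurableT)).
under eq_fun do rewrite integralE.
have H (g : T1 -> 'rV[R]_n ->
    \bar R) : measurable_fun setT (fun p : T1 * 'rV[R]_n => g p.1 p.2) ->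
    (forall x z, 0 <= g x z)%E ->
    measurable_fun setT (fun x => \int[surface_measure n]_(z in sphere) g x z)%E.
  move=> mg g0.
  have mgx x : measurable_fun setT (g x).
    have : measurable_fun setT (fun z : 'rV[R]_n => (x, z)) by apply:
        measurable_fun_pair.
    by move=> /(measurableT_comp mg).
  under eq_fun do rewrite (ge0_integral_sphere hn)//.
  apply: measurable_funeM; apply: (measurable_ge0_integral2 (rV_lebesgue n)).
    apply: emeasurable_funM.
      by apply/measurable_EFinP; exact: (measurableT_comp (@measurable_puncture R n)).
    have mN : measurable_fun setT (fun p : T1 * 'rV[R]_n => (p.1, normalize p.2)).
      apply: measurable_fun_pair => //.
      exact: (measurableT_comp (@measurable_normalize R n)).
    exact: (measurableT_comp mg mN).
  by move=> x y; apply: mule_ge0 => //; rewrite lee_fin.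
apply: emeasurable_funB.
  apply: (H (fun x y => (EFin \o f x)^\+%E y)) => //.
  have mp : measurable_fun setT (fun p => (EFin \o (fun p : T1 *
      _ => f p.1 p.2))^\+%E p).
    exact: measurable_funepos.
  rewrite [X in measurable_fun _ X](_ : _ =
      (fun p => (EFin \o (fun p : T1 * _ => f p.1 p.2))^\+%E p))//.
  by apply/funext => p; rewrite !funepos.unlock.
apply: (H (fun x y => (EFin \o f x)^\-%E y)) => //.
have mp : measurable_fun setT (fun p => (EFin \o (fun p : T1 * _ => f p.1 p.2))^\-%E p).
  exact: measurable_funeneg.
rewrite [X in measurable_fun _ X](_ : _ =
    (fun p => (EFin \o (fun p : T1 * _ => f p.1 p.2))^\-%E p))//.
by apply/funext => p; rewrite !funeneg.unlock.
Qed.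

End parametric_measurability.

(** * Measurability of potentials; the pole as a null set *)

Section potential_estimates.
Context {R : realType} (n n1 : nat).
Hypothesis hn : (3 <= n)%N.
Local Notation L := (@rV_lebesgue R n).
Local Notation sigma := (@surface_measure R n).
Implicit Types (h phi : 'rV[R]_n -> 'rV[R]_n1).

Let hn2 : (2 <= n)%N. Proof. exact: leq_trans hn. Qed.

Lemma measurable_green h :
  (forall j, measurable_fun oball (fun y => h y 0 j)) ->
  forall j, measurable_fun setT (fun x => green h x 0 j).
Proof.
move=> mh j.
pose f x y : R := green_kernel x y * ((fun y => h y 0 j) \_ oball) y.
rewrite (_ : (fun x => _) = fun x => \int[L]_y f x y).
  apply: measurable_Rintegral_param; apply: measurable_funM.
    by apply: measurable_green_kernel.
  have : measurable_fun setT ((fun y => h y 0 j) \_ oball).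
    exact/(measurable_restrictT _ (@measurable_oball R n)).
  by move=> /measurableT_comp; apply.
apply/funext => x; rewrite /green mxE Rintegral_mkcond; congr (Rintegral _ _ _).
apply/funext => y; rewrite /f !patchE; case: ifP => //; by rewrite mulr0.
Qed.

Lemma measurable_poissonV phi :
  (forall j, measurable_fun sphere (fun y => phi y 0 j)) ->
  forall j, measurable_fun setT (fun x => poissonV phi x 0 j).
Proof.
move=> mh j.
pose f x y : R := poisson_kernel x y * ((fun y => phi y 0 j) \_ sphere) y.
rewrite (_ : (fun x => _) = fun x => \int[sigma]_(z in sphere) f x z).
  apply: measurable_Rintegral_sphere_param => //; apply: measurable_funM.
    apply: measurable_funM.
      apply: measurable_funB => //; apply: measurable_funX.
      by apply: measurable_fun_enorm.
    by apply: measurable_enorm_sub_inv.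
  have : measurable_fun setT ((fun y => phi y 0 j) \_ sphere).
    exact/(measurable_restrictT _ (@measurable_sphere R n)).
  by move=> /measurableT_comp; apply.
apply/funext => x; rewrite /poissonV /poisson mxE; apply: eq_Rintegral => z zS.
by rewrite /f patchE zS.
Qed.

Lemma rV_lebesgue_set1 (x : 'rV[R]_n) : L [set x] = 0%E.
Proof.
have m1 : measurable_fun setT (fun y : 'rV[R]_n => (\1_[set x] y : R)%:E).
  by apply/measurable_EFinP; apply: measurable_indic; exact: measurable_rV_set1.
have m2 y : (0 <= (\1_[set x] y : R)%:E)%E by rewrite lee_fin.
transitivity (\int[L]_y (\1_[set x] y : R)%:E)%E.
  by rewrite integral_indic ?setIT//; exact: measurable_rV_set1.
rewrite -(ge0_integral_rV_shift x m1 m2) -[RHS](@rV_lebesgue_set0 R n hn2).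
transitivity (\int[L]_y (\1_[set 0%R] y : R)%:E)%E.
  apply: eq_integral => y _; rewrite !indicE; congr ((nat_of_bool _)%:R)%:E.
  apply/idP/idP; rewrite !inE /=; last by move=> ->; rewrite add0r.
  by move/eqP; rewrite addrC -subr_eq0 addrAC subrr add0r => /eqP.
by rewrite integral_indic ?setIT//; exact: measurable_rV_set1.
Qed.

Lemma green_kernel_pos_ae (x : 'rV[R]_n) (k : 'rV[R]_n -> R) :
  ae_eq L oball (fun y => (green_kernel x y *
      k y)%:E) (fun y => (green_pos x y * k y)%:E).
Proof.
have mx := measurable_rV_set1 x; have x0 := rV_lebesgue_set1 x.
exists [set x]; split => // y /=.
move=> /not_implyP[By E]; apply: contrapT => yx; apply: E.
rewrite /green_pos (_ : y != x); last exact/eqP.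
by rewrite mul1r indicE mem_set// mul1r.
Qed.

End potential_estimates.

(** * Bounds for Green and Poisson potentials *)

Section potential_bounds.
Context {R : realType} (n n1 : nat).
Hypothesis hn : (3 <= n)%N.
Local Notation L := (@rV_lebesgue R n).
Local Notation sigma := (@surface_measure R n).
Implicit Types (h phi : 'rV[R]_n -> 'rV[R]_n1) (x y z : 'rV[R]_n).

Lemma Rintegral_green_pos x (k : 'rV[R]_n -> R) : measurable_fun oball k ->
  \int[L]_(y in oball) (green_kernel x y * k y) =
  \int[L]_(y in oball) (green_pos x y * k y).
Proof.
move=> mk; rewrite /Rintegral; congr fine; apply: ae_eq_integral.
- exact: measurable_oball.
- apply/measurable_EFinP; apply: measurable_funM => //; apply: measurable_funTS.
  by apply: measurable_green_kernel.
- apply/measurable_EFinP; apply: measurable_funM => //; apply: measurable_funTS.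
  exact: measurable_green_pos.
- exact: green_kernel_pos_ae.
Qed.

Lemma integral_oball_green_pos x (k : 'rV[R]_n -> R) :
  (\int[L]_(y in oball) (green_pos x y * k y)%:E =
      \int[L]_y (green_pos x y * k y)%:E)%E.
Proof.
rewrite integral_EFin_indic; apply: eq_integral => y _; congr EFin.
rewrite /green_pos !indicE; case: (y \in oball); first by rewrite mul1r.
by rewrite !(mul0r, mulr0).
Qed.

(** Reduces the estimate to the scalar potential of a majorant B; that this potential has a finite
    value is also what provides integrability. *)
Lemma enorm_green_le h (B : 'rV[R]_n -> R) x (c : R) :
  (forall j, measurable_fun oball (fun y => h y 0 j)) ->
  measurable_fun setT B -> (forall y, oball y -> enorm (h y) <= B y) ->
  oball x -> (\int[L]_y (green_pos x y * B y)%:E = c%:E)%E ->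
  enorm (green h x) <= c.
Proof.
move=> mh mB hB x1 Ic; have mO := @measurable_oball R n.
rewrite (_ : green h x = \row_j \int[L]_(y in oball) (green_pos x y *
    h y 0 j)); last first.
  by apply/rowP => j; rewrite !mxE Rintegral_green_pos.
have E : (\int[L]_(y in oball) (`|green_pos x y| * B y)%:E = c%:E)%E.
  rewrite -Ic -integral_oball_green_pos; apply: eq_integral => y _.
  by rewrite ger0_norm// green_pos_ge0.
have B0 y : oball y -> 0 <= B y by move=> /hB; exact: le_trans (enorm_ge0 _).
have mG := @measurable_green_pos R n x.
apply: (le_trans (enorm_Rintegral_le (mu := L) mO (measurable_funTS mG) mh hB _)).
  apply/integrableP; split.
    apply/measurable_EFinP/measurable_funTS; apply: measurable_funM => //.
    exact: (measurableT_comp (@normr_measurable R setT) mG).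
  rewrite (eq_integral (fun y => (`|green_pos x y| * B y)%:E)) ?E ?ltry// => y.
  by rewrite inE => By /=; rewrite ger0_norm// mulr_ge0// B0.
by rewrite /Rintegral E.
Qed.

Lemma integrable_green_pos_power x j : oball x ->
  L.-integrable setT (EFin \o (fun y => green_pos x y * dotp y y ^+ j)).
Proof.
move=> x1; apply/integrableP; split.
  apply/measurable_EFinP; apply: measurable_funM; first exact: measurable_green_pos.
  by apply: measurable_funX; exact: measurable_dotp.
rewrite (eq_integral (fun y => (green_pos x y * dotp y y ^+ j)%:E)).
  by rewrite integral_green_pos// ltry.
move=> y _ /=; rewrite ger0_norm// mulr_ge0//; first exact: green_pos_ge0.
by rewrite exprn_ge0// dotp_ge0.
Qed.

(** Serves both bounds below: b = 0 for a constant majorant, a = b for a multiple of 1 - |y|^2. *)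
Lemma integral_green_pos_affine x (a b : R) : oball x ->
  (\int[L]_y (green_pos x y * (a - b * dotp y y))%:E =
   (a * ((1 - dotp x x) / (2 * n%:R)) -
    b * ((1 - dotp x x ^+ 2) / (4 * (n%:R + 2))))%:E)%E.
Proof.
move=> x1.
have i0 := integrable_green_pos_power 0 x1.
have i1 := integrable_green_pos_power 1 x1.
have I0 := integral_green_pos hn 0 x1; have I1 := integral_green_pos hn 1 x1.
transitivity (\int[L]_y (a%:E * (green_pos x y * dotp y y ^+ 0)%:E -
    b%:E * (green_pos x y * dotp y y ^+ 1)%:E))%E.
  apply: eq_integral => y _; rewrite -!EFinM -EFinB; congr EFin.
  by rewrite expr0 expr1; ring.
have mT : measurable [set: 'rV[R]_n] by [].
rewrite integralB//.
- rewrite (integralZl mT i0) (integralZl mT i1) I0 I1 -!EFinM -EFinB.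
  congr EFin; rewrite expr1 mulr1 muln0 add0r; congr (_ - _ * (_ / _)).
  by rewrite muln1; ring.
- exact: integrableZl.
- exact: integrableZl.
Qed.

Lemma enorm_green_le_cst h (C : R) x :
  (forall j, measurable_fun oball (fun y => h y 0 j)) ->
  (forall y, oball y -> enorm (h y) <= C) -> oball x ->
  enorm (green h x) <= C / (2 * n%:R) * (1 - enorm x ^+ 2).
Proof.
move=> mh hC x1.
have := integral_green_pos_affine C 0 x1; rewrite mul0r subr0 -sqr_enorm => I.
have -> : C / (2 * n%:R) * (1 - enorm x ^+ 2) =
    C * ((1 - enorm x ^+ 2) / (2 * n%:R)) by ring.
apply: (enorm_green_le mh _ _ x1 I).
- by apply: measurable_funB => //; apply: measurable_funM => //; apply: measurable_dotp.
- by move=> y By; rewrite mul0r subr0; exact: hC.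
Qed.

(** With d = |x|^2, the potential of 1 - |y|^2 is exactly (1 - d)(n + 4 - nd) / (4n(n + 2)).
    Dropping nd leaves a multiple of 1 - d, a bound of the same shape as the assumption, so it can
    be iterated. *)
Lemma enorm_green_le_quad h (C : R) x : 0 <= C ->
  (forall j, measurable_fun oball (fun y => h y 0 j)) ->
  (forall y, oball y -> enorm (h y) <= C * (1 - enorm y ^+ 2)) -> oball x ->
  enorm (green h x) <=
    C * ((n%:R + 4) / (4 * n%:R * (n%:R + 2))) * (1 - enorm x ^+ 2).
Proof.
move=> C0 mh hC x1.
have I := integral_green_pos_affine C C x1.
have n0 : (0 : R) < n%:R by rewrite ltr0n (leq_trans _ hn).
apply: (le_trans (enorm_green_le mh _ _ x1 I)).
- by apply: measurable_funB => //; apply: measurable_funM => //; apply: measurable_dotp.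
- by move=> y By; rewrite (le_trans (hC _ By))// sqr_enorm mulrBr mulr1.
have d0 := dotp_ge0 x; move: x1 => /oballE d1; rewrite sqr_enorm.
set d := dotp x x in d0 d1 *.
have -> : C * ((1 - d) / (2 * n%:R)) - C * ((1 - d ^+ 2) / (4 * (n%:R + 2))) =
    C * ((n%:R + 4) / (4 * n%:R * (n%:R + 2))) * (1 - d) -
    C * (d * (1 - d) / (4 * (n%:R + 2))).
  by field; rewrite gt_eqF//= gt_eqF// addr_gt0.
by rewrite gerBl mulr_ge0// divr_ge0 ?mulr_ge0 ?subr_ge0 ?addr_ge0// ltW.
Qed.

Lemma measurable_iter_green h k :
  (forall j, measurable_fun oball (fun y => h y 0 j)) ->
  forall j, measurable_fun oball (fun y => iter k (@green R n n1) h y 0 j).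
Proof.
elim: k => // k IH mh j; apply: measurable_funTS.
by apply: measurable_green => //; exact: IH.
Qed.

Lemma enorm_iter_green_le h (C : R) k x : 0 <= C ->
  (forall j, measurable_fun oball (fun y => h y 0 j)) ->
  (forall y, oball y -> enorm (h y) <= C) -> oball x ->
  enorm (iter k.+1 (@green R n n1) h x) <=
    C / (2 * n%:R) * ((n%:R + 4) / (4 * n%:R * (n%:R + 2))) ^+ k *
    (1 - enorm x ^+ 2).
Proof.
move=> C0 mh hC; elim: k x => [|k IH] x x1.
  by rewrite expr0 mulr1; exact: enorm_green_le_cst.
rewrite iterS exprSr [C / _ * _]mulrA; apply: enorm_green_le_quad => //.
- by rewrite mulr_ge0 ?divr_ge0 ?exprn_ge0 ?divr_ge0 ?mulr_ge0 ?addr_ge0.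
- exact: measurable_iter_green.
Qed.

Lemma measurable_poisson_kernel x : measurable_fun setT (poisson_kernel x).
Proof. by apply: measurable_funM => //; exact: measurable_enorm_sub_inv. Qed.

Lemma poisson_kernel_ge0 x z : oball x -> 0 <= poisson_kernel x z.
Proof.
move=> x1; rewrite divr_ge0 ?exprn_ge0 ?enorm_ge0// subr_ge0.
by rewrite expr_le1// ?enorm_ge0// ltW.
Qed.

Lemma integrable_poisson_kernel x : oball x ->
  sigma.-integrable sphere (EFin \o poisson_kernel x).
Proof.
move=> x1; apply/integrableP; split.
  by apply/measurable_EFinP/measurable_funTS; exact: measurable_poisson_kernel.
rewrite (eq_integral (fun z => (poisson_kernel x z)%:E)).
  by rewrite integral_poisson_kernel// ltry.
by move=> z _ /=; rewrite ger0_norm// poisson_kernel_ge0.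
Qed.

Lemma enorm_poissonV_le phi (C : R) x :
  (forall j, measurable_fun sphere (fun z => phi z 0 j)) ->
  (forall z, sphere z -> enorm (phi z) <= C) -> oball x ->
  enorm (poissonV phi x) <= C.
Proof.
move=> mphi hC x1; have mS := @measurable_sphere R n.
have i := integrable_poisson_kernel x1.
have E : (\int[sigma]_(z in sphere) (`|poisson_kernel x z| * C)%:E = C%:E)%E.
  transitivity (\int[sigma]_(z in sphere) (C%:E * (poisson_kernel x z)%:E))%E.
    by apply: eq_integral => z _; rewrite ger0_norm ?poisson_kernel_ge0// mulrC.
  by rewrite (integralZl mS i) integral_poisson_kernel// mule1.
have mP := measurable_poisson_kernel x.
apply: (le_trans (enorm_Rintegral_le (mu := sigma) (B := cst C) mS
    (measurable_funTS mP) mphi hC _)).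
  have := integrableZl mS C i; apply: eq_integrable => // z _.
  by rewrite /= ger0_norm ?poisson_kernel_ge0// mulrC.
by rewrite /Rintegral E.
Qed.

End potential_bounds.

(** * The Schwarz lemma for Poisson integrals *)

Section harmonic_schwarz.
Context {R : realType} (n : nat).
Hypothesis hn : (3 <= n)%N.
Local Notation sigma := (@surface_measure R n).
Implicit Types (x y z : 'rV[R]_n).

Let hn2 : (2 <= n)%N. Proof. exact: leq_trans hn. Qed.

(* At [v = 0] the junk value of the division makes this the identity. *)
Definition householder (v y : 'rV[R]_n) : 'rV[R]_n :=
  y - (2 * dotp y v / dotp v v) *: v.

Lemma dotp_householder (v x z : 'rV[R]_n) :
  dotp (householder v x) z = dotp x (householder v z).
Proof. by rewrite !dotpE (dotpC v z); ring. Qed.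

Lemma householderK (v : 'rV[R]_n) : involutive (householder v).
Proof.
move=> y; rewrite /householder.
have [->|v0] := eqVneq v 0; first by rewrite !scaler0 !subr0.
have d0 : dotp v v != 0 by rewrite -sqr_enorm expf_neq0// enorm_eq0.
rewrite !dotpE -addrA -opprD -scalerDl.
rewrite [X in X *: v](_ : _ = 0) ?scale0r ?subr0//.
by field.
Qed.

(** The reflection along x - y takes x to y when |x| = |y|; it is self-adjoint and preserves the
    surface measure, so it can be moved from x to z and removed. *)
Lemma ge0_integral_sphere_zonal (F : R -> R) x y : enorm x = enorm y ->
  measurable_fun setT F -> (forall a, 0 <= F a) ->
  (\int[sigma]_(z in sphere) (F (dotp x z))%:E =
   \int[sigma]_(z in sphere) (F (dotp y z))%:E)%E.
Proof.
move=> xy mF F0; pose T := householder (x - y).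
have Tx : T x = y.
  rewrite /T /householder; have [xy0|xy0] := eqVneq (x - y) 0.
    by rewrite xy0 scaler0 subr0; apply/eqP; rewrite -subr_eq0 xy0.
  have d0 : dotp (x - y) (x - y) != 0 by rewrite -sqr_enorm expf_neq0// enorm_eq0.
  rewrite (_ : _ / _ = 1); first by rewrite scale1r opprB addrC subrK.
  apply: (mulIf d0); rewrite divfK// mul1r !dotpE (dotpC y x) -!sqr_enorm xy.
  by ring.
have mT : measurable_fun setT T.
  apply: measurable_fun_rVB => //; apply: measurable_fun_rVZ => //.
  apply: measurable_funM => //; apply: measurable_funM => //.
  by apply: measurable_dotp.
have mg : measurable_fun setT (fun z => (F (dotp x z))%:E).
  by apply/measurable_EFinP; apply: (measurableT_comp mF); exact: measurable_dotp.
rewrite -(ge0_integral_sphere_isometry hn2 (T := T) mT _ _ _ _ mg).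
- by apply: eq_integral => z _; rewrite -dotp_householder -/T Tx.
- move=> u v; rewrite /T; move: (x - y) => w.
  by rewrite /householder dotpDl mulrDr mulrDl scalerDl opprD addrACA.
- move=> a u; rewrite /T; move: (x - y) => w.
  by rewrite /householder dotpZl scalerBr scalerA; congr (_ - _ *: _); ring.
- exact: householderK.
- by move=> u; rewrite /T dotp_householder householderK.
- by move=> z; rewrite lee_fin.
Qed.

Lemma last_ord_subproof : (n.-1 < n)%N.
Proof. by rewrite prednK// (leq_trans _ hn). Qed.

Definition last_ord : 'I_n := Ordinal last_ord_subproof.

Lemma northE i : (north n : 'rV[R]_n) 0 i = (i == last_ord)%:R.
Proof.
rewrite mxE; congr (nat_of_bool _)%:R; apply/eqP/eqP => [h|->].
  by apply/val_inj; exact: (congr1 predn h).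
by rewrite /= prednK// (leq_trans _ hn).
Qed.

Lemma dotp_north z : dotp (north n) z = z 0 last_ord.
Proof.
rewrite /dotp (bigD1 last_ord)//= northE eqxx mul1r big1 ?addr0// => i il.
by rewrite northE (negbTE il) mul0r.
Qed.

Lemma enorm_north : enorm (north n : 'rV[R]_n) = 1.
Proof. by rewrite /enorm dotp_north northE eqxx sqrtr1. Qed.

(** On the equator both indicators are 1 and cancel, so [cap_sign] is the sign of the last
    coordinate. *)
Lemma cap_signE z : sphere z ->
  cap_sign z = (0 < z 0 last_ord)%R%:R - (z 0 last_ord < 0)%R%:R.
Proof.
move=> Sz; have H (P : R -> bool) :
    (forall i : 'I_n, i.+1 = n -> P (z 0 i)) <-> P (z 0 last_ord).
  split=> [|h i hi]; first by apply; rewrite /= prednK// (leq_trans _ hn).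
  by rewrite (_ : i = last_ord)//; apply/val_inj; exact: (congr1 predn hi).
have E1 : (z \in @north_cap R n) = (0 <= z 0 last_ord).
  apply/idP/idP => [|h]; rewrite inE /north_cap /=.
    by move=> [_ /(H (fun t => 0 <= t))].
  by split=> //; exact/(H (fun t => 0 <= t)).
have E2 : (z \in @south_cap R n) = (z 0 last_ord <= 0).
  apply/idP/idP => [|h]; rewrite inE /south_cap /=.
    by move=> [_ /(H (fun t => t <= 0))].
  by split=> //; exact/(H (fun t => t <= 0)).
rewrite /cap_sign !indicE E1 E2.
by case: ltgtP => _; rewrite ?subrr.
Qed.

Lemma measurable_coord (i : 'I_n) : measurable_fun setT (fun z : 'rV[R]_n => z 0 i).
Proof. exact: measurable_rV_coord. Qed.

Lemma measurable_cap_sign : measurable_fun sphere (@cap_sign R n).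
Proof.
apply: (eq_measurable_fun (fun z : 'rV[R]_n =>
    ((0 < z 0 last_ord)%R%:R - (z 0 last_ord < 0)%R%:R : R))).
  by move=> z; rewrite inE => Sz; rewrite cap_signE.
apply: measurable_funTS; apply: measurable_funB; apply: measurable_indic_lt => //.
  exact: measurable_coord.
exact: measurable_coord.
Qed.

Lemma normr_cap_sign_le z : sphere z -> `|cap_sign z| <= 1.
Proof.
by move=> /cap_signE ->; case: ltgtP => _;
    rewrite ?subr0 ?sub0r ?subrr ?normrN ?normr1 ?normr0.
Qed.

Lemma integrable_cap_sign : sigma.-integrable sphere (EFin \o @cap_sign R n).
Proof.
exact: (integrable_sphere_bounded hn2 measurable_cap_sign normr_cap_sign_le).
Qed.

(** The map z -> -z exchanges the two open hemispheres. *)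
Lemma Rintegral_cap_sign : \int[sigma]_(z in sphere) (cap_sign z : R) = 0.
Proof.
pose p (z : 'rV[R]_n) : R := (0 < z 0 last_ord)%R%:R.
pose q (z : 'rV[R]_n) : R := (z 0 last_ord < 0)%R%:R.
have mp : measurable_fun setT p by apply: measurable_indic_lt => //;
    exact: measurable_coord.
have mq : measurable_fun setT q by apply: measurable_indic_lt => //;
    exact: measurable_coord.
have i (h : 'rV[R]_n -> R) : measurable_fun setT h -> (forall z, `|h z| <= 1) ->
    sigma.-integrable sphere (EFin \o h).
  by move=> mh h1; exact: (integrable_sphere_bounded hn2 (measurable_funTS mh)
      (fun z _ => h1 z)).
have ip := i _ mp (fun z => ltac:(by rewrite /p; case: ltP; rewrite ?normr1 ?normr0)).
have iq := i _ mq (fun z => ltac:(by rewrite /q; case: ltP; rewrite ?normr1 ?normr0)).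
transitivity (\int[sigma]_(z in sphere) (p z - q z)).
  by apply: eq_Rintegral => z; rewrite inE => Sz; rewrite cap_signE.
rewrite RintegralB//; last exact: measurable_sphere.
apply/eqP; rewrite subr_eq0; apply/eqP; rewrite /Rintegral; congr fine.
have mpE : measurable_fun setT (fun z => (p z)%:E) by exact/measurable_EFinP.
rewrite -(ge0_integral_sphere_opp hn2 mpE) //; last by move=> z; rewrite lee_fin.
by apply: eq_integral => z _; rewrite /p /q mxE oppr_gt0.
Qed.

(** The value of P(x, .) on the equator <x, z> = 0 when |x| = rho. *)
Definition kernel_level (rho : R) := (1 - rho ^+ 2) / (1 + rho ^+ 2) `^ (n%:R / 2).

Lemma kernel_levelE (rho : R) :
  kernel_level rho = (1 - rho ^+ 2) / Num.sqrt (1 + rho ^+ 2) ^+ n.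
Proof.
have h : 0 <= 1 + rho ^+ 2 by rewrite addr_ge0// sqr_ge0.
by rewrite /kernel_level (mulrC n%:R) powRrM powR12_sqrt// powR_mulrn ?sqrtr_ge0.
Qed.

Lemma poisson_kernel_sphereE x z : sphere z ->
  poisson_kernel x z =
  (1 - enorm x ^+ 2) / Num.sqrt (1 + enorm x ^+ 2 - 2 * dotp x z) ^+ n.
Proof.
move=> Sz; rewrite /poisson_kernel /enorm; congr (_ / Num.sqrt _ ^+ _).
by rewrite !dotpE (sphere_dotp Sz) -/(enorm x) sqr_enorm (dotpC z x); ring.
Qed.

(* [P(x, .)] exceeds its level [kernel_level |x|] exactly on the hemisphere
   around x, so for x on the north axis the sign of the difference is
   [cap_sign]. *)
Lemma normr_poisson_kernelB (rho : R) z : 0 <= rho -> rho < 1 -> sphere z ->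
  `|poisson_kernel (rho *: north n) z - kernel_level rho| =
  (poisson_kernel (rho *: north n) z - kernel_level rho) * cap_sign z.
Proof.
move=> r0 r1 Sz; have er : enorm (rho *: north n : 'rV[R]_n) = rho.
  by rewrite enormZ enorm_north mulr1 ger0_norm.
have hz : `|rho * z 0 last_ord| <= rho.
  by have := normr_dotp_le (rho *: north n) z; rewrite er Sz mulr1 dotpZl dotp_north.
rewrite poisson_kernel_sphereE// kernel_levelE er dotpZl dotp_north cap_signE//.
set a := z 0 last_ord in hz *.
have k0 : 0 <= 1 - rho ^+ 2 by rewrite subr_ge0 expr_le1// ltW.
move: hz; rewrite ler_norml => /andP[h1 h2].
have q0 : 0 < 1 + rho ^+ 2 - 2 * (rho * a) by nra.
have p0 : 0 < 1 + rho ^+ 2 by have := sqr_ge0 rho; lra.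
have [a0|a0|a0] := ltgtP 0 a.
- rewrite subr0 mulr1 ger0_norm// subr_ge0 ler_wpM2l//.
  rewrite lef_pV2 ?posrE ?exprn_gt0 ?sqrtr_gt0// lerXn2r ?nnegrE ?sqrtr_ge0//.
  by rewrite ler_wsqrtr//; have := mulr_ge0 r0 (ltW a0); lra.
- rewrite sub0r mulrN1 ler0_norm// subr_le0 ler_wpM2l//.
  rewrite lef_pV2 ?posrE ?exprn_gt0 ?sqrtr_gt0// lerXn2r ?nnegrE ?sqrtr_ge0//.
  by rewrite ler_wsqrtr//; have := mulr_ge0_le0 r0 (ltW a0); lra.
- by rewrite -a0 subrr !mulr0 subr0 subrr normr0.
Qed.

Lemma integral_normr_poisson_kernelB x : oball x ->
  (\int[sigma]_(z in sphere) `|poisson_kernel x z - kernel_level (enorm x)|%:E =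
   (poisson (@cap_sign R n) (enorm x *: north n))%:E)%E.
Proof.
move=> x1; set rho := enorm x; have r0 : 0 <= rho := enorm_ge0 x.
have mS := @measurable_sphere R n.
pose y : 'rV[R]_n := rho *: north n.
have ey : enorm y = rho by rewrite enormZ enorm_north mulr1 ger0_norm.
have y1 : oball y by rewrite /oball/= ey.
pose F (a : R) : R := `|(1 - rho ^+ 2) / Num.sqrt (1 + rho ^+ 2 - 2 *
    a) ^+ n - kernel_level rho|.
have mF : measurable_fun setT F.
  apply: (measurableT_comp (@normr_measurable R setT)); apply: measurable_funB => //.
  apply: measurable_funM => //; apply: measurable_fun_invr; last first.
    by move=> t; rewrite exprn_ge0// sqrtr_ge0.
  by apply: measurable_funX; apply: measurable_sqrt; apply: measurable_funB => //.
transitivity (\int[sigma]_(z in sphere) (F (dotp x z))%:E)%E.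
  by apply: eq_integral => z; rewrite inE => Sz; rewrite poisson_kernel_sphereE.
rewrite (@ge0_integral_sphere_zonal F x y) ?ey// => [|a]; last exact: normr_ge0.
have iP := integrable_poisson_kernel hn y1.
have iC := integrable_cap_sign.
have iPC : sigma.-integrable sphere (EFin \o (fun z => poisson_kernel y z *
    cap_sign z)).
  apply: (le_integrable mS _ _ iP).
    apply/measurable_EFinP; apply: measurable_funM; last exact: measurable_cap_sign.
    by apply: measurable_funTS; exact: measurable_poisson_kernel.
  move=> z Sz /=; rewrite lee_fin normrM ler_piMr// normr_cap_sign_le//.
have iKC : sigma.-integrable sphere (EFin \o (fun z => kernel_level rho * cap_sign z)).
  by have := integrableZl mS (kernel_level rho) iC.
transitivity (\int[sigma]_(z in sphere) ((poisson_kernel y z *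
    cap_sign z)%:E - (kernel_level rho * cap_sign z)%:E))%E.
  apply: eq_integral => z; rewrite inE => Sz.
  rewrite -EFinB -mulrBl -normr_poisson_kernelB//; congr EFin.
  by rewrite /F poisson_kernel_sphereE// ey.
rewrite integralB_EFin//.
have -> : (\int[sigma]_(z in sphere) (kernel_level rho * cap_sign z)%:E = 0)%E.
  under eq_integral do rewrite EFinM.
  rewrite (integralZl mS iC).
  have -> : (\int[sigma]_(z in sphere) (EFin \o @cap_sign R n) z = 0)%E.
    by rewrite -[LHS]fineK ?(integrable_fin_num mS iC)//; congr EFin;
        exact: Rintegral_cap_sign.
  by rewrite mule0.
rewrite sube0 /poisson /Rintegral fineK//.
exact: (integrable_fin_num mS iPC).
Qed.

(** As P(0, .) = 1, the difference is a single integral of [phi] against P(x, .) - c, and its norm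
    is at most C times the integral of |P(x, .) - c|. *)
Lemma enorm_poissonV_sub_le n1 (phi : 'rV[R]_n -> 'rV[R]_n1) (C : R) x :
  (forall j, measurable_fun sphere (fun z => phi z 0 j)) ->
  (forall z, sphere z -> enorm (phi z) <= C) -> oball x ->
  enorm (poissonV phi x - kernel_level (enorm x) *: poissonV phi 0) <=
  C * poisson (@cap_sign R n) (enorm x *: north n).
Proof.
move=> mphi hC x1; have mS := @measurable_sphere R n.
set c := kernel_level _.
have mP := @measurable_poisson_kernel R n x.
have iphi j : sigma.-integrable sphere (EFin \o (fun z => phi z 0 j)).
  apply: (@integrable_sphere_bounded _ _ hn2 _ C (mphi j)) => z Sz.
  by rewrite (le_trans (normr_coord_le_enorm _ _))// hC.
have o0 : oball (0 : 'rV[R]_n) by rewrite /oball/= enorm0.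
have iP (y : 'rV[R]_n) j : oball y ->
    sigma.-integrable sphere (EFin \o (fun z => poisson_kernel y z * phi z 0 j)).
  move=> y1; have := integrableZl mS C (integrable_poisson_kernel hn y1).
  apply: le_integrable => //.
    apply/measurable_EFinP; apply: measurable_funM => //.
    by apply: measurable_funTS; exact: measurable_poisson_kernel.
  move=> z Sz /=; rewrite lee_fin !normrM mulrC ler_wpM2r//.
  by rewrite (le_trans (normr_coord_le_enorm _ _))// (le_trans (hC _ Sz))// ler_norm.
have -> : poissonV phi x - c *: poissonV phi 0 =
    \row_j \int[sigma]_(z in sphere) ((poisson_kernel x z - c) * phi z 0 j).
  apply/rowP => j; rewrite !mxE /poisson.
  rewrite -RintegralZl//; last exact: iP.
  rewrite -RintegralB//; last 2 first.
  - exact: iP.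
  - by have := integrableZl mS c (iP _ j o0).
  apply: eq_Rintegral => z; rewrite inE => Sz;
      rewrite [X in _ - c * (X * _)](_ : _ = 1).
    by rewrite mul1r mulrBl.
  by rewrite poisson_kernel_sphereE// enorm0 expr0n subr0 addr0 -(scale0r (0 :
      'rV[R]_n)) dotpZl mul0r mulr0 subr0 sqrtr1 expr1n divr1.
have E : (\int[sigma]_(z in sphere) (`|poisson_kernel x z - c| * C)%:E =
    (C * poisson (@cap_sign R n) (enorm x *: north n))%:E)%E.
  under eq_integral do rewrite mulrC EFinM.
  rewrite integralZl//; first by rewrite integral_normr_poisson_kernelB.
  apply/integrableP; split.
    apply/measurable_EFinP/measurable_funTS.
    by apply: (measurableT_comp (@normr_measurable R setT)); exact: measurable_funB.
  rewrite (eq_integral (fun z => `|poisson_kernel x z - c|%:E));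
      last by move=> z _ /=; rewrite normr_id.
  by rewrite integral_normr_poisson_kernelB// ltry.
have mK : measurable_fun sphere (fun z => poisson_kernel x z - c).
  by apply: measurable_funTS; exact: measurable_funB.
apply: (le_trans (enorm_Rintegral_le (mu := sigma) (B := cst C) mS mK mphi hC _)).
  apply/integrableP; split.
    apply/measurable_EFinP; apply: measurable_funM => //.
    exact: (measurableT_comp (@normr_measurable R setT)).
  rewrite (eq_integral (fun z => (`|poisson_kernel x z - c| * C)%:E));
      first by rewrite E ltry.
  move=> z; rewrite inE => Sz /=; rewrite ger0_norm// mulr_ge0//.
  by rewrite (le_trans (enorm_ge0 (phi z)))// hC.
by rewrite /Rintegral E.
Qed.

End harmonic_schwarz.

(** * The bound for solutions *)

Section euclidean_topology.
Context {R : realType}.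

Lemma continuous_dotp n : continuous (fun x : 'rV[R]_n => dotp x x).
Proof.
apply: continuous_big => [|i _ x]; first exact: add_continuous.
by apply: continuousM; exact: coord_continuous.
Qed.

Lemma continuous_enorm n : continuous (@enorm R n).
Proof.
move=> x; apply: (@continuous_comp _ _ _ (fun y : 'rV[R]_n => dotp y y) Num.sqrt).
  exact: continuous_dotp.
exact: sqrt_continuous.
Qed.

(** A closed subset of the cube [-1, 1]^n. *)
Lemma compact_cball n : compact (@cball R n).
Proof.
have cube : compact [set v : 'rV[R]_n | forall i, v ord0 i \in `[(-1), 1]].
  apply: (@rV_compact _ _ (fun=> `[(-1 : R), 1]%classic)).
  by move=> _; exact: segment_compact.
apply: subclosed_compact cube _ => [|x x1 i].
  rewrite (_ : cball = @enorm R n @^-1` [set t | t <= 1])//.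
  by apply: closed_comp; [move=> x _; exact: continuous_enorm|exact: closed_le].
rewrite /= in_itv/= -ler_norml.
exact: le_trans (normr_coord_le_enorm x i) x1.
Qed.

Lemma compact_sphere n : compact (@sphere R n).
Proof.
apply: subclosed_compact (@compact_cball n) _ => [|x /=];
    last by rewrite /cball/= => ->.
rewrite (_ : sphere = @enorm R n @^-1` [set 1])//.
by apply: closed_comp; [move=> x _; exact: continuous_enorm|exact: closed_eq].
Qed.

Lemma has_sup_enorm n n1 (A : set 'rV[R]_n) (h : 'rV[R]_n -> 'rV[R]_n1) :
  compact A -> {within A, continuous h} -> A !=set0 ->
  has_sup [set enorm (h x) | x in A].
Proof.
move=> cA ch [x Ax]; apply: compact_has_sup; first by exists (enorm (h x)), x.
apply: continuous_compact => // y.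
apply: (@continuous_comp (subspace A) _ _ h (@enorm R n1)); first exact: ch.
exact: continuous_enorm.
Qed.

(** The measurable sets are generated by the coordinates, the topology by the sup norm. They are
    linked by the countably many cubes with rational centre and half-side 1/(k+1): an open set is
    the union of those it contains. *)
Lemma open_measurable_rV n (O : set 'rV[R]_n) : open O -> measurable O.
Proof.
move=> oO.
pose box (q : 'rV[rat]_n) (k : nat) : set 'rV[R]_n :=
  [set x | forall i, `|ratr (q 0 i) - x 0 i| < k.+1%:R^-1].
have mbox q k : measurable (box q k).
  rewrite (_ : box q k = \bigcap_(i in [set: 'I_n]) [set x | `|ratr (q 0 i) - x
      0 i| < k.+1%:R^-1]); last first.
    by apply/seteqP; split=> x /= h i; [move=> _; exact: h|exact: h].
  apply: fin_bigcap_measurable => // i _.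
  have mf : measurable_fun setT (fun x : 'rV[R]_n => `|ratr (q 0 i) - x 0 i|).
    apply: (measurableT_comp (@normr_measurable R setT)); apply: measurable_funB => //.
    exact: measurable_rV_coord.
  rewrite [X in _.-measurable X](_ : _ =
      (fun x : 'rV[R]_n => `|ratr (q 0 i) - x 0 i|) @^-1` `]-oo, k.+1%:R^-1[).
    by rewrite -[X in measurable X]setTI; exact: mf.
  by apply/seteqP; split => x /=; rewrite in_itv.
pose F (m : nat) : set 'rV[R]_n :=
  if @unpickle ('rV[rat]_n * nat)%type m is Some p then
    (if `[< box p.1 p.2 `<=` O >] then box p.1 p.2 else set0) else set0.
rewrite (_ : O = \bigcup_m F m); last first.
  apply/seteqP; split => [x Ox|x [m _]]; last first.
    by rewrite /F; case: unpickle => // p; case: ifPn => // /asboolP; exact.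
  have /nbhs_ballP[e /= e0 eO] : nbhs x O by exact: open_nbhs_nbhs.
  (* A cube of this size that contains x stays within distance e of x. *)
  have [k ke] : exists k : nat, k.+1%:R^-1 < e / 2.
    have e20 : 0 < e / 2 by rewrite divr_gt0.
    exists (Num.truncn (e / 2)^-1); rewrite -[ltRHS]invrK ltf_pV2 ?posrE ?invr_gt0//.
    exact: Num.Theory.truncnS_gt.
  have k0 : (0 : R) < k.+1%:R^-1 by rewrite invr_gt0.
  have /choice[q qx] : forall i : 'I_n, exists r : rat, `|ratr r - x 0 i| < k.+1%:R^-1.
    move=> i; have [|r] := @rat_in_itvoo R (x 0 i) (x 0 i + k.+1%:R^-1);
        first by rewrite ltrDl.
    rewrite in_itv/= => /andP[r1 r2]; exists r; rewrite ger0_norm ?subr_ge0 ?(ltW r1)//.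
    by rewrite ltrBlDl.
  exists (pickle ((\row_i q i : 'rV[rat]_n), k)) => //; rewrite /F pickleK /=.
  have sub : box (\row_i q i) k `<=` O.
    move=> y yb; apply: eO; split=> // i j; rewrite (ord1 i) /ball/=.
    have := yb j; have := qx j; rewrite mxE => h1 h2.
    rewrite (le_lt_trans (ler_distD (ratr (q j)) _ _))// distrC.
    by rewrite (lt_trans (ltrD h1 h2))// [ltRHS](splitr e) ltrD.
  by rewrite (asboolT sub) => i; rewrite mxE.
apply: bigcupT_measurable => m; rewrite /F; case: unpickle => // p.
by case: ifPn.
Qed.

Lemma within_continuous_measurable n n1 (A : set 'rV[R]_n) (h : 'rV[R]_n -> 'rV[R]_n1) :
  measurable A -> {within A, continuous h} ->
  forall j, measurable_fun A (fun x => h x 0 j).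
Proof.
move=> mA ch j.
have cj : continuous ((fun x => h x 0 j) : subspace A -> R).
  move=> x; apply: (@continuous_comp (subspace A) _ _ h (fun v : 'rV[R]_n1 => v 0 j)).
    exact: ch.
  exact: coord_continuous.
apply: (measurability _ (RGenOpens.measurableE R)).
move=> _ [_ [a [b ->] <-]].
have /open_subspaceP[V oV VE] : open (((fun x => h x 0 j) : subspace A ->
    R) @^-1` `]a, b[).
  by move/continuousP : cj; apply; exact: interval_open.
rewrite setIC -VE setIC; apply: measurableI => //.
exact: open_measurable_rV.
Qed.

End euclidean_topology.

(** * Suprema of the data and assembly of the inequality *)

Section schwarz_bound.
Context {R : realType} (n m n1 : nat).
Hypotheses (hn : (3 <= n)%N) (hm : (2 <= m)%N).
Implicit Types (phi : nat -> 'rV[R]_n -> 'rV[R]_n1) (f : 'rV[R]_n -> 'rV[R]_n1).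

Lemma enormD (x y : 'rV[R]_n1) : enorm (x + y) <= enorm x + enorm y.
Proof.
rewrite -(ler_pXn2r (n := 2))// ?nnegrE ?addr_ge0 ?enorm_ge0//.
rewrite sqr_enorm !dotpE (dotpC y x) sqrrD -!sqr_enorm.
have := dotp_le_enorm x y; lra.
Qed.

Lemma enorm_sum (I : Type) (s : seq I) (P : pred I) (F : I -> 'rV[R]_n1) :
  enorm (\sum_(i <- s | P i) F i) <= \sum_(i <- s | P i) enorm (F i).
Proof.
elim/big_ind2 : _ => //; first by rewrite enorm0.
by move=> x a y b xa yb; rewrite (le_trans (enormD _ _))// lerD.
Qed.

Lemma enorm_le_sup_norm (D : set 'rV[R]_n) (h : 'rV[R]_n -> 'rV[R]_n1) x :
  has_sup [set enorm (h y) | y in D] -> D x -> enorm (h x) <= sup_norm D h.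
Proof. by move=> hs Dx; apply: sup_upper_bound => //; exists x. Qed.

Lemma sphere_north : sphere (north n : 'rV[R]_n).
Proof. exact: enorm_north. Qed.

Lemma oball0 : oball (0 : 'rV[R]_n).
Proof. by rewrite /oball/= enorm0. Qed.

Lemma within_sphere_has_sup (h : 'rV[R]_n -> 'rV[R]_n1) :
  {within sphere, continuous h} -> has_sup [set enorm (h y) | y in sphere].
Proof.
move=> ch; apply: has_sup_enorm => //; first exact: compact_sphere.
by exists (north n); exact: sphere_north.
Qed.

Lemma measurable_cball : measurable (@cball R n).
Proof.
rewrite (_ : cball = @enorm R n @^-1` `]-oo, 1]); last first.
  by apply/seteqP; split => y /=; rewrite in_itv.
by rewrite -[X in measurable X]setTI; apply: measurable_enorm.
Qed.

(** The datum on the ball is measured over the open ball; compactness of the closed ball makes this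
    supremum an actual bound. *)
Lemma within_cball_has_sup (h : 'rV[R]_n -> 'rV[R]_n1) :
  {within cball, continuous h} -> has_sup [set enorm (h y) | y in oball].
Proof.
move=> ch; split; first by exists (enorm (h 0)), 0 => //; exact: oball0.
have [|_ [M MB]] := has_sup_enorm (@compact_cball R n) ch.
  by exists 0; rewrite /cball/= enorm0.
by exists M => _ [y yB <-]; apply: MB; exists y => //; exact: ltW.
Qed.

Lemma capU_axis (x : 'rV[R]_n) : oball x ->
  capU (enorm x *: north n : 'rV[R]_n) = poisson (@cap_sign R n) (enorm x *: north n).
Proof.
by move=> x1; rewrite /capU enormZ enorm_north// mulr1 ger0_norm ?enorm_ge0// x1.
Qed.

Lemma capU_north : capU (north n : 'rV[R]_n) = 1.
Proof.
rewrite /capU enorm_north// ltxx (cap_signE hn sphere_north) northE eqxx.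
by rewrite ltr01 ltr10 subr0.
Qed.

Section solution.
Variables (phi : nat -> 'rV[R]_n -> 'rV[R]_n1) (f : 'rV[R]_n -> 'rV[R]_n1).
Hypothesis sol : bvp_solution m phi f.

(** [bvp_solution] states no continuity for [phi 0]; the boundedness and measurability of the trace
    are taken from f, with which it agrees on the sphere. *)
Let f_sphere : {within sphere, continuous f}.
Proof.
apply: continuous_subspaceW (bvp_continuous sol) => x.
by rewrite /sphere /cball /= => ->.
Qed.

Let sup_f : sup_norm sphere (phi 0) = sup_norm sphere f.
Proof.
rewrite /sup_norm; congr sup; apply/seteqP.
by split => _ [z Sz <-]; exists z => //; rewrite (bvp_trace sol).
Qed.

Lemma trace_bound z : sphere z -> enorm (phi 0 z) <= data_norm m phi 0.
Proof.
move=> Sz; rewrite /data_norm ifF; last by apply/negbTE; case: (m) hm.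
rewrite sup_f (bvp_trace sol)//; apply: enorm_le_sup_norm => //.
exact: within_sphere_has_sup.
Qed.

Lemma measurable_trace j : measurable_fun sphere (fun z => phi 0 z 0 j).
Proof.
apply: (eq_measurable_fun (fun z => f z 0 j)).
  by move=> z; rewrite inE => Sz; rewrite (bvp_trace sol).
by apply: within_continuous_measurable => //; exact: measurable_sphere.
Qed.

(** For k = m the iteration starts from the datum on the ball, otherwise from a Poisson extension,
    which is bounded by the same supremum. The first Green potential gives 1/(2n), and each of the
    other k - 1 one more factor. *)
Lemma enorm_green_term_le k x : (1 <= k <= m)%N -> oball x ->
  enorm (green_term m phi k x) <=
  data_norm m phi k / (2 * n%:R) *
    ((n%:R + 4) / (4 * n%:R * (n%:R + 2))) ^+ (k - 1) * (1 - enorm x ^+ 2).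
Proof.
move=> /andP[k1 km] x1; rewrite /green_term /data_norm.
case: k k1 km => // k _ km; rewrite subSS subn0.
case: eqVneq => [km'|km'].
  have hs := within_cball_has_sup (bvp_data_ball sol).
  rewrite -km' in hs *; apply: enorm_iter_green_le => //.
  - by rewrite (le_trans (enorm_ge0 _) (enorm_le_sup_norm hs oball0)).
  - move=> j; apply: (@measurable_funS _ _ _ _ cball).
    + exact: measurable_cball.
    + by move=> y; exact: ltW.
    + apply: within_continuous_measurable; first exact: measurable_cball.
      by rewrite km'; exact: bvp_data_ball sol.
  - by move=> y; exact: enorm_le_sup_norm.
have cphi : {within sphere, continuous (phi k.+1)}.
  by apply: (@bvp_data_sphere _ _ _ _ _ _ sol k.+1); rewrite /= ltn_neqAle km' km.
have hs := within_sphere_has_sup cphi.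
apply: enorm_iter_green_le => //.
- by rewrite (le_trans (enorm_ge0 _) (enorm_le_sup_norm hs sphere_north)).
- move=> j; apply: measurable_funTS; apply: measurable_poissonV => //.
  by apply: within_continuous_measurable => //; exact: measurable_sphere.
- move=> y y1; apply: enorm_poissonV_le => //.
    by apply: within_continuous_measurable => //; exact: measurable_sphere.
  by move=> z; exact: enorm_le_sup_norm.
Qed.

Lemma schwarz_bound_bvp x : cball x ->
  enorm (f x - ((1 - enorm x ^+ 2) / (1 + enorm x ^+ 2) `^ (n%:R / 2)) *:
                 poissonV (phi 0%N) 0)
  <= data_norm m phi 0 * capU (enorm x *: north n)
     + \sum_(1 <= k < m.+1)
         data_norm m phi k / (2 * n%:R) *
         ((n%:R + 4) / (4 * n%:R * (n%:R + 2))) ^+ (k - 1) *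
         (1 - enorm x ^+ 2).
Proof.
rewrite /cball /= le_eqVlt => /predU1P[x1|x1].
  (* On the sphere [capU] is 1 and every other correction carries the factor 1 - |x|^2 = 0. *)
  rewrite x1 expr1n subrr mul0r scale0r subr0 scale1r capU_north mulr1.
  rewrite big1 ?addr0; last by move=> k _; rewrite mulr0.
  by rewrite -(bvp_trace sol x1) trace_bound.
rewrite (bvp_representation sol x1) addrAC (le_trans (enormD _ _))// lerD//.
  rewrite capU_axis//.
  exact: (enorm_poissonV_sub_le hn measurable_trace trace_bound).
rewrite (le_trans (enorm_sum _ _ _))// big_seq [leRHS]big_seq.
apply: ler_sum => k; rewrite mem_index_iota ltnS => km.
rewrite enormZ normrX normrN1 expr1n mul1r.
exact: enorm_green_term_le.
Qed.

End solution.
End schwarz_bound.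

(** * Radial polynomial solutions *)

Section polynomial_functions.
Context {R : realType} (n n1 : nat).
Implicit Types (x : 'rV[R]_n) (e : 'rV[R]_n1).

(** Polynomial functions as a predicate closed under partial derivatives; the existence and
    continuity of all iterated partials follow by induction. *)
Inductive polyfun : ('rV[R]_n -> R) -> Prop :=
| polyfun_cst (c : R) : polyfun (fun=> c)
| polyfun_coord i : polyfun (fun x => x 0 i)
| polyfun_add p q : polyfun p -> polyfun q -> polyfun (p + q)
| polyfun_mul p q : polyfun p -> polyfun q -> polyfun (p * q).

Lemma is_derive_coord (j : 'I_n) x v :
  is_derive x v (fun y : 'rV[R]_n => y 0 j) (v 0 j).
Proof.
have lim : (fun h : R => h^-1 *: (((fun y : 'rV[R]_n => y 0 j) \o shift x) (h
    *: v) - x 0 j))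
    @ 0^' --> v 0 j.
  apply: cvg_near_cst; near=> h.
  rewrite /= !mxE addrK /GRing.scale/= mulKf//.
  by near: h; exact: nbhs_dnbhs_neq.
apply: DeriveDef; first by apply/cvg_ex; exists (v 0 j).
exact: cvg_lim lim.
Unshelve. all: by end_near. Qed.

Lemma is_derive_scalel (p : 'rV[R]_n -> R) e x v (dp : R) :
  is_derive x v p dp -> is_derive x v (fun y => p y *: e) (dp *: e).
Proof.
move=> [dvp Dp].
have lim : (fun h : R => h^-1 *: (((fun y => p y *: e) \o shift x) (h *: v) - p x *: e))
    @ 0^' --> dp *: e.
  rewrite (_ : (fun h : R => _) =
      fun h : R => (h^-1 *: ((p \o shift x) (h *: v) - p x)) *: e).
    by apply: cvgZr_tmp; rewrite -Dp; exact: dvp.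
  by apply/funext => h; rewrite /= -scalerBl scalerA.
apply: DeriveDef; first by apply/cvg_ex; exists (dp *: e).
exact: cvg_lim lim.
Qed.

Lemma polyfun_derive (p : 'rV[R]_n -> R) v : polyfun p ->
  exists2 q, polyfun q & forall x, is_derive x v p (q x).
Proof.
elim=> [c|i|{}p q _ [p' pp' dp] _ [q' pq' dq]|{}p q pp [p' pp' dp] pq [q' pq' dq]].
- by exists (fun=> 0); [exact: polyfun_cst|move=> x; exact: is_derive_cst].
- exists (fun=> v 0 i); first exact: polyfun_cst.
  by move=> x; exact: is_derive_coord.
- exists (p' + q'); first exact: polyfun_add.
  by move=> x; have := dp x; have := dq x; move=> ? ?; exact: is_deriveD.
- exists (p * q' + q * p'); first by apply: polyfun_add; exact: polyfun_mul.
  by move=> x; have := dp x; have := dq x; move=> ? ?; exact: is_deriveM.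
Qed.

Lemma polyfun_continuous p : polyfun p -> continuous p.
Proof.
elim=> [c|i|{}p q _ cp _ cq|{}p q _ cp _ cq] x.
- exact: cst_continuous.
- exact: coord_continuous.
- by apply: continuousD; [exact: cp|exact: cq].
- by apply: continuousM; [exact: cp|exact: cq].
Qed.

Lemma partials_polyfun (p : 'rV[R]_n -> R) e (s : seq 'I_n) : polyfun p ->
  exists2 q, polyfun q & partials s (fun x => p x *: e) = (fun x => q x *: e).
Proof.
move=> pp; elim: s => [|i s [q pq /= ->]]; first by exists p.
have [q' pq' dq] := polyfun_derive (@basis_vec R n i) pq.
exists q' => //; apply/funext => x.
by have [_ ->] := is_derive_scalel e (dq x).
Qed.

Lemma continuous_scalel (p : 'rV[R]_n -> R) e : continuous p ->
  continuous (fun x => p x *: e).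
Proof. by move=> cp x; exact: (cvgZr_tmp (cp x)). Qed.

Lemma smooth_on_polyfun k D (p : 'rV[R]_n -> R) e : polyfun p ->
  smooth_on k D (fun x => p x *: e).
Proof.
move=> pp s; have [q pq ->] := partials_polyfun e s pp; split=> _ x.
  by move=> _; apply: continuous_scalel; exact: polyfun_continuous.
move=> i _; have [q' _ dq] := polyfun_derive (@basis_vec R n i) pq.
by have [] := is_derive_scalel e (dq x).
Qed.

Lemma polyfun_radial (p : {poly R}) : polyfun (fun x => p.[dotp x x]).
Proof.
have pd : polyfun (fun x => dotp x x).
  rewrite (_ : (fun x => _) =
      \sum_(i < n) ((fun x : 'rV[R]_n => x 0 i) * (fun x => x 0 i))).
    elim/big_ind : _ => [|q q' pq pq'|i _]; first exact: (polyfun_cst 0).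
      exact: polyfun_add.
    by apply: polyfun_mul; exact: polyfun_coord.
  by apply/funext => x; rewrite fct_sumE.
elim/poly_ind: p => [|p c IH].
  rewrite (_ : (fun x => _) = fun=> 0); first exact: polyfun_cst.
  by apply/funext => x; rewrite horner0.
rewrite (_ : (fun x => _) = (fun x => p.[dotp x x]) * (fun x => dotp x x) + (fun=> c)).
  by apply: polyfun_add; [exact: polyfun_mul|exact: polyfun_cst].
by apply/funext => x; rewrite hornerD hornerMX hornerC.
Qed.

End polynomial_functions.

(** * The Laplacian on polynomials in |x|^2 *)

Section radial_laplacian.
Context {R : realType} (n n1 : nat).
Implicit Types (x : 'rV[R]_n) (e : 'rV[R]_n1) (p q : {poly R}).

Definition radial e p x : 'rV[R]_n1 := p.[dotp x x] *: e.

(** The Laplacian on coefficients in t = |x|^2, from Delta |x|^(2k) = 2k(2k + n - 2) |x|^(2k-2) at k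
    = i + 1. *)
Definition radial_lap p : {poly R} :=
  \poly_(i < size p) (2 * i.+1%:R * ((2 * i)%:R + n%:R) * p`_i.+1).

Lemma coef_radial_lap p i :
  (radial_lap p)`_i = 2 * i.+1%:R * ((2 * i)%:R + n%:R) * p`_i.+1.
Proof.
rewrite coef_poly; case: ltnP => // h.
by rewrite nth_default ?mulr0// (leq_trans h).
Qed.

(** The differential form 4t p'' + 2n p' is what partial differentiation produces; the coefficient
    form is the one that can be inverted. *)
Lemma radial_lapE p :
  radial_lap p = 4 *: ('X * deriv (deriv p)) + (2 * n%:R) *: deriv p.
Proof.
apply/polyP => i; rewrite coef_radial_lap coefD !coefZ coefXM !coef_deriv.
case: i => [|i] /=.
  by rewrite muln0 mulr1n (_ : 0%:R = 0 :> R)// mulr0 add0r mulr1 add0r.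
rewrite -[p`_i.+2 *+ i.+2]mulr_natr -[_ *+ i.+1]mulr_natr natrM.
rewrite -[i.+2%:R]natr1 -[i.+1%:R]natr1.
by move: (p`_i.+2) (i%:R : R) (n%:R : R) => a b c; ring.
Qed.

Lemma is_derive_dotp x (i : 'I_n) :
  is_derive x (@basis_vec R n i) (fun y : 'rV[R]_n => dotp y y) (2 * x 0 i).
Proof.
pose c j (y : 'rV[R]_n) := y 0 j.
have dc j : is_derive x (@basis_vec R n i) (c j) (i == j)%:R.
  have := is_derive_coord j x (@basis_vec R n i).
  by rewrite /basis_vec mxE eqxx eq_sym.
have := @is_derive_sum _ _ _ n (fun j => c j *
    c j) x (@basis_vec R n i) _ (fun j => is_deriveM (dc j) (dc j)).
rewrite (_ : \sum_(_ < n) _ = (fun y : 'rV[R]_n => dotp y y)); last first.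
  by apply/funext => y; rewrite fct_sumE.
move=> H; apply: (is_derive_eq H).
rewrite (bigD1 i)//= eqxx big1 ?addr0; first by rewrite /GRing.scale/= /c; ring.
by move=> j ji; rewrite eq_sym (negbTE ji) !scaler0 addr0.
Qed.

Lemma is_derive_radial p x (i : 'I_n) :
  is_derive x (@basis_vec R n i) (fun y : 'rV[R]_n => p.[dotp y y])
    (2 * x 0 i * (deriv p).[dotp x x]).
Proof.
elim/poly_ind: p => [|p c IH].
  rewrite deriv0 horner0 mulr0 (_ : (fun y => _) = cst 0); first exact: is_derive_cst.
  by apply/funext => y; rewrite horner0.
have d := is_derive_dotp x i.
rewrite (_ : (fun y => _) =
    (fun y => p.[dotp y y]) * (fun y : 'rV[R]_n => dotp y y) + cst c); last first.
  by apply/funext => y; rewrite hornerD hornerMX hornerC.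
have H := is_deriveD (is_deriveM IH d) (is_derive_cst c x (@basis_vec R n i)).
apply: (is_derive_eq H).
rewrite derivD derivM derivX derivC !addr0 mulr1 hornerD hornerMX /GRing.scale/=.
by ring.
Qed.

Lemma laplacian_radial e p : laplacian (radial e p) = radial e (radial_lap p).
Proof.
apply/funext => x; rewrite /laplacian.
have D1 i : 'D_(@basis_vec R n i) (radial e p) =
    (fun y => (2 * y 0 i * (deriv p).[dotp y y]) *: e).
  by apply/funext => y; have [_ ->] := is_derive_scalel e (is_derive_radial p y i).
under eq_bigr => i _.
  rewrite D1.
  have dc : is_derive x (@basis_vec R n i) (fun y : 'rV[R]_n => y 0 i) 1.
    by have := is_derive_coord i x (@basis_vec R n i); rewrite /basis_vec mxE !eqxx.
  have H := is_deriveM (is_deriveM (is_derive_cst (2 : R) x (@basis_vec R n i)) dc)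
    (is_derive_radial (deriv p) x i).
  have [_ ->] := is_derive_scalel e H.
  over.
rewrite -scaler_suml /radial radial_lapE; congr (_ *: e).
rewrite hornerD !hornerZ hornerM hornerX.
transitivity (\sum_(i < n) (4 * (x 0 i * x 0 i) *
    (deriv (deriv p)).[dotp x x] + 2 * (deriv p).[dotp x x])).
  apply: eq_bigr => i _.
  transitivity (2 * x 0 i * (2 * x 0 i * (deriv (deriv p)).[dotp x x]) +
    (deriv p).[dotp x x] * (2 * 1 + x 0 i * 0)); first by [].
  by ring.
rewrite big_split /= -mulr_suml -mulr_sumr -/(dotp x x) sumr_const card_ord -mulr_natl.
by ring.
Qed.

Lemma iter_laplacian_radial e p j :
  iter j (@laplacian R n n1) (radial e p) = radial e (iter j radial_lap p).
Proof. by elim: j => //= j ->; exact: laplacian_radial. Qed.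

(** Hence the m-th iterate kills every polynomial of size at most m. *)
Lemma size_iter_radial_lap p j : (size (iter j radial_lap p) <= size p - j)%N.
Proof.
elim: j => [|j IH]; first by rewrite subn0.
apply/leq_sizeP => i hi; rewrite iterS coef_radial_lap nth_default ?mulr0//.
by apply: (leq_trans IH); rewrite -[i.+1]add1n -leq_subLR subn1 -subnS.
Qed.

(** For a radial function, x -> f(rx) is the dilation of t = |x|^2 by r^2; the boundary conditions
    are stated on such functions. *)
Definition dilate (c : R) p : {poly R} := \poly_(i < size p) (c ^+ i * p`_i).

Lemma coef_dilate c p i : (dilate c p)`_i = c ^+ i * p`_i.
Proof. by rewrite coef_poly; case: ltnP => // h; rewrite nth_default ?mulr0. Qed.

Lemma horner_dilate c p t : (dilate c p).[t] = p.[c * t].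
Proof.
rewrite horner_poly horner_coef; apply: eq_bigr => i _.
by rewrite exprMn; ring.
Qed.

Lemma iter_radial_lap_dilate c p j :
  iter j radial_lap (dilate c p) = c ^+ j *: dilate c (iter j radial_lap p).
Proof.
elim: j => [|j /= ->]; first by rewrite expr0 scale1r.
apply/polyP => i; rewrite !(coef_radial_lap, coefZ, coef_dilate) !exprS.
by ring.
Qed.

End radial_laplacian.

(** * The Green potential on polynomials in |x|^2 *)

Section radial_potentials.
Context {R : realType} (n n1 : nat).
Hypothesis hn : (3 <= n)%N.
Local Notation L := (@rV_lebesgue R n).
Implicit Types (x : 'rV[R]_n) (e : 'rV[R]_n1) (p q : {poly R}).

(** The preimage of p under [radial_lap] that has no constant term. *)
Definition radial_prim p : {poly R} :=
  \poly_(i < (size p).+1)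
    (if i is j.+1 then p`_j / (2 * j.+1%:R * ((2 * j)%:R + n%:R)) else 0).

(** The solution of -Delta u = p that vanishes at t = 1. *)
Definition radial_green p : {poly R} := (radial_prim p).[1]%:P - radial_prim p.

Lemma coef_radial_prim p i : (radial_prim p)`_i =
  if i is j.+1 then p`_j / (2 * j.+1%:R * ((2 * j)%:R + n%:R)) else 0.
Proof.
rewrite coef_poly ltnS; case: i => [|i]; first by rewrite leq0n.
by case: ltnP => // h; rewrite nth_default ?mul0r.
Qed.

Lemma radial_primD p q : radial_prim (p + q) = radial_prim p + radial_prim q.
Proof.
apply/polyP => -[|i]; rewrite coefD !coef_radial_prim ?addr0//.
by rewrite coefD mulrDl.
Qed.

Lemma radial_greenD p q : radial_green (p + q) = radial_green p + radial_green q.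
Proof.
by rewrite /radial_green radial_primD hornerD polyCD opprD addrACA.
Qed.

Lemma radial_greenZ c p : radial_green (c *: p) = c *: radial_green p.
Proof.
have E : radial_prim (c *: p) = c *: radial_prim p.
  apply/polyP => -[|i]; rewrite coefZ !coef_radial_prim ?mulr0//.
  by rewrite coefZ mulrA.
by rewrite /radial_green E hornerZ scalerBr polyCM mul_polyC.
Qed.

Lemma radial_green_lap q : radial_green (radial_lap n q) = q.[1]%:P - q.
Proof.
have E : radial_prim (radial_lap n q) = q - (q`_0)%:P.
  apply/polyP => -[|i]; rewrite coefB coefC coef_radial_prim ?subrr//= subr0.
  rewrite coef_radial_lap mulrC mulKf// !mulf_neq0 ?pnatr_eq0//.
  by rewrite -natrD pnatr_eq0 -lt0n ltn_addl// (leq_trans _ hn).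
rewrite /radial_green E hornerD hornerN hornerC polyCB.
by rewrite opprB addrA subrK.
Qed.

Lemma integral_green_radial p x : oball x ->
  \int[L]_(y in oball) (green_kernel x y * p.[dotp y y]) =
  (radial_green p).[dotp x x].
Proof.
move=> x1; rewrite (@Rintegral_green_pos R n hn x (fun y => p.[dotp y y])); last first.
  apply: measurable_funTS.
  apply: (@measurableT_comp _ _ _ _ _ _ (horner p) _ (fun y : 'rV[R]_n => dotp y y)).
    by apply: continuous_measurable_fun; exact: continuous_horner.
  exact: measurable_dotp.
rewrite /Rintegral (integral_oball_green_pos x (fun y => p.[dotp y y])).
have mT : measurable [set: 'rV[R]_n] by [].
rewrite (eq_integral (fun y => \sum_(i < size p)
    ((p`_i)%:E * (green_pos x y * dotp y y ^+ i)%:E)))%E; last first.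
  move=> y _; rewrite horner_coef mulr_sumr sumEFin; congr EFin.
  by apply: eq_bigr => i _; ring.
rewrite integral_sum//; last first.
  by move=> i; apply: integrableZl => //; exact: integrable_green_pos_power.
under eq_bigr => i _.
  rewrite (integralZl mT (integrable_green_pos_power hn i x1)).
  rewrite (integral_green_pos hn i x1) -EFinM; over.
rewrite sumEFin /= /radial_green hornerD hornerN hornerC.
rewrite !horner_poly !big_ord_recl /= !mul0r !add0r -sumrB.
by apply: eq_bigr => i _; rewrite /bump /= add1n expr1n; ring.
Qed.

Lemma green_radial e p x : oball x ->
  green (radial e p) x = radial e (radial_green p) x.
Proof.
move=> x1; apply/rowP => j; rewrite !mxE.
have -> : (radial_green p).[dotp x x] * e 0 j =
    (radial_green (e 0 j *: p)).[dotp x x].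
  by rewrite radial_greenZ hornerZ mulrC.
rewrite -(integral_green_radial (e 0 j *: p) x1).
by apply: eq_Rintegral => y _; rewrite /radial mxE hornerZ [e 0 j * _]mulrC.
Qed.

Lemma poissonV_cst e x : oball x -> poissonV (fun=> e) x = e.
Proof.
move=> x1; apply/rowP => j; rewrite mxE /poisson /Rintegral.
have mS := @measurable_sphere R n.
rewrite (eq_integral (fun z => (e 0 j)%:E * (poisson_kernel x z)%:E))%E; last first.
  by move=> z _; rewrite -EFinM mulrC.
rewrite (integralZl mS (integrable_poisson_kernel hn x1)).
by rewrite (integral_poisson_kernel hn x1) mule1.
Qed.

Lemma eq_green (h k : 'rV[R]_n -> 'rV[R]_n1) x :
  (forall y, oball y -> h y = k y) -> green h x = green k x.
Proof.
move=> hk; apply/rowP => j; rewrite !mxE.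
by apply: eq_Rintegral => y; rewrite inE => /hk ->.
Qed.

(** The agreement with a radial polynomial holds only in the ball, which is all that the next Green
    integral sees. *)
Lemma iter_green_radial (h : 'rV[R]_n -> 'rV[R]_n1) e p k x :
  (forall y, oball y -> h y = radial e p y) -> oball x ->
  iter k (@green R n n1) h x = radial e (iter k radial_green p) x.
Proof.
move=> hp; elim: k x => [|k IH] x x1 /=; first exact: hp.
by rewrite (eq_green _ IH) green_radial.
Qed.

End radial_potentials.

(** * Radial polynomials as solutions *)

Section radial_solutions.
Context {R : realType} (n n1 : nat).
Hypothesis hn : (3 <= n)%N.
Implicit Types (x : 'rV[R]_n) (e : 'rV[R]_n1) (p q : {poly R}).

Lemma iter_radial_greenD k p q :
  iter k (radial_green n) (p + q) =
  iter k (radial_green n) p + iter k (radial_green n) q.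
Proof. by elim: k => //= k ->; rewrite radial_greenD. Qed.

Lemma iter_radial_green0 k : iter k (radial_green n) (0 : {poly R}) = 0.
Proof.
elim: k => //= k ->.
by rewrite -[X in radial_green _ X](scale0r (0 : {poly R})) radial_greenZ scale0r.
Qed.

(** Write D and G for the Laplacian and the Green potential, and b_k = G^k[D^k p]. The constant (D^k
    p)(1) is D^k p + G[D^(k+1) p], so the k-th term is (-1)^k (b_k + b_(k+1)) and the sum is (-1)^m
    b_(m+1) - b_1. Here b_(m+1) = 0 by degree and b_1 = p(1) - p = -p. *)
Lemma radial_green_telescope p m : p.[1] = 0 -> (size p <= m)%N ->
  \sum_(1 <= k < m.+1) (-1) ^+ k *:
    iter k (radial_green n) ((iter k (radial_lap n) p).[1]%:P) = p.
Proof.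
move=> p1 pm; pose b k := iter k (radial_green n) (iter k (radial_lap n) p).
have bE k : iter k (radial_green n) ((iter k (radial_lap n) p).[1]%:P) =
    b k + b k.+1.
  rewrite /b iterSr [in iter k.+1 (radial_lap n) p]iterS (radial_green_lap hn).
  by rewrite -iter_radial_greenD addrC subrK.
transitivity ((-1) ^+ m *: b m.+1 - b 1%N); last first.
  have : (size (iter m.+1 (radial_lap n) p) <= 0)%N.
    rewrite (leq_trans (size_iter_radial_lap _ _ _))//.
    by rewrite leqn0 subn_eq0 leqW.
  rewrite leqn0 size_poly_eq0 => /eqP b0.
  rewrite /b b0 iter_radial_green0 scaler0 add0r /= (radial_green_lap hn) p1.
  by rewrite polyC0 add0r opprK.
clearbody b; clear pm; elim: m => [|m IH];
    first by rewrite big_geq// expr0 scale1r subrr.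
rewrite big_nat_recr// IH bE [LHS]/= exprS mulN1r !scaleNr scalerDr opprD.
by rewrite addrACA subrr add0r addrC.
Qed.

Variable m : nat.

(** All data are constants, the boundary values of the iterated Laplacians. The Poisson integral
    fixes constants in the ball, so the representation is the telescoping identity; for k = m the
    constant is 0 by degree. *)
Lemma bvp_solution_radial e p : p.[1] = 0 -> (size p <= m)%N ->
  bvp_solution m (fun k _ => (iter k (radial_lap n) p).[1] *: e)
    (radial e p : 'rV[R]_n -> 'rV[R]_n1).
Proof.
move=> p1 pm.
have sphere1 z : sphere z -> dotp z z = 1 :> R.
  by rewrite /sphere/= -sqr_enorm => ->; rewrite expr1n.
have radial_cont : continuous (radial e p : 'rV[R]_n -> 'rV[R]_n1).
  by apply: continuous_scalel; apply: polyfun_continuous; exact: polyfun_radial.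
split.
- by apply: continuous_subspaceT => x; exact: cst_continuous.
- by move=> k _; apply: continuous_subspaceT => x; exact: cst_continuous.
- by apply: smooth_on_polyfun; exact: polyfun_radial.
- exact: continuous_subspaceT.
- move=> x _; rewrite iter_laplacian_radial.
  have : (size (iter m (radial_lap n) p) <= 0)%N.
    rewrite (leq_trans (size_iter_radial_lap _ _ _))//.
    by rewrite leqn0 subn_eq0.
  rewrite leqn0 size_poly_eq0 => /eqP ->.
  by rewrite /radial !horner0 !scale0r.
- move=> j _ z /sphere1 z1.
  have E r : (fun x : 'rV[R]_n => radial e p (r *: x)) =
      radial e (dilate (r ^+ 2) p).
    apply/funext => x; rewrite /radial horner_dilate; congr (p.[_] *: e).
    by rewrite !dotpE; ring.
  rewrite (_ : (fun r : R => _) = fun r =>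
    ((r ^+ 2) ^+ j * (iter j (radial_lap n) p).[r ^+ 2]) *: e); last first.
    apply/funext => r; rewrite E iter_laplacian_radial iter_radial_lap_dilate.
    by rewrite /radial hornerZ horner_dilate z1 mulr1.
  (* The expression is a polynomial in r, so the radial limit is its value at 1. *)
  pose q := ('X^2) ^+ j * (iter j (radial_lap n) p \Po 'X^2).
  rewrite (_ : (fun r : R => _) = fun r => q.[r] *: e); last first.
    apply/funext => r.
    by rewrite /q hornerM horner_exp hornerXn horner_comp hornerXn.
  rewrite (_ : (iter j (radial_lap n) p).[1] = q.[1]); last first.
    by rewrite /q hornerM horner_exp hornerXn horner_comp hornerXn !expr1n mul1r.
  apply: cvg_at_left_filter.
  exact: (cvgZr_tmp (@continuous_horner R q 1)).
- by move=> z /sphere1 z1; rewrite /radial z1.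
- move=> x x1; rewrite (poissonV_cst hn)//= p1 scale0r add0r.
  under eq_bigr => k _.
    rewrite (_ : green_term m _ k x = radial e (iter k (radial_green n)
        ((iter k (radial_lap n) p).[1]%:P)) x); last first.
      rewrite /green_term.
      have [->|_] := eqVneq k m; apply: (iter_green_radial hn) => // y y1.
        by rewrite /radial hornerC.
      by rewrite (poissonV_cst hn)// /radial hornerC.
    rewrite /radial scalerA; over.
  rewrite -scaler_suml /radial -[in LHS](radial_green_telescope p1 pm).
  rewrite horner_sum; congr (_ *: e).
  by apply: eq_bigr => k _; rewrite hornerZ.
Qed.

End radial_solutions.

Lemma sup_norm_sphere0 (R : realType) (n n1 : nat) (hn : (3 <= n)%N)
    (h : 'rV[R]_n -> 'rV[R]_n1) :
  (forall z, sphere z -> h z = 0) -> sup_norm sphere h = 0.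
Proof.
move=> h0; rewrite /sup_norm (_ : [set _ | _ in _] = [set 0]) ?sup1//.
apply/seteqP; split=> [_ [z Sz <-]|_ ->] /=; first by rewrite h0// enorm0.
by exists (north n); [exact: sphere_north|rewrite h0 ?enorm0//; exact: sphere_north].
Qed.

Theorem theorem1p1 (R : realType) (n m n1 : nat)
    (hn : (3 <= n)%N) (hm : (2 <= m)%N) (hn1 : (1 <= n1)%N) :
  (forall (phi : nat -> 'rV[R]_n -> 'rV[R]_n1) (f : 'rV[R]_n -> 'rV[R]_n1),
     bvp_solution m phi f ->
     forall x : 'rV[R]_n, cball x ->
     enorm (f x - ((1 - enorm x ^+ 2) / (1 + enorm x ^+ 2) `^ (n%:R / 2)) *:
                    poissonV (phi 0%N) 0)
     <= data_norm m phi 0 * capU (enorm x *: north n)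
        + \sum_(1 <= k < m.+1)
            data_norm m phi k / (2 * n%:R) *
            ((n%:R + 4) / (4 * n%:R * (n%:R + 2))) ^+ (k - 1) *
            (1 - enorm x ^+ 2))
  /\
  (forall M : R, 0 < M ->
     let f := (fun x : 'rV[R]_n => \row_(j < n1)
       if (val j == 0)%N then M * (1 - enorm x ^+ (2 * (m - 1))) else 0) in
     exists2 phi : nat -> 'rV[R]_n -> 'rV[R]_n1, bvp_solution m phi f &
     forall x : 'rV[R]_n, sphere x ->
     enorm (f x - ((1 - enorm x ^+ 2) / (1 + enorm x ^+ 2) `^ (n%:R / 2)) *:
                    poissonV (phi 0%N) 0)
     = data_norm m phi 0 * capU (enorm x *: north n)
        + \sum_(1 <= k < m.+1)
            data_norm m phi k / (2 * n%:R) *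
            ((n%:R + 4) / (4 * n%:R * (n%:R + 2))) ^+ (k - 1) *
            (1 - enorm x ^+ 2)).
Proof.
split=> [phi f sol x|M M0 f]; first exact: schwarz_bound_bvp.
pose e : 'rV[R]_n1 := \row_j (val j == 0)%:R.
(* The mapping in the variable t = |x|^2; its degree m - 1 is the largest that the bound on the size
   in [bvp_solution_radial] admits. *)
pose p : {poly R} := M *: (1 - 'X^(m.-1)).
have fE : f = radial e p.
  apply/funext => x; apply/rowP => j; rewrite !mxE /p hornerZ hornerD hornerN.
  rewrite hornerXn hornerC exprM sqr_enorm subn1.
  by case: ifP => _; rewrite ?mulr1 ?mulr0.
have p1 : p.[1] = 0.
  by rewrite /p hornerZ hornerD hornerN hornerXn hornerC expr1n subrr mulr0.
have pm : (size p <= m)%N.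
  rewrite (leq_trans (size_scale_leq _ _))// (leq_trans (size_polyD _ _))//.
  rewrite size_polyN size_polyXn size_poly1 geq_max prednK ?leqnn ?andbT//.
    exact: ltnW.
  exact: ltnW.
exists (fun k _ => (iter k (radial_lap n) p).[1] *: e).
  by rewrite fE; exact: bvp_solution_radial.
move=> x x1; have d1 : enorm x = 1 := x1.
rewrite fE /radial -sqr_enorm d1 expr1n p1 subrr mul0r !scale0r subr0 enorm0.
rewrite big1 ?addr0; last by move=> k _; rewrite mulr0.
rewrite /data_norm ifF; last by apply: negbTE; rewrite eq_sym -lt0n ltnW.
by rewrite sup_norm_sphere0 ?mul0r// => z _ /=; rewrite p1 scale0r.
Qed.
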